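(* Let $X$ be a complex Banach space, $E=\ell^2(\mathbb Z,X)$, let $A\in L(E)$ be tridiagonal, let $n\in\mathbb N$, and put $$\varepsilon'_n:=2(\|\alpha\|_\infty+\|\gamma\|_\infty)\sin\frac{\pi}{2n}.$$ Let $\mathfrak a,\mathfrak c\in\ell^\infty(\mathbb Z,L(X))$ with $\|\mathfrak a\|_\infty\le\|\alpha\|_\infty$ and $\|\mathfrak c\|_\infty\le\|\gamma\|_\infty$. Then $$\mathrm{spec}_\varepsilon A\subset\pi^{n,\mathfrak a,\mathfrak c}_{\varepsilon+\varepsilon'_n}(A),\quad\varepsilon>0;$$ moreover, if $X$ has Globevnik's property, $\mathrm{Spec}_\varepsilon A\subset\Pi^{n,\mathfrak a,\mathfrak c}_{\varepsilon+\varepsilon'_n}(A)$ for $\varepsilon\ge0$. In particular, for every $t\in\mathbb C$ with $|t|=1$, $$\mathrm{spec}_\varepsilon A\subset\pi^{n,t}_{\varepsilon+\varepsilon'_n}(A),\quad\varepsilon>0,$$ and, if $X$ has Globevnik's property, $\mathrm{Spec}_\varepsilon A\subset\Pi^{n,t}_{\varepsilon+\varepsilon'_n}(A)$ for $\varepsilon\ge0$.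
   Context: $E=\ell^2(\mathbb Z,X)$ has norm $(\sum_j\|x_j\|_X^2)^{1/2}$. Tridiagonal: $(Ax)_i=\alpha_{i-1}x_{i-1}+\beta_ix_i+\gamma_{i+1}x_{i+1}$ with bounded sequences $\alpha,\beta,\gamma$ in $L(X)$, i.e. matrix entries $a_{j+1,j}=\alpha_j$, $a_{j,j}=\beta_j$, $a_{j-1,j}=\gamma_j$, zeros elsewhere; $\|\alpha\|_\infty:=\sup_j\|\alpha_j\|_{L(X)}$, etc. Pseudospectra: for $B\in L(Y)$, $Y$ a complex Banach space, with $\|C^{-1}\|:=\infty$ if $C$ is not invertible and $1/\infty:=0$, $\mathrm{Spec}_\varepsilon B:=\{\lambda:1/\|(B-\lambda I)^{-1}\|\le\varepsilon\}$ for $\varepsilon>0$ (closed), $\mathrm{Spec}_0B:=\mathrm{Spec}\,B$ (the spectrum), and $\mathrm{spec}_\varepsilon B:=\{\lambda:1/\|(B-\lambda I)^{-1}\|<\varepsilon\}$ for $\varepsilon>0$ (open). $A_{n,k}:=[a_{i,j}]_{i,j=k+1}^{k+n}$; $A^{\mathfrak a,\mathfrak c}_{n,k}:=A_{n,k}+B^{\mathfrak a,\mathfrak c}_{n,k}$, where $B^{\mathfrak a,\mathfrak c}_{n,k}$ is the $n\times n$ matrix with $(i,j)$ entry $\delta_{i,1}\delta_{j,n}\mathfrak a_k+\delta_{i,n}\delta_{j,1}\mathfrak c_k$; these act on $X^n$ with norm $(\sum_{j=1}^n\|\xi_j\|_X^2)^{1/2}$. For $|t|=1$, $A^{\mathrm{per},t}_{n,k}$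 is $A^{\mathfrak a,\mathfrak c}_{n,k}$ with $\mathfrak a_k:=t\alpha_k$, $\mathfrak c_k:=\bar t\gamma_{k+n+1}$. Define $$\pi^{n,\mathfrak a,\mathfrak c}_\varepsilon(A):=\bigcup_{k\in\mathbb Z}\mathrm{spec}_\varepsilon A^{\mathfrak a,\mathfrak c}_{n,k}\ (\varepsilon>0),\qquad\Pi^{n,\mathfrak a,\mathfrak c}_\varepsilon(A):=\overline{\bigcup_{k\in\mathbb Z}\mathrm{Spec}_\varepsilon A^{\mathfrak a,\mathfrak c}_{n,k}}\ (\varepsilon\ge0),$$ and $\pi^{n,t}_\varepsilon(A)$, $\Pi^{n,t}_\varepsilon(A)$ in the same way with $A^{\mathrm{per},t}_{n,k}$ in place of $A^{\mathfrak a,\mathfrak c}_{n,k}$. A Banach space $Y$ has Globevnik's property if $Y$ is finite-dimensional or $Y$ or $Y^*$ is complex uniformly convex (for every $\epsilon>0$ there is $\delta>0$ such that $\|y\|\ge\epsilon$ and $\|x+\zeta y\|\le1$ for all $|\zeta|\le1$ imply $\|x\|\le1-\delta$).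
   Formalization: The two closed inclusions Spec_ε A ⊂ Π_{ε+ε'_n}(A) are proved when ε+ε'_n > 0 or X is finite-dimensional; for ε = 0, α = γ = 0 and infinite-dimensional X they can fail (diagonal A built from growing nilpotent Jordan blocks). *)

(* Defs.v *)
From HB Require Import structures.
From mathcomp Require Import all_boot all_order all_algebra.
From mathcomp Require Import complex ring lra.
From mathcomp Require Import all_classical all_reals all_analysis.

Set Implicit Arguments.
Unset Strict Implicit.
Unset Printing Implicit Defensive.
Import Order.TTheory GRing.Theory Num.Theory.
Import numFieldNormedType.Exports.

Local Open Scope classical_set_scope.
Local Open Scope ring_scope.
Local Open Scope complex_scope.

(* In a normed module over R[i], `|x| lies in R[i]; rnorm is the same number
   seen in R, see rnormE. *)
Definition rnorm {R : realType} {V : normedModType R[i]} (x : V) : R :=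
  complex.Re `|x|.

Section rnorm_theory.
Variables (R : realType) (V : normedModType R[i]).
Implicit Types x y : V.

Lemma rnormE x : `|x| = (rnorm x)%:C.
Proof.
have := normr_ge0 x; rewrite /rnorm; case: `|x| => a b.
by rewrite lecE/= => /andP[/eqP -> _].
Qed.

Lemma rnorm_ge0 x : 0 <= rnorm x.
Proof. by have := normr_ge0 x; rewrite rnormE ler0c. Qed.

Lemma rnormD x y : rnorm (x + y) <= rnorm x + rnorm y.
Proof. by have := ler_normD x y; rewrite !rnormE -rmorphD/= lecR. Qed.

Lemma rnormZ (l : R[i]) x : rnorm (l *: x) = rnorm (l : R[i]^o) * rnorm x.
Proof.
by apply/complexI; rewrite rmorphM/= -!rnormE normrZ.
Qed.

Lemma rnorm0_eq0 x : rnorm x = 0 -> x = 0.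
Proof. by move=> x0; apply/normr0_eq0; rewrite rnormE x0. Qed.

Lemma rnorm0 : rnorm (0 : V) = 0.
Proof. by rewrite /rnorm normr0. Qed.

End rnorm_theory.

(* l^2(I, X), as square-summable functions on an arbitrary index type I: the
   case I = int is l^2(Z, X), and the case I = 'I_n is X^n with the norm
   (sum_j ||xi_j||^2)^(1/2), see ell2_ord_finite and ell2_ord_normE. *)
Definition ell2_sum {R : realType} {I : choiceType} {X : normedModType R[i]}
  (x : I -> X) : \bar R := (\esum_(i in [set: I]) ((rnorm (x i)) ^+ 2)%:E)%E.

Definition ell2_pred {R : realType} {I : choiceType} {X : normedModType R[i]} :
  {pred I -> X} := [pred x | (ell2_sum x < +oo)%E].

Record ell2 {R : realType} (I : choiceType) (X : normedModType R[i]) :=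
  Ell2 { ell2_fun :> I -> X ; ell2P : ell2_fun \in ell2_pred }.

Section ell2_sum_theory.
Variables (R : realType) (I : choiceType) (X : normedModType R[i]).
Implicit Types x y : I -> X.

Lemma ell2_sum_ge0 x : (0 <= ell2_sum x)%E.
Proof. by apply: esum_ge0 => i _; rewrite lee_fin sqr_ge0. Qed.

Lemma ell2_sum_ge x i : ((rnorm (x i) ^+ 2)%:E <= ell2_sum x)%E.
Proof.
apply: esum_ge; exists [set i]; last by rewrite fsbig_set1.
by split=> //; exact: finite_set1.
Qed.

Lemma ell2_sum0 : ell2_sum (0 : I -> X) = 0%E.
Proof. by apply: esum1 => i _; rewrite rnorm0 expr0n. Qed.

Lemma esumZl (k : R) (f : I -> \bar R) : 0 <= k -> (forall i, 0 <= f i)%E ->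
  (\esum_(i in [set: I]) (k%:E * f i) = k%:E * \esum_(i in [set: I]) f i)%E.
Proof.
move=> k0 f0; rewrite /esum -ereal_supZl//; last first.
  by apply/set0P; exists 0%E, set0; [exact: fsets_set0 | rewrite fsbig_set0].
congr ereal_sup; rewrite image_comp; apply: eq_imagel => A [finA _] /=.
by rewrite ge0_mule_fsumr.
Qed.

Lemma ell2_sumZ (l : R[i]) x :
  ell2_sum (l *: x) = ((rnorm (l : R[i]^o) ^+ 2)%:E * ell2_sum x)%E.
Proof.
rewrite /ell2_sum -esumZl ?sqr_ge0//; last by move=> i; rewrite lee_fin sqr_ge0.
by apply: eq_esum => i _; rewrite -EFinM -exprMn -rnormZ.
Qed.

Lemma ell2_sumD x y (s t : R) : 0 < s -> 0 < t ->
  (ell2_sum x <= (s ^+ 2)%:E)%E -> (ell2_sum y <= (t ^+ 2)%:E)%E ->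
  (ell2_sum (x + y)%R <= ((s + t) ^+ 2)%:E)%E.
Proof.
move=> s0 t0 xs yt.
pose p := 1 + t / s; pose q := 1 + s / t.
have p0 : 0 <= p by rewrite addr_ge0// divr_ge0// ltW.
have q0 : 0 <= q by rewrite addr_ge0// divr_ge0// ltW.
apply: (@le_trans _ _ (p%:E * ell2_sum x + q%:E * ell2_sum y)%E).
  rewrite /ell2_sum -!esumZl//; do ?by move=> i; rewrite lee_fin sqr_ge0.
  rewrite -esumD; do ?by move=> i _; rewrite -EFinM lee_fin mulr_ge0 ?sqr_ge0.
  apply: le_esum => i _; rewrite -!EFinM -EFinD lee_fin.
  set a := rnorm (x i); set b := rnorm (y i).
  apply: (@le_trans _ _ ((a + b) ^+ 2)).
    by rewrite ler_sqr ?nnegrE ?addr_ge0 ?rnorm_ge0// rnormD.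
  rewrite -subr_ge0.
  suff -> : p * a ^+ 2 + q * b ^+ 2 - (a + b) ^+ 2 = (t * a - s * b) ^+ 2 / (s * t).
    by rewrite divr_ge0 ?sqr_ge0// mulr_ge0// ltW.
  by rewrite /p /q; field; rewrite !gt_eqF.
apply: (@le_trans _ _ (p%:E * (s ^+ 2)%:E + q%:E * (t ^+ 2)%:E)%E).
  by apply: leeD; apply: lee_wpmul2l; rewrite ?lee_fin.
rewrite -!EFinM -EFinD lee_fin le_eqVlt; apply/orP; left; apply/eqP.
by rewrite /p /q; field; rewrite !gt_eqF.
Qed.

Lemma ell2_submod_closed : submod_closed (@ell2_pred R I X).
Proof.
split; first by rewrite inE ell2_sum0 ltry.
move=> l x y; rewrite !inE => xoo yoo.
have H (z : I -> X) : (ell2_sum z < +oo)%E ->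
    exists2 s : R, 0 < s & (ell2_sum z <= (s ^+ 2)%:E)%E.
  move=> zoo; have zfin : ell2_sum z \is a fin_num.
    by rewrite ge0_fin_numE// ell2_sum_ge0.
  exists (1 + fine (ell2_sum z)).
    by rewrite ltr_pwDl// fine_ge0// ell2_sum_ge0.
  rewrite -[leLHS]fineK// lee_fin.
  have : 0 <= fine (ell2_sum z) by rewrite fine_ge0// ell2_sum_ge0.
  move: (fine _) => u u0; nra.
have lxoo : (ell2_sum (l *: x)%R < +oo)%E.
  by rewrite ell2_sumZ lte_mul_pinfty// lee_fin sqr_ge0.
have [s s0 xs] := H _ lxoo; have [t t0 yt] := H _ yoo.
by apply: le_lt_trans (ell2_sumD s0 t0 xs yt) _; rewrite ltry.
Qed.

HB.instance Definition _ :=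
  GRing.isSubmodClosed.Build _ _ (@ell2_pred R I X) ell2_submod_closed.

HB.instance Definition _ := [isSub for @ell2_fun R I X].
HB.instance Definition _ := [Choice of ell2 I X by <:].
HB.instance Definition _ := [SubChoice_isSubLmodule of ell2 I X by <:].

End ell2_sum_theory.

Section ell2_norm.
Variables (R : realType) (I : choiceType) (X : normedModType R[i]).
Implicit Types x y : ell2 I X.

Definition ell2_norm x : R := Num.sqrt (fine (ell2_sum x)).

Lemma ell2_sum_fin x : ell2_sum x \is a fin_num.
Proof. by rewrite ge0_fin_numE ?ell2_sum_ge0//; have := ell2P x; rewrite inE. Qed.

Lemma ell2_sumE x : ell2_sum x = (ell2_norm x ^+ 2)%:E.
Proof.
by rewrite sqr_sqrtr ?fineK ?ell2_sum_fin// fine_ge0// ell2_sum_ge0.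
Qed.

Lemma ell2_norm_ge0 x : 0 <= ell2_norm x.
Proof. exact: sqrtr_ge0. Qed.

Lemma ell2_norm_le x (s : R) : 0 <= s ->
  (ell2_norm x <= s) = (ell2_sum x <= (s ^+ 2)%:E)%E.
Proof.
by move=> s0; rewrite ell2_sumE lee_fin ler_sqr ?nnegrE ?ell2_norm_ge0.
Qed.

Lemma ell2_normD x y : ell2_norm (x + y) <= ell2_norm x + ell2_norm y.
Proof.
apply/ler_addgt0Pl => e e0; rewrite ell2_norm_le; last first.
  by rewrite !addr_ge0 ?ell2_norm_ge0// ltW.
set s := ell2_norm x; set t := ell2_norm y.
rewrite (_ : e + (s + t) = (s + e / 2) + (t + e / 2)); last by field.
have s0 : 0 <= s := ell2_norm_ge0 x.
have t0 : 0 <= t := ell2_norm_ge0 y.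
by apply: ell2_sumD; rewrite -?ell2_norm_le -/s -/t; lra.
Qed.

Lemma ell2_normZ (l : R[i]) x :
  (ell2_norm (l *: x))%:C = `|l| * (ell2_norm x)%:C.
Proof.
rewrite (rnormE (l : R[i]^o)) -rmorphM/=; congr (_%:C).
rewrite /ell2_norm ell2_sumZ fineM ?ell2_sum_fin//=.
by rewrite sqrtrM ?sqr_ge0// sqrtr_sqr ger0_norm// rnorm_ge0.
Qed.

Lemma ell2_norm_coord x i : rnorm (x i) <= ell2_norm x.
Proof.
rewrite -ler_sqr ?nnegrE ?ell2_norm_ge0 ?rnorm_ge0// -lee_fin -ell2_sumE.
exact: ell2_sum_ge.
Qed.

Lemma ell2_norm0_eq0 x : (ell2_norm x)%:C = 0 -> x = 0.
Proof.
move=> /complexI x0; apply/val_inj/funext => i /=; apply/rnorm0_eq0/eqP.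
by rewrite eq_le rnorm_ge0 andbT -[leRHS]x0 ell2_norm_coord.
Qed.

Lemma ell2_normDC x y :
  (ell2_norm (x + y))%:C <= (ell2_norm x)%:C + (ell2_norm y)%:C.
Proof. by rewrite -rmorphD/= lecR ell2_normD. Qed.

HB.instance Definition _ := Lmodule_isNormed.Build R[i] (ell2 I X)
  ell2_normDC ell2_normZ ell2_norm0_eq0.

Lemma ell2_rnormE x : rnorm x = Num.sqrt (fine (ell2_sum x)).
Proof. by []. Qed.

End ell2_norm.

Section ell2_ord.
Variables (R : realType) (n : nat) (X : normedModType R[i]).

Lemma ell2_sum_ord (x : 'I_n -> X) :
  ell2_sum x = (\sum_(i < n) rnorm (x i) ^+ 2)%:E.
Proof.
rewrite /ell2_sum esum_fset//; first last.
- by move=> i _; rewrite lee_fin sqr_ge0.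
- exact: finite_finset.
rewrite -sumEFin -big_enum [RHS]fsbig_seq ?enum_uniq//.
by apply: eq_fsbigl; apply/seteqP; split=> i _ //=; rewrite mem_enum.
Qed.

Lemma ell2_ord_finite (x : 'I_n -> X) : x \in @ell2_pred R 'I_n X.
Proof. by rewrite inE ell2_sum_ord ltry. Qed.

Lemma ell2_ord_normE (x : ell2 'I_n X) :
  rnorm x = Num.sqrt (\sum_(i < n) rnorm (x i) ^+ 2).
Proof. by rewrite ell2_rnormE ell2_sum_ord. Qed.

End ell2_ord.

(* The bounded linear operators from Y to Z; their norm in bop_norm below is
   the operator norm. *)
Definition bop_pred {R : realType} {Y Z : normedModType R[i]} :
  {pred Y -> Z} := [pred f : Y -> Z |
    `[< linear f /\ exists M : R, forall y, rnorm (f y) <= M * rnorm y >]].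

Record bop {R : realType} (Y Z : normedModType R[i]) :=
  Bop { bop_fun :> Y -> Z ; bopP : bop_fun \in bop_pred }.

Notation "''L' ( Y )" := (bop Y Y) (at level 8, format "''L' ( Y )") : type_scope.

Section bop_lmodule.
Variables (R : realType) (Y Z : normedModType R[i]).

Lemma bop_submod_closed : submod_closed (@bop_pred R Y Z).
Proof.
split.
  apply/asboolP; split; first by move=> k u v; rewrite [RHS]addr0 scaler0.
  by exists 0 => y; rewrite rnorm0 mul0r.
move=> l f g /asboolP[lf [M fM]] /asboolP[lg [N gN]].
apply/asboolP; split.
  move=> k u v; rewrite -[LHS]/(l *: f (k *: u + v) + g (k *: u + v)).
  rewrite -[RHS]/(k *: (l *: f u + g u) + (l *: f v + g v)) lf lg.
  by rewrite !scalerDr !scalerA mulrC addrACA.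
exists (rnorm (l : R[i]^o) * M + N) => y.
rewrite mulrDl (le_trans (rnormD _ _))// lerD// rnormZ -mulrA.
by rewrite ler_wpM2l ?rnorm_ge0.
Qed.

HB.instance Definition _ :=
  GRing.isSubmodClosed.Build _ _ (@bop_pred R Y Z) bop_submod_closed.

HB.instance Definition _ := [isSub for @bop_fun R Y Z].
HB.instance Definition _ := [Choice of bop Y Z by <:].
HB.instance Definition _ := [SubChoice_isSubLmodule of bop Y Z by <:].

Lemma bop_linear (f : bop Y Z) : linear f.
Proof. by have /asboolP[] := bopP f. Qed.

HB.instance Definition _ (f : bop Y Z) :=
  GRing.isLinear.Build _ _ _ _ (bop_fun f) (bop_linear f).

End bop_lmodule.

Section bop_norm.
Variables (R : realType) (Y Z : normedModType R[i]).
Implicit Types f g : bop Y Z.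

Definition bop_norm f : R :=
  sup [set rnorm (f y) | y in [set y : Y | rnorm y <= 1]].

Lemma bop_has_sup f : has_sup [set rnorm (f y) | y in [set y : Y | rnorm y <= 1]].
Proof.
have /asboolP[_ [M fM]] := bopP f; split.
  by exists (rnorm (f 0)), 0 => //=; rewrite rnorm0.
exists `|M| => _ [y /= y1 <-]; apply: le_trans (fM y) _.
apply: (@le_trans _ _ (`|M| * rnorm y)).
  by rewrite ler_wpM2r ?rnorm_ge0// ler_norm.
by rewrite ler_piMr.
Qed.

Lemma bop_norm_unit f y : rnorm y <= 1 -> rnorm (f y) <= bop_norm f.
Proof. by move=> y1; apply: ub_le_sup; [case: (bop_has_sup f) | exists y]. Qed.

Lemma bop_norm_ge0 f : 0 <= bop_norm f.
Proof.
by apply: le_trans (rnorm_ge0 (f 0)) (bop_norm_unit _ _); rewrite rnorm0.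
Qed.

Lemma bop_norm_ub f (M : R) :
  (forall y, rnorm y <= 1 -> rnorm (f y) <= M) -> bop_norm f <= M.
Proof.
by move=> fM; apply: ge_sup; [case: (bop_has_sup f) | move=> _ [y /= /fM + <-]].
Qed.

Lemma rnorm_real (r : R) : rnorm (r%:C : R[i]^o) = `|r|.
Proof. by rewrite /rnorm normc_def/= expr0n/= addr0 sqrtr_sqr. Qed.

Lemma bop_norm_le f y : rnorm (f y) <= bop_norm f * rnorm y.
Proof.
have [y0|y0] := eqVneq (rnorm y) 0.
  by rewrite (rnorm0_eq0 y0) linear0 !rnorm0 mulr0.
have yp : 0 < rnorm y by rewrite lt_neqAle eq_sym y0 rnorm_ge0.
rewrite -ler_pdivrMr// mulrC.
have -> : (rnorm y)^-1 * rnorm (f y) = rnorm (f ((rnorm y)^-1%:C *: y)).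
  by rewrite linearZ rnormZ rnorm_real gtr0_norm// invr_gt0.
apply: bop_norm_unit; rewrite rnormZ rnorm_real gtr0_norm ?invr_gt0//.
by rewrite mulVf.
Qed.

Lemma bop_normD f g : (bop_norm (f + g))%:C <= (bop_norm f)%:C + (bop_norm g)%:C.
Proof.
rewrite -rmorphD/= lecR; apply: bop_norm_ub => y y1.
by apply: le_trans (rnormD _ _) _; rewrite lerD// bop_norm_unit.
Qed.

Lemma bop_norm0_eq0 f : (bop_norm f)%:C = 0 -> f = 0.
Proof.
move=> /complexI f0; apply/val_inj/funext => y /=; apply/rnorm0_eq0/eqP.
by rewrite eq_le rnorm_ge0 andbT (le_trans (bop_norm_le f y))// f0 mul0r.
Qed.

Lemma bop_normZ (l : R[i]) f : (bop_norm (l *: f))%:C = `|l| * (bop_norm f)%:C.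
Proof.
rewrite (rnormE (l : R[i]^o)) -rmorphM/=; congr (_%:C).
have H (k : R[i]) g : bop_norm (k *: g) <= rnorm (k : R[i]^o) * bop_norm g.
  apply: bop_norm_ub => y y1.
  by rewrite [X in rnorm X](_ : _ = k *: g y)// rnormZ ler_wpM2l ?rnorm_ge0 ?bop_norm_unit.
apply/eqP; rewrite eq_le H/=.
have [->|l0] := eqVneq l 0; first by rewrite rnorm0 mul0r bop_norm_ge0.
have lp : 0 < rnorm (l : R[i]^o).
  rewrite lt_neqAle rnorm_ge0 andbT eq_sym; apply: contra_neq l0.
  exact: (@rnorm0_eq0 _ R[i]^o).
rewrite mulrC -ler_pdivlMr// mulrC.
rewrite -{1}[f](scale1r) -(mulVf l0) -scalerA; apply: le_trans (H _ _) _.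
rewrite ler_wpM2r ?bop_norm_ge0//.
by rewrite -lecR -(@rnormE _ R[i]^o) normfV (@rnormE _ R[i]^o) fmorphV.
Qed.

HB.instance Definition _ := Lmodule_isNormed.Build R[i] (bop Y Z)
  bop_normD bop_normZ bop_norm0_eq0.

Lemma bop_rnormE f :
  rnorm f = sup [set rnorm (f y) | y in [set y : Y | rnorm y <= 1]].
Proof. by []. Qed.

End bop_norm.

Lemma bop_id_subproof (R : realType) (Y : normedModType R[i]) :
  idfun \in @bop_pred R Y Y.
Proof. by apply/asboolP; split=> //; exists 1 => y; rewrite mul1r. Qed.

Definition bop_id {R : realType} {Y : normedModType R[i]} : 'L(Y) :=
  Bop (@bop_id_subproof R Y).

Section pseudospectra.
Variables (R : realType) (Y : normedModType R[i]).
Implicit Types B C : 'L(Y).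

Definition is_inverse B C := cancel B C /\ cancel C B.

Definition invertible B := exists C, is_inverse B C.

(* ||B^-1||, with the convention that it is +oo if B is not invertible; the
   inverse is unique, so that xget picks it. *)
Definition inverse_norm B : \bar R :=
  if `[< invertible B >] then (rnorm (xget 0 (is_inverse B)))%:E else +oo%E.

Definition spectrum B : set R[i]^o :=
  [set lambda : R[i]^o | ~ invertible (B - lambda *: bop_id)].

(* The closed eps-pseudospectrum Spec_eps B, for eps >= 0; in \bar R,
   +oo^-1 = 0 and 0^-1 = +oo. *)
Definition Spec (eps : R) B : set R[i]^o :=
  if eps == 0 then spectrum B else
  [set lambda : R[i]^o |
    ((inverse_norm (B - lambda *: bop_id)%R)^-1 <= eps%:E)%E].

(* The open eps-pseudospectrum spec_eps B, for eps > 0. *)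
Definition spec (eps : R) B : set R[i]^o :=
  [set lambda : R[i]^o |
    ((inverse_norm (B - lambda *: bop_id)%R)^-1 < eps%:E)%E].

End pseudospectra.

Section globevnik.
Variable R : realType.
Implicit Types Y : normedModType R[i].

Definition finite_dimensional Y := exists (m : nat) (e : 'I_m -> Y),
  forall y, exists c : 'I_m -> R[i], y = \sum_(j < m) c j *: e j.

Definition complex_uniformly_convex Y := forall eps : R, 0 < eps ->
  exists2 delta : R, 0 < delta & forall x y : Y, eps <= rnorm y ->
    (forall zeta : R[i], `|zeta| <= 1 -> rnorm (x + zeta *: y) <= 1) ->
    rnorm x <= 1 - delta.

Definition dual Y : normedModType R[i] := bop Y R[i]^o.

Definition globevnik Y := [\/ finite_dimensional Y,
  complex_uniformly_convex Y | complex_uniformly_convex (dual Y)].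

End globevnik.

Section operator_matrix.
Variables (R : realType) (X : normedModType R[i]) (n : nat).
Implicit Types (M : 'M['L(X)]_n) (x : ell2 'I_n X).

Definition mxop_fun M x : ell2 'I_n X :=
  Ell2 (ell2_ord_finite (fun i => \sum_(j < n) M i j (x j))).

Lemma ell2_ord_norm_le x : rnorm x <= \sum_(i < n) rnorm (x i).
Proof.
rewrite [leLHS]/(ell2_norm x) ell2_norm_le; last by rewrite sumr_ge0// => i _; exact: rnorm_ge0.
rewrite ell2_sum_ord lee_fin expr2 mulr_suml; apply: ler_sum => i _.
rewrite expr2 ler_wpM2l ?rnorm_ge0//.
by rewrite (bigD1 i)//= lerDl sumr_ge0// => j _; exact: rnorm_ge0.
Qed.

Lemma mxop_subproof M : mxop_fun M \in @bop_pred R (ell2 'I_n X) (ell2 'I_n X).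
Proof.
apply/asboolP; split.
  move=> k x y; apply/val_inj/funext => i /=.
  rewrite -[RHS]/(k *: (\sum_(j < n) M i j (x j)) + \sum_(j < n) M i j (y j)).
  by rewrite scaler_sumr -big_split; apply: eq_bigr => j _; exact: bop_linear.
exists (\sum_(i < n) \sum_(j < n) rnorm (M i j)) => x.
apply: le_trans (ell2_ord_norm_le _) _; rewrite mulr_suml.
apply: ler_sum => i _ /=; rewrite mulr_suml.
apply: (@le_trans _ _ (\sum_(j < n) rnorm (M i j (x j)))).
  elim/big_ind2 : _ => [|u u' v v' uu' vv'|//]; first by rewrite rnorm0.
  by apply: le_trans (rnormD _ _) _; rewrite lerD.
apply: ler_sum => j _; apply: le_trans (bop_norm_le _ _) _.
by rewrite ler_wpM2l ?bop_norm_ge0 ?ell2_norm_coord.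
Qed.

(* (M x)_i = sum_j M_ij x_j on X^n *)
Definition mxop M : 'L(ell2 'I_n X) := Bop (mxop_subproof M).

End operator_matrix.

Section tridiagonal.
Variables (R : realType) (X : normedModType R[i]).
Implicit Types (alpha beta gamma a c : int -> 'L(X)).

Definition bounded_seq a := has_ubound (range (fun j => rnorm (a j))).

Definition sup_norm a : R := sup (range (fun j => rnorm (a j))).

Definition tridiagonal alpha beta gamma (A : 'L(ell2 int X)) :=
  forall (x : ell2 int X) (i : int),
    A x i = alpha (i - 1) (x (i - 1)) + beta i (x i) + gamma (i + 1) (x (i + 1)).

Definition entry alpha beta gamma (i j : int) : 'L(X) :=
  if i == j + 1 then alpha j else
  if i == j then beta j else
  if i == j - 1 then gamma j else 0.

(* [a_{i,j}]_{i,j = k+1}^{k+n}; as 'I_n is numbered from 0, i : 'I_n stands for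
   the row or column i + 1 of the n x n matrix. *)
Definition section_mx alpha beta gamma (n : nat) (k : int) : 'M['L(X)]_n :=
  \matrix_(i < n, j < n) entry alpha beta gamma (k + i.+1%:Z) (k + j.+1%:Z).

(* a_k in the upper right corner, c_k in the lower left one, and a_k + c_k if
   n = 1. *)
Definition corner_mx a c (n : nat) (k : int) : 'M['L(X)]_n :=
  \matrix_(i < n, j < n)
    (a k *+ ((i.+1 == 1%N) && (j.+1 == n)) + c k *+ ((i.+1 == n) && (j.+1 == 1%N))).

Definition corner_section alpha beta gamma a c (n : nat) (k : int) :
  'L(ell2 'I_n X) :=
  mxop (section_mx alpha beta gamma n k + corner_mx a c n k).

Definition pi_ac alpha beta gamma a c (n : nat) (eps : R) : set R[i]^o :=
  \bigcup_(k in [set: int]) spec eps (corner_section alpha beta gamma a c n k).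

Definition Pi_ac alpha beta gamma a c (n : nat) (eps : R) : set R[i]^o :=
  closure (\bigcup_(k in [set: int])
    Spec eps (corner_section alpha beta gamma a c n k)).

Definition per_a alpha (t : R[i]) : int -> 'L(X) := fun k => t *: alpha k.

Definition per_c gamma (n : nat) (t : R[i]) : int -> 'L(X) :=
  fun k => t^* *: gamma (k + n%:Z + 1).

Definition pi_per alpha beta gamma (t : R[i]) (n : nat) (eps : R) :=
  pi_ac alpha beta gamma (per_a alpha t) (per_c gamma n t) n eps.

Definition Pi_per alpha beta gamma (t : R[i]) (n : nat) (eps : R) :=
  Pi_ac alpha beta gamma (per_a alpha t) (per_c gamma n t) n eps.

Definition eps' alpha gamma (n : nat) : R :=
  2 * (sup_norm alpha + sup_norm gamma) * sin (pi / (2 * n%:R)).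

End tridiagonal.

(* Main.v *)
(* Suppose that every periodized section B_k - l is invertible with inverse of
   norm at most 1 / eta, where eta > eps'.  Cut a vector of l^2(Z, X) into windows
   of length n with the weights w_j = sin((2j+1) pi / 2n).  Commuting A - l with
   the windows costs the differences of neighbouring weights, and w_0 + w_(n-1) at
   the wrap-around; as w extends antiperiodically, these are all values of
   2 sin(pi / 2n) |cos(j pi / n)|, whose squares have the sum
   4 sin^2(pi / 2n) sum_j w_j^2.  Minkowski's inequality then gives
   ||(A - l) x|| >= (eta - eps') ||x||.  Gluing the solutions of the B_k - l with
   the same weights gives a right inverse of A - l up to an error of norm
   eps' / eta < 1, so that A - l is onto, without recourse to adjoints.

   For the closed pseudospectra, a bound ||(B_k - m)^-1|| <= 1 / eta on a disc
   around l has to be improved at l, uniformly in k.  Averaging the resolvent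
   against the kernel 1 + Re(zeta * conj(z)^m) gives
   ||R + (zeta rho^m / 2) R^(m+1)|| <= 1 / eta for |zeta| <= 1.  Complex uniform
   convexity (of the space, or of its dual by Hahn-Banach) applies to this with
   m = 1; in finite dimension one expresses R by R^2, ..., R^(N+1) through the
   characteristic polynomial, whose coefficients are bounded uniformly in k. *)
Require Import Defs.
From HB Require Import structures.
From mathcomp Require Import all_boot all_order all_algebra.
From mathcomp Require cyclic separable cyclotomic.
From mathcomp Require Import perm.
From mathcomp Require Import complex zify ring lra.
From mathcomp Require Import all_classical all_reals all_analysis.

Set Implicit Arguments.
Unset Strict Implicit.
Unset Printing Implicit Defensive.
Import Order.TTheory GRing.Theory Num.Theory.
Import numFieldNormedType.Exports.
Local Open Scope classical_set_scope.
Local Open Scope ring_scope.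
Local Open Scope complex_scope.

(** * The Hahn-Banach theorem *)

(** The corners [a] and [c] are controlled only in norm, so nothing cancels at the wrap-around and
    w_(n-1) and w_0 add up, as if w were continued with a change of sign. Among antiperiodic
    sequences the ratio of the sum of the |w_j - w_(j-1)|^2 to the sum of the w_j^2 is smallest for
    these sines, with minimum 4 sin^2(pi / 2n); this is the origin of [eps'].

    The closed case needs a uniform gap: for l outside the closure, every single section satisfies a
    strict inequality, but the infimum over k may still be attained only in the limit. The windows
    would then give ||(A - l)^-1|| <= 1 / eps, whereas a strict inequality is needed, and for eps =
    0 the gluing error e' / eta would not be below 1. The disc around l, available because l avoids
    the closure and not only the union, is what the averages turn into this gap. *)

Section rnorm_extra.
Variables (R : realType) (V : normedModType R[i]).
Implicit Types x y : V.

Lemma rnormN x : rnorm (- x) = rnorm x.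
Proof. by rewrite /rnorm normrN. Qed.

Lemma rnormB x y : rnorm (x - y) <= rnorm x + rnorm y.
Proof. by rewrite -(rnormN y) rnormD. Qed.

Lemma rnorm_distC x y : rnorm (x - y) = rnorm (y - x).
Proof. by rewrite -rnormN opprB. Qed.

Lemma rnormZr (t : R) x : rnorm (t%:C *: x) = `|t| * rnorm x.
Proof. by rewrite rnormZ rnorm_real. Qed.

Lemma rnorm_sum (I : Type) (r : seq I) (P : pred I) (F : I -> V) :
  rnorm (\sum_(i <- r | P i) F i) <= \sum_(i <- r | P i) rnorm (F i).
Proof.
elim/big_ind2 : _ => [|u u' v v' uu' vv'|//]; first by rewrite rnorm0.
by apply: le_trans (rnormD _ _) _; rewrite lerD.
Qed.

End rnorm_extra.

Section hahn_banach.
Variables (R : realType) (Y : normedModType R[i]).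
Implicit Types (p q : Y -> R) (x y a : Y).

(** Hahn-Banach is proved without extending functionals from subspaces: a minimal sublinear
    functional is real linear. The bound by the norm also bounds [p] from below ([sublinear_ge]), so
    that infima over chains are finite. *)
Definition sublinear p :=
  [/\ forall x y, p (x + y) <= p x + p y,
      forall (t : R) x, 0 <= t -> p (t%:C *: x) = t * p x
    & forall x, p x <= rnorm x].

Lemma sublinear0 p : sublinear p -> p 0 = 0.
Proof. by move=> [_ h _]; have := h 0 0 (lexx _); rewrite scaler0 mul0r. Qed.

Lemma sublinear_ge p x : sublinear p -> - rnorm x <= p x.
Proof.
move=> sp; have [h1 _ h3] := sp.
have := h1 x (- x); rewrite subrr (sublinear0 sp) => h.
have := h3 (- x); rewrite rnormN; lra.
Qed.

Lemma sublinear_rnorm : sublinear (@rnorm R Y).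
Proof.
split=> //; first exact: rnormD.
by move=> t x t0; rewrite rnormZr ger0_norm.
Qed.

(* The largest sublinear functional below p whose value at -a is -p(a). *)
Definition sub_along p a x : R :=
  inf [set p (x + t%:C *: a) - t * p a | t in [set t : R | 0 <= t]].

Lemma sub_along_lb p a x (t : R) : sublinear p -> 0 <= t ->
  - p (- x) <= p (x + t%:C *: a) - t * p a.
Proof.
move=> [h1 h2 _] t0; have := h1 (x + t%:C *: a) (- x).
by rewrite addrAC subrr add0r h2//; lra.
Qed.

Lemma sub_along_has_inf p a x : sublinear p ->
  has_inf [set p (x + t%:C *: a) - t * p a | t in [set t : R | 0 <= t]].
Proof.
move=> sp; split; first by exists (p (x + 0%:C *: a) - 0 * p a), 0 => /=.
by exists (- p (- x)) => _ [t /= t0 <-]; exact: sub_along_lb.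
Qed.

Lemma sub_along_le p a x (t : R) : sublinear p -> 0 <= t ->
  sub_along p a x <= p (x + t%:C *: a) - t * p a.
Proof.
move=> sp t0; apply: ge_inf; last by exists t.
by have [] := sub_along_has_inf a x sp.
Qed.

Lemma sub_along_ge p a x (c : R) : sublinear p ->
  (forall t : R, 0 <= t -> c <= p (x + t%:C *: a) - t * p a) ->
  c <= sub_along p a x.
Proof.
move=> sp h; apply: lb_le_inf; first by have [] := sub_along_has_inf a x sp.
by move=> _ [t /= t0 <-]; exact: h.
Qed.

Lemma sub_along_le_id p a x : sublinear p -> sub_along p a x <= p x.
Proof.
move=> sp; apply: le_trans (sub_along_le _ _ sp (lexx 0)) _.
by rewrite scale0r addr0 mul0r subr0.
Qed.

Lemma sublinear_sub_along p a : sublinear p -> sublinear (sub_along p a).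
Proof.
move=> sp; have [h1 h2 h3] := sp; split; last first.
- by move=> x; apply: le_trans (h3 x); exact: sub_along_le_id.
(* One inequality suffices: applied to [t^-1] it yields the converse. *)
- have hle (t : R) x : 0 < t -> sub_along p a (t%:C *: x) <= t * sub_along p a x.
    move=> t0; rewrite mulrC -ler_pdivrMr// mulrC; apply: sub_along_ge => // s s0.
    rewrite mulrC ler_pdivrMr//; apply: le_trans (sub_along_le _ _ sp _) _.
      by apply: (mulr_ge0 (ltW t0) s0).
    rewrite rmorphM/= -scalerA -scalerDr h2 ?(ltW t0)//; lra.
  move=> t x; rewrite le_eqVlt => /predU1P[<-|t0].
    rewrite scale0r mul0r; apply/eqP; rewrite eq_le; apply/andP; split.
      by apply: le_trans (sub_along_le_id _ _ sp) _; rewrite (sublinear0 sp).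
    apply: sub_along_ge => // s s0; apply: le_trans (sub_along_lb _ _ sp s0).
    by rewrite oppr0 (sublinear0 sp) oppr0.
  apply/eqP; rewrite eq_le hle//=.
  have ti : 0 < t^-1 by rewrite invr_gt0.
  have := hle _ (t%:C *: x) ti; rewrite scalerA -rmorphM/= mulVf ?gt_eqF// scale1r.
  by rewrite mulrC ler_pdivlMr// mulrC.
- move=> x y; rewrite -lerBlDr; apply: sub_along_ge => // t t0.
  rewrite lerBlDr -lerBlDl; apply: sub_along_ge => // s s0.
  rewrite lerBlDl; apply: le_trans (sub_along_le _ _ sp (addr_ge0 t0 s0)) _.
  have := h1 (x + t%:C *: a) (y + s%:C *: a).
  by rewrite addrACA -scalerDl -rmorphD/=; lra.
Qed.

Lemma minimal_sublinear q : sublinear q ->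
  exists p, [/\ sublinear p, forall x, p x <= q x
    & forall p', sublinear p' -> (forall x, p' x <= p x) -> p' = p].
Proof.
move=> sq; pose T := {p : Y -> R | sublinear p /\ forall x, p x <= q x}.
(* The order is reversed, so that a maximal element in the sense of Zorn is a minimal functional. *)
pose le (u v : T) := `[< forall x, sval v x <= sval u x >].
have [| | | |[p [sp pq]] pmin] := @Zorn T le.
- by move=> u; apply/asboolP.
- move=> u v w /asboolP uv /asboolP vw; apply/asboolP => x.
  by apply: le_trans (vw x) (uv x).
- move=> [u Pu] [v Pv] /asboolP/= uv /asboolP/= vu; apply: eq_exist; apply/funext => x.
  by apply/eqP; rewrite eq_le vu uv.
- move=> C totC; have [[u0 Cu0]|C0] := pselect (exists u, C u); last first.
    by exists (exist _ q (conj sq (fun x => lexx _))) => s Cs; case: C0; exists s.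
  pose V x := [set sval u x | u in C].
  have Vi x : has_inf (V x).
    split; first by exists (sval u0 x), u0.
    exists (- rnorm x) => _ [[u [su uq]] _ <-] /=; exact: sublinear_ge.
  pose p x := inf (V x).
  have p_le u x : C u -> p x <= sval u x.
    by move=> Cu; apply: ge_inf; [have [] := Vi x|exists u].
  have le_p x c : (forall u, C u -> c <= sval u x) -> c <= p x.
    by move=> h; apply: lb_le_inf; [have [] := Vi x| move=> _ [u Cu <-]; exact: h].
  have sp : sublinear p.
    split.
    + move=> x y; rewrite -lerBlDr; apply/le_p => u Cu.
      rewrite lerBlDr -lerBlDl; apply/le_p => v Cv; rewrite lerBlDl.
      have [[u1 _ _] _] := svalP u; have [[v1 _ _] _] := svalP v.
      (* In a chain the smaller of [u] and [v] serves for both arguments, and its own subadditivity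
         is enough. *)
      have [/asboolP uv|/asboolP vu] := totC _ _ Cu Cv.
        apply: le_trans (p_le _ _ Cv) _; apply: le_trans (v1 _ _) _.
        by rewrite lerD2r.
      apply: le_trans (p_le _ _ Cu) _; apply: le_trans (u1 _ _) _.
      by rewrite lerD2l.
    + move=> t x; rewrite le_eqVlt => /predU1P[<-|t0].
        apply/eqP; rewrite scale0r mul0r eq_le; apply/andP; split.
          apply: le_trans (p_le _ _ Cu0) _; case: (u0) => u [su _] /=.
          by rewrite sublinear0.
        by apply/le_p => -[u [su _]] _ /=; rewrite sublinear0.
      apply/eqP; rewrite eq_le; apply/andP; split.
        rewrite mulrC -ler_pdivrMr//; apply/le_p => u Cu; rewrite ler_pdivrMr//.
        apply: le_trans (p_le _ _ Cu) _; have [[_ u2 _] _] := svalP u.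
        by rewrite u2 ?(ltW t0)// mulrC.
      apply/le_p => u Cu; have [[_ u2 _] _] := svalP u.
      by rewrite u2 ?(ltW t0)// ler_pM2l// p_le.
    + move=> x; apply: le_trans (p_le _ _ Cu0) _.
      by have [[_ _ ->]] := svalP u0.
  have pq x : p x <= q x.
    by apply: le_trans (p_le _ _ Cu0) _; have [_ ->] := svalP u0.
  by exists (exist _ p (conj sp pq)) => s Cs; apply/asboolP => x; exact: p_le.
- exists p; split => // p' sp' p'p.
  have p'q x : p' x <= q x by apply: le_trans (p'p x) (pq x).
  have := pmin (exist _ p' (conj sp' p'q)) (introT (asboolP _) p'p).
  by move=> /(congr1 sval).
Qed.

(** Minimality forces [sub_along p a = p], and t = 1 in its definition reads p x <= p (x + a) - p a,
    the missing half of additivity. *)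
Lemma minimal_sublinear_additive p : sublinear p ->
  (forall p', sublinear p' -> (forall x, p' x <= p x) -> p' = p) ->
  forall x y, p (x + y) = p x + p y.
Proof.
move=> sp pmin x a; apply/eqP; rewrite eq_le; have [-> //= _ _] := sp.
have h := pmin _ (sublinear_sub_along a sp) (fun x => sub_along_le_id a x sp).
have := sub_along_le a x sp ler01; rewrite h scale1r mul1r; lra.
Qed.

Lemma norming_functional y :
  exists phi : dual Y, (forall x, rnorm (phi x) <= rnorm x) /\
    rnorm (phi y) = rnorm y.
Proof.
have sn := sublinear_rnorm.
(* Starting below [sub_along rnorm y] forces f (- y) <= - rnorm y, hence f y >= rnorm y. *)
have [f [sf fle fmin]] := minimal_sublinear (sublinear_sub_along y sn).
have fD := minimal_sublinear_additive sf fmin.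
have [_ fp f_le] := sf.
have fN x : f (- x) = - f x.
  by have := fD x (- x); rewrite subrr (sublinear0 sf); lra.
have fZ (t : R) x : f (t%:C *: x) = t * f x.
  have [t0|t0] := leP 0 t; first exact: fp.
  have := fp (- t) (- x); rewrite fN rmorphN/= scaleNr scalerN opprK => ->; lra.
have fy : rnorm y <= f y.
  have := fle (- y); rewrite fN => h.
  have := le_trans h (sub_along_le _ _ sn ler01).
  by rewrite scale1r mul1r addNr rnorm0; lra.
(* The complex linear functional with real part [f] is f x - i f (i x). *)
pose g x : R[i]^o := (f x) +i* (- f ('i%C *: x)).
have gre x : complex.Re (g x) = f x by [].
have gD x z : g (x + z) = g x + g z.
  by rewrite /g scalerDr !fD opprD.
have gZ (c : R[i]) x : g (c *: x) = c *: g x.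
  have H (u : Y) : f (c *: u) = complex.Re c * f u + complex.Im c * f ('i%C *: u).
    by rewrite {1}[c]complexE scalerDl fD fZ (mulrC 'i%C) -scalerA fZ.
  have ii : 'i%C *: ('i%C *: x) = - x.
    by rewrite scalerA -expr2 sqr_i scaleN1r.
  rewrite /g scalerA (mulrC 'i%C) -scalerA !H ii fN.
  by case: c {H} => a b /=; congr (_ +i* _); rewrite /=; lra.
have gle x : rnorm (g x) <= rnorm x.
  have [->|n0] := eqVneq (rnorm (g x)) 0; first exact: rnorm_ge0.
  have gx0 : 0 < rnorm (g x) by rewrite lt_neqAle eq_sym n0 rnorm_ge0.
  (* A phase [c] rotates [g x] onto its modulus, so that the bound on the real part at [c *: x]
     bounds the modulus. *)
  pose c : R[i] := (g x)^*%R / (rnorm (g x))%:C.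
  have cg : c * g x = (rnorm (g x))%:C.
    rewrite /c mulrAC (mulrC (_^*%R)) -normCK.
    by rewrite (@rnormE _ R[i]^o) expr2 mulfK// (inj_eq (@complexI _)).
  have c1 : rnorm (c : R[i]^o) = 1.
    have gn0 : (rnorm (g x))%:C != 0 :> R[i] by rewrite (inj_eq (@complexI _)).
    have e : `|(rnorm (g x))%:C : R[i]^o| = (rnorm (g x))%:C.
      by rewrite rnormE rnorm_real gtr0_norm.
    apply/complexI; rewrite -rnormE /c (normrM (_^*%R)) norm_conjC normfV e.
    by rewrite (@rnormE _ R[i]^o) divff.
  have := f_le (c *: x); rewrite rnormZ c1 mul1r -gre gZ.
  by rewrite (_ : c *: g x = c * g x)// cg.
have gP : g \in @bop_pred R Y R[i]^o.
  apply/asboolP; split; first by move=> c u v; rewrite gD gZ.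
  by exists 1 => u; rewrite mul1r.
exists (Bop gP); split; first exact: gle.
apply/eqP; rewrite eq_le gle /=; apply: le_trans fy _.
rewrite -(gre y) /rnorm; have := normc_ge_Re (g y).
move=> h; apply: le_trans (ler_norm _) _.
by have := h; rewrite lecE => /andP[_] /=.
Qed.

End hahn_banach.

(** * Coercive inverses and pseudospectra *)

Section coercive.
Variables (R : realType) (Y : normedModType R[i]).
Implicit Types B C : 'L(Y).

(* For eta > 0 this says that B is invertible with ||B^-1|| <= 1 / eta. *)
Definition coercive (eta : R) B :=
  invertible B /\ forall x, eta * rnorm x <= rnorm (B x).

Lemma inverse_norm_ge (eta : R) B : 0 < eta ->
  (eta%:E <= (inverse_norm B)^-1)%E <-> coercive eta B.
Proof.
move=> eta0; rewrite /inverse_norm; case: asboolP => iB; last first.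
  by rewrite invey lee_fin leNgt eta0; split=> // -[].
have [BK KB] : is_inverse B (xget 0 (is_inverse B)) by exact: xgetPex.
move: (xget _ _) BK KB => D BK KB.
have D0 : 0 <= rnorm D := rnorm_ge0 D.
have -> : (eta%:E <= (rnorm D)%:E^-1)%E = (eta * rnorm D <= 1).
  (* An inverse of norm zero occurs only on the zero space; its reciprocal is then +oo and every
     bound holds. *)
  rewrite inver; case: eqP => [->|/eqP Dn]; first by rewrite leey mulr0 ler01.
  by rewrite lee_fin -ler_pdivlMr ?div1r// lt_neqAle eq_sym Dn.
split=> [le1|[_ cB]].
  split=> // x; rewrite -{1}[x]BK; apply: (@le_trans _ _ (eta * rnorm D * rnorm (B x))).
    by rewrite -mulrA ler_wpM2l ?(ltW eta0)//; exact: bop_norm_le.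
  by rewrite ler_piMl ?rnorm_ge0.
rewrite mulrC -ler_pdivlMr// mul1r; apply: bop_norm_ub => y y1.
rewrite -[leRHS]mul1r ler_pdivlMr// mulrC; apply: le_trans (cB _) _.
by rewrite KB.
Qed.

Lemma specNE (eps : R) B l : 0 < eps ->
  ~ spec eps B l <-> coercive eps (B - l *: bop_id).
Proof.
by move=> e0; rewrite -inverse_norm_ge// /spec/= leNgt; split=> /negP.
Qed.

Lemma SpecN_coercive (eps : R) B l : 0 < eps ->
  ~ Spec eps B l -> coercive eps (B - l *: bop_id).
Proof.
move=> e0; rewrite /Spec gt_eqF//= => /negP; rewrite -ltNge => /ltW.
by rewrite inverse_norm_ge.
Qed.

Lemma coercive_SpecN (eps eps1 : R) B l : 0 <= eps -> eps < eps1 ->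
  coercive eps1 (B - l *: bop_id) -> ~ Spec eps B l.
Proof.
move=> e0 e1 cB; rewrite /Spec; case: eqP => [_ /=|/eqP en0].
  by case: cB => iB _ /(_ iB).
apply/negP; rewrite -ltNge; apply: (@lt_le_trans _ _ eps1%:E).
  by rewrite lte_fin.
by apply/inverse_norm_ge => //; exact: le_lt_trans e1.
Qed.

End coercive.

(** * The sine window *)

Section sine_window.
Variables (R : realType) (n : nat).
Hypothesis n0 : (0 < n)%N.

Definition angle : R := pi / (2 * n%:R).
Definition sinw (j : nat) : R := sin (j.*2.+1%:R * angle).
(* With the antiperiodic convention w_(-1) = - w_(n-1), the difference
   |w_j - w_(j-1)| is 2 sin(angle) * cosw j for all j < n, see sinwS, sinw_wrap. *)
Definition cosw (j : nat) : R := `|cos (j.*2%:R * angle)|.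

Lemma angleE : n%:R * (angle *+ 2) = pi.
Proof. by rewrite /angle -mulr_natl; field; rewrite pnatr_eq0 -lt0n. Qed.

Lemma sin_angle_gt0 : 0 < sin angle.
Proof.
have n1 : 1 <= n%:R :> R by rewrite ler1n.
apply: sin_gt0_pi; rewrite divr_gt0 ?pi_gt0//=; last by lra.
by rewrite ltr_pdivrMr; have := @pi_gt0 R; [nra | lra].
Qed.

Lemma sinw_gt0 (j : nat) : (j < n)%N -> 0 < sinw j.
Proof.
move=> jn; have n1 : 0 < n%:R :> R by rewrite ltr0n.
have a0 : 0 < angle by rewrite divr_gt0 ?pi_gt0//; lra.
apply: sin_gt0_pi; rewrite mulr_gt0//= -angleE -(mulr_natl angle) mulrA ltr_pM2r//.
by rewrite -natrM ltr_nat -muln2; lia.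
Qed.

Lemma sinwS (j : nat) : `|sinw j.+1 - sinw j| = 2 * sin angle * cosw j.+1.
Proof.
rewrite /sinw /cosw; set a := j.+1.*2%:R * angle.
have -> : j.+1.*2.+1%:R * angle = a + angle by rewrite -natr1 mulrDl mul1r.
have -> : j.*2.+1%:R * angle = a - angle by rewrite /a doubleS -natr1; ring.
rewrite sinD sinB.
rewrite (_ : _ - _ = 2 * sin angle * cos a); last by ring.
by rewrite normrM gtr0_norm// mulr_gt0// sin_angle_gt0.
Qed.

Lemma sinw_wrap : sinw 0 + sinw n.-1 = 2 * sin angle.
Proof.
rewrite /sinw mul1r (_ : n.-1.*2.+1%:R * angle = - angle + pi).
  by rewrite sinDpi sinN opprK; ring.
rewrite -angleE; case: n n0 => // m _ /=.
by rewrite -muln2 -natr1 natrM -natr1 -mulr_natl; ring.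
Qed.

Lemma cosw0 : cosw 0 = 1.
Proof. by rewrite /cosw mul0r cos0 normr1. Qed.

Lemma coswn : cosw n = 1.
Proof. by rewrite /cosw -muln2 natrM -mulrA (mulr_natl angle) angleE cospi normrN1. Qed.

(** With h the angle, cos^2 a - sin^2(a + h) = cos(2a + h) cos h, so the difference of the sums
    telescopes after multiplication by 4 sin h. Evaluating both sums to n / 2 would exclude n = 1,
    where they equal 1. *)
Lemma sum_cosw_sinw : \sum_(j < n) cosw j ^+ 2 = \sum_(j < n) sinw j ^+ 2.
Proof.
have s0 := sin_angle_gt0.
pose T (j : nat) := sin ((4 * j%:R - 1) * angle).
apply/eqP; rewrite -subr_eq0 -sumrB.
have : 4 * sin angle * (\sum_(j < n) (cosw j ^+ 2 - sinw j ^+ 2)) = 0.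
  rewrite mulr_sumr -(big_mkord xpredT
    (fun j => 4 * sin angle * (cosw j ^+ 2 - sinw j ^+ 2))).
  rewrite (@telescope_sumr_eq _ _ _ T)//; last first.
    move=> j _; rewrite /cosw /sinw /T real_normK ?num_real//.
    set a := j.*2%:R * angle.
    have -> : j.*2.+1%:R * angle = a + angle by rewrite -natr1 mulrDl mul1r.
    have -> : (4 * j.+1%:R - 1) * angle = (a + a + angle) + (angle + angle).
      by rewrite /a -muln2 natrM -natr1; ring.
    have -> : (4 * j%:R - 1) * angle = (a + a + angle) - (angle + angle).
      by rewrite /a -muln2 natrM; ring.
    rewrite (sinD _ (angle + angle)) (sinB _ (angle + angle)) (sinD angle angle).
    rewrite (cosD (a + a)) (cosD a a) (sinD a a) (sinD a angle).
    have := cos2Dsin2 angle; move: (cos (angle + angle)) (sin (a + a + angle)).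
    move: (cos a) (sin a) (cos angle) (sin angle) => ca sa c s C u h1.
    have e : ca ^+ 2 = ca ^+ 2 * (c ^+ 2 + s ^+ 2) by rewrite h1 mulr1.
    by rewrite {1}e; ring.
  rewrite /T mulr0 add0r mulN1r sinN.
  rewrite (_ : _ * angle = - angle + pi *+ 2); last first.
    by rewrite -angleE; ring.
  by rewrite sinD2pi sinN subrr.
by move/eqP; rewrite mulf_eq0 mulf_eq0 (gt_eqF s0) pnatr_eq0.
Qed.

Lemma sum_coswS_sinw : \sum_(j < n) cosw j.+1 ^+ 2 = \sum_(j < n) sinw j ^+ 2.
Proof.
rewrite -sum_cosw_sinw; case: n coswn => [|m] cm; first by rewrite !big_ord0.
by rewrite big_ord_recr /= cm [RHS]big_ord_recl /= cosw0 addrC.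
Qed.

Lemma sum_sinw_gt0 : 0 < \sum_(j < n) sinw j ^+ 2.
Proof.
rewrite -sum_cosw_sinw; case: n n0 => // m _.
rewrite big_ord_recl cosw0 expr1n ltr_pwDl// sumr_ge0// => j _; exact: sqr_ge0.
Qed.

End sine_window.

(** * Square-summable sequences *)

(** Minkowski's inequality for three vectors of equal norm; the difference of the two sides is an
    explicit combination of squares. *)
Lemma sum_sqr3_le (R : realType) (n : nat) (w C D : 'I_n -> R) (S p u v : R) :
  0 <= p -> 0 <= u -> 0 <= v ->
  \sum_j w j ^+ 2 = S -> \sum_j C j ^+ 2 = S -> \sum_j D j ^+ 2 = S ->
  \sum_j (w j * p + C j * u + D j * v) ^+ 2 <= S * (p + u + v) ^+ 2.
Proof.
move=> p0 u0 v0 wS CS DS.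
have -> : S * (p + u + v) ^+ 2 = \sum_j (w j ^+ 2 * (p * (p + u + v)) +
    C j ^+ 2 * (u * (p + u + v)) + D j ^+ 2 * (v * (p + u + v))).
  by rewrite !big_split /= -!mulr_suml wS CS DS; ring.
apply: ler_sum => j _; rewrite -subr_ge0.
rewrite (_ : _ - _ = p * u * (w j - C j) ^+ 2 + p * v * (w j - D j) ^+ 2
  + u * v * (C j - D j) ^+ 2); last by ring.
by do 2?[apply: addr_ge0]; apply: mulr_ge0 (sqr_ge0 _); apply: mulr_ge0.
Qed.

(** Cauchy-Schwarz, from (C_j q - z_j)^2 >= 0; the case q = 0 is apart because a factor 2 q is
    cancelled. *)
Lemma sum_mul_le (R : realType) (n : nat) (C z : 'I_n -> R) (S q : R) :
  0 <= q -> \sum_j C j ^+ 2 = S -> \sum_j z j ^+ 2 <= S * q ^+ 2 ->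
  \sum_j C j * z j <= S * q.
Proof.
move=> q0 CS zS.
move: q0; rewrite le_eqVlt => /predU1P[q0|q0].
  rewrite -q0 mulr0; rewrite -q0 expr0n mulr0 in zS.
  rewrite big1// => j _; suff -> : z j = 0 by rewrite mulr0.
  apply/eqP; rewrite -sqrf_eq0 eq_le sqr_ge0 andbT; apply: le_trans zS.
  by rewrite (bigD1 j)//= lerDl sumr_ge0// => k _; exact: sqr_ge0.
rewrite -(@ler_pM2r _ (2 * q)) ?mulr_gt0//.
have -> : S * q * (2 * q) = (\sum_j C j ^+ 2) * q ^+ 2 + S * q ^+ 2 by rewrite CS; ring.
apply: le_trans (lerD (lexx _) zS); rewrite !mulr_suml -big_split; apply: ler_sum => j _ /=.
by rewrite -subr_ge0 (_ : _ - _ = (C j * q - z j) ^+ 2) ?sqr_ge0//; ring.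
Qed.

(* The zero vector if u is not square summable. Locked, so that unification does
   not unfold the subtype machinery behind it. *)
HB.lock Definition ell2_of (R : realType) (I : choiceType)
  (X : normedModType R[i]) (u : I -> X) : ell2 I X := insubd 0 u.

Section ell2_lemmas.
Variables (R : realType) (I : choiceType) (X : normedModType R[i]).

Lemma ell2_sum_rnorm (x : ell2 I X) : ell2_sum x = (rnorm x ^+ 2)%:E.
Proof. exact: ell2_sumE. Qed.

Lemma rnorm_ell2_le (x : ell2 I X) (s : R) : 0 <= s ->
  (ell2_sum x <= (s ^+ 2)%:E)%E -> rnorm x <= s.
Proof. by move=> s0; rewrite -ell2_norm_le. Qed.

Lemma sum_rnorm_esum (n : nat) (z : 'I_n -> ell2 I X) :
  (\sum_j rnorm (z j) ^+ 2)%:E =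
  (\esum_(k in [set: I]) (\sum_j rnorm (z j k) ^+ 2)%:E)%E.
Proof.
under [RHS]eq_esum do rewrite -sumEFin.
rewrite esum_sum; last by move=> *; rewrite lee_fin sqr_ge0.
by rewrite -sumEFin; apply: eq_bigr => j _; rewrite -ell2_sum_rnorm.
Qed.

(** Passes from single windows to the whole sequence: with [k] numbering the windows, an estimate in
    each X^n is summed over [k] and the two summations are interchanged. *)
Lemma ell2_family_le (n m : nat) (x : 'I_n -> ell2 I X) (y : 'I_m -> ell2 I X)
    (c : R) : 0 <= c ->
  (forall k, c * \sum_j rnorm (x j k) ^+ 2 <= \sum_j rnorm (y j k) ^+ 2) ->
  c * \sum_j rnorm (x j) ^+ 2 <= \sum_j rnorm (y j) ^+ 2.
Proof.
move=> c0 h; rewrite -lee_fin EFinM !sum_rnorm_esum -esumZl//; last first.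
  by move=> k; rewrite lee_fin sumr_ge0// => j _; exact: sqr_ge0.
by apply: le_esum => k _; rewrite -EFinM lee_fin.
Qed.

Lemma ell2_ofE (u : I -> X) (M : R) (n : nat) (y : 'I_n -> ell2 I X) : 0 <= M ->
  (forall k, rnorm (u k) ^+ 2 <= M * \sum_j rnorm (y j k) ^+ 2) ->
  forall k, ell2_of u k = u k.
Proof.
move=> M0 h k; rewrite ell2_of.unlock -[LHS]/(val (insubd _ _) k) val_insubd ifT// inE.
apply: (@le_lt_trans _ _ (M%:E * (\sum_j rnorm (y j) ^+ 2)%:E)%E).
  rewrite sum_rnorm_esum -esumZl//; last first.
    by move=> i; rewrite lee_fin sumr_ge0// => j _; exact: sqr_ge0.
  by apply: le_esum => i _; rewrite -EFinM lee_fin.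
by rewrite -EFinM ltry.
Qed.

Lemma ell2_domE (u : I -> X) (M : R) (x : ell2 I X) : 0 <= M ->
  (forall k, rnorm (u k) <= M * rnorm (x k)) ->
  (forall k, ell2_of u k = u k) /\ rnorm (ell2_of u) <= M * rnorm x.
Proof.
move=> M0 h.
have h2 k : rnorm (u k) ^+ 2 <= M ^+ 2 * \sum_(j < 1) rnorm (x k) ^+ 2.
  by rewrite big_ord1 -exprMn ler_sqr ?nnegrE ?rnorm_ge0// mulr_ge0 ?rnorm_ge0.
have E := ell2_ofE (sqr_ge0 M) h2; split=> //.
rewrite -ler_sqr ?nnegrE ?rnorm_ge0 ?mulr_ge0 ?rnorm_ge0//.
have := @ell2_family_le 1 1 (fun=> ell2_of u) (fun=> M%:C *: x) 1 ler01.
rewrite !big_ord1 mul1r rnormZr ger0_norm//; apply => k.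
rewrite !big_ord1 mul1r E -[(_ *: x) k]/(M%:C *: x k) rnormZr ger0_norm//.
by rewrite ler_sqr ?nnegrE ?rnorm_ge0// mulr_ge0 ?rnorm_ge0.
Qed.

Lemma ell2D (x y : ell2 I X) k : (x + y) k = x k + y k. Proof. by []. Qed.
Lemma ell2B (x y : ell2 I X) k : (x - y) k = x k - y k. Proof. by []. Qed.
Lemma ell2Z (l : R[i]) (x : ell2 I X) k : (l *: x) k = l *: x k. Proof. by []. Qed.
Lemma ell2_sumE_coord (J : Type) (r : seq J) (P : pred J) (F : J -> ell2 I X) k :
  (\sum_(j <- r | P j) F j) k = \sum_(j <- r | P j) F j k.
Proof. by elim/big_rec2 : _ => // j u v _ <-. Qed.

Lemma ell2_eqP (x y : ell2 I X) : (forall k, x k = y k) -> x = y.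
Proof. by move=> h; apply/val_inj/funext. Qed.

End ell2_lemmas.

Section shift.
Variables (R : realType) (X : normedModType R[i]).
Implicit Types (x y : ell2 int X) (m k : int).

Definition ell2_shift m x : ell2 int X := ell2_of (fun k => x (k + m)).

Lemma ell2_sum_shift m (u : int -> X) : ell2_sum (fun k => u (k + m)) = ell2_sum u.
Proof.
rewrite /ell2_sum [RHS](@reindex_esum _ _ _ setT setT (fun k => k + m))//.
split=> //; first by move=> a b _ _ /addIr.
by move=> k _; exists (k - m) => //; rewrite subrK.
Qed.

Lemma ell2_shiftE m x k : ell2_shift m x k = x (k + m).
Proof.
rewrite /ell2_shift ell2_of.unlock -[LHS]/(val (insubd _ _) k) val_insubd ifT//.
by rewrite inE ell2_sum_shift; have := ell2P x; rewrite inE.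
Qed.

Lemma rnorm_ell2_shift m x : rnorm (ell2_shift m x) = rnorm x.
Proof.
apply/eqP; rewrite -(@eqrXn2 _ 2) ?rnorm_ge0// -(inj_eq (@EFin_inj _)).
rewrite -!ell2_sum_rnorm -(ell2_sum_shift m x); apply/eqP; congr (ell2_sum _).
by apply/funext => k; rewrite ell2_shiftE.
Qed.

Definition op_bound (M : R) (a : int -> 'L(X)) :=
  forall k v, rnorm (a k v) <= M * rnorm v.

Definition diag_op (a : int -> 'L(X)) x : ell2 int X := ell2_of (fun k => a k (x k)).

Lemma diag_opE (M : R) a x k : 0 <= M -> op_bound M a -> diag_op a x k = a k (x k).
Proof.
move=> M0 aM.
by have [->] := @ell2_domE R int X (fun k => a k (x k)) M x M0 (fun k => aM k _).
Qed.

Lemma rnorm_diag_op (M : R) a x : 0 <= M -> op_bound M a ->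
  rnorm (diag_op a x) <= M * rnorm x.
Proof.
move=> M0 aM.
by have [_] := @ell2_domE R int X (fun k => a k (x k)) M x M0 (fun k => aM k _).
Qed.

End shift.

(** * Completeness and approximate right inverses *)

Section geometric.
Variables (R : realType) (rho : R).
Hypotheses (rho0 : 0 <= rho) (rho1 : rho < 1).

Lemma geometric_small (K e : R) : 0 < e -> exists M : nat, K * rho ^+ M <= e.
Proof.
move=> e0; have rn : `|rho| < 1 by rewrite ger0_norm.
have K0 : 0 < `|K| + 1 by rewrite ltr_pwDr.
have eK : 0 < e / (`|K| + 1) by rewrite divr_gt0.
have [M _ /(_ M (leqnn M)) /=] := (@cvgrPdist_le _ _ _ _ _ _ _).1 (cvg_expr rn) _ eK.
rewrite sub0r normrN normrX ger0_norm// ler_pdivlMr// => h; exists M.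
apply: le_trans h; rewrite mulrC ler_wpM2l ?exprn_ge0//.
by have := ler_norm K; lra.
Qed.

Lemma geometric_sum_dist (V : normedModType R[i]) (u : nat -> V) (c : R) (m d : nat) :
  (forall l, rnorm (u l) <= c * rho ^+ l) -> 0 <= c ->
  rnorm (\sum_(0 <= l < m + d) u l - \sum_(0 <= l < m) u l)
    <= c / (1 - rho) * rho ^+ m.
Proof.
move=> uc c0; have r1 : 0 < 1 - rho by rewrite subr_gt0.
apply: (@le_trans _ _ (c / (1 - rho) * (rho ^+ m - rho ^+ (m + d)))).
  elim: d => [|d IH]; first by rewrite addn0 !subrr rnorm0 mulr0.
  rewrite addnS big_nat_recr//= addrAC; apply: le_trans (rnormD _ _) _.
  apply: le_trans (lerD IH (uc _)) _; rewrite le_eqVlt; apply/orP; left; apply/eqP.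
  by rewrite exprS; field; rewrite gt_eqF.
rewrite ler_wpM2l ?divr_ge0 ?(ltW r1)//.
by rewrite gerBl exprn_ge0.
Qed.

Lemma geometric_series_cvg (V : completeNormedModType R[i]) (u : nat -> V) (c : R) :
  (forall l, rnorm (u l) <= c * rho ^+ l) -> 0 <= c ->
  exists x, forall m, rnorm (x - \sum_(0 <= l < m) u l) <= c / (1 - rho) * rho ^+ m.
Proof.
move=> uc c0; pose K := c / (1 - rho).
have K0 : 0 <= K by rewrite divr_ge0// subr_ge0 ltW.
have dec (a b : nat) : (a <= b)%N -> rho ^+ b <= rho ^+ a.
  by move=> ab; rewrite ler_wiXn2l// ltW.
have su : cvg (series u @ \oo).
  apply/cauchy_cvgP/cauchy_seriesP => e e0.
  have eR : e = (complex.Re e)%:C by move: e0; case: e => a b; rewrite ltcE/= => /andP[/eqP->].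
  rewrite eR ltcR in e0 *; move: (complex.Re e) e0 => {eR}e e0.
  have [M hM] := geometric_small K (divr_gt0 e0 (ltr0n _ 2)).
  exists ([set n | (M <= n)%N], [set n | (M <= n)%N]); first by split; exists M.
  move=> [a b] /= [Ma Mb]; rewrite rnormE ltcR.
  have [ab|ab] := leqP a b; last first.
    by rewrite big_geq ?(ltnW ab)// rnorm0.
  rewrite -(subnKC ab) -(addKr (\sum_(0 <= k < a) u k) (\sum_(_ <= k < _) _)).
  rewrite -big_cat_nat//= ?leq_addr// addrC.
  apply: le_lt_trans (geometric_sum_dist _ _ uc c0) _.
  apply: le_lt_trans (_ : _ <= e / 2) _; last by rewrite ltr_pdivrMr// ltr_pMr// ltr1n.
  by apply: le_trans hM; rewrite ler_wpM2l// dec.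
exists (lim (series u @ \oo)) => m; rewrite -/K; apply/ler_addgt0Pl => e e0.
have [N _ hN] := (@cvgrPdist_le _ _ _ _ _ _ _).1 su e%:C (introT idP (etrans (ltcR 0 e) e0)).
have := hN (m + N)%N (leq_addl _ _); rewrite /= rnormE lecR /series/= => h.
rewrite -(subrKA (\sum_(0 <= k < m + N) u k)) -/K.
by apply: le_trans (rnormD _ _) _; rewrite lerD// geometric_sum_dist.
Qed.

(** Completeness of [ell2] in the form that the Neumann series needs. The limit is taken in each
    coordinate and is not known to be square summable; the tail bound on finite sets of coordinates
    gives both membership and convergence. *)
Lemma ell2_series_cvg (I : choiceType) (X : completeNormedModType R[i])
    (u : nat -> ell2 I X) (c : R) :
  (forall l, rnorm (u l) <= c * rho ^+ l) -> 0 <= c ->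
  exists x, forall m, rnorm (x - \sum_(0 <= l < m) u l) <= c / (1 - rho) * rho ^+ m.
Proof.
move=> uc c0; pose K := c / (1 - rho).
have K0 : 0 <= K by rewrite divr_ge0// subr_ge0 ltW.
have uci i l : rnorm (u l i) <= c * rho ^+ l.
  by apply: le_trans (uc l); exact: ell2_norm_coord.
pose x i := sval (cid (geometric_series_cvg (uci i) c0)).
have xP i m : rnorm (x i - \sum_(0 <= l < m) u l i) <= K * rho ^+ m.
  exact: (svalP (cid (geometric_series_cvg (uci i) c0))).
pose s m : ell2 I X := \sum_(0 <= l < m) u l.
have sE m i : s m i = \sum_(0 <= l < m) u l i by rewrite ell2_sumE_coord.
have tail m : (ell2_sum (fun i => x i - s m i)%R <= ((K * rho ^+ m) ^+ 2)%:E)%E.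
  set k := K * rho ^+ m; have k0 : 0 <= k by rewrite mulr_ge0 ?exprn_ge0.
  apply: ge_ereal_sup => _ [A [finA _] <-].
  rewrite fsbig_finite//= sumEFin lee_fin; set F := (X in \sum_(_ <- X) _).
  pose N : R := (size F)%:R; have N0 : 0 <= N by rewrite ler0n.
  have kN : 0 < (2 * k + 1) * (N + 1) by rewrite mulr_gt0//; lra.
  apply/ler_addgt0Pl => e e0.
  (* On the [N] coordinates in [F] the limit is replaced by a later partial sum, at the cost of [d]
     per coordinate. Since (d + D)^2 <= (2k + 1) d + D^2 for d <= 1 and D <= k, the total cost is at
     most (2k + 1) N d <= e. *)
  have [|M hM] := @geometric_small K (Num.min 1 (e / ((2 * k + 1) * (N + 1)))).
    by rewrite lt_min ltr01 divr_gt0.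
  set d := K * rho ^+ M in hM; have d0 : 0 <= d by rewrite mulr_ge0 ?exprn_ge0.
  have sk : rnorm (s (m + M)%N - s m) <= k by exact: geometric_sum_dist.
  pose D i := rnorm (s (m + M)%N i - s m i).
  have DK : \sum_(i <- F) D i ^+ 2 <= k ^+ 2.
    rewrite -lee_fin; apply: (@le_trans _ _ (ell2_sum (s (m + M)%N - s m))).
      by apply: esum_ge; exists A => //; rewrite fsbig_finite//= sumEFin.
    by rewrite ell2_sum_rnorm lee_fin ler_sqr ?nnegrE ?rnorm_ge0.
  have Dk i : D i <= k by apply: le_trans sk; exact: (ell2_norm_coord (s (m + M)%N - s m) i).
  apply: (@le_trans _ _ (\sum_(i <- F) ((2 * k + 1) * d + D i ^+ 2))).
    apply: ler_sum => i _.
    have h : rnorm (x i - s m i) <= d + D i.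
      rewrite -(subrKA (s (m + M)%N i)); apply: le_trans (rnormD _ _) _.
      rewrite lerD2r sE; apply: le_trans (xP _ _) _; rewrite ler_wpM2l//.
      by rewrite ler_wiXn2l ?leq_addl// ltW.
    have d1 : d <= 1 by apply: le_trans hM _; rewrite ge_min lexx.
    have := rnorm_ge0 (x i - s m i); have := Dk i; have := rnorm_ge0 (s (m + M)%N i - s m i).
    rewrite -/(D i); nra.
  rewrite big_split/=; apply: lerD => //.
  rewrite big_const_seq count_predT iter_addr_0 -mulr_natr -/N.
  have : d * ((2 * k + 1) * (N + 1)) <= e.
    by rewrite -ler_pdivlMr//; apply: le_trans hM _; rewrite ge_min lexx orbT.
  by have := mulr_ge0 d0 k0; lra.
have xP2 : x \in @ell2_pred R I X.
  have hP : (fun i => x i - s 0 i) \in @ell2_pred R I X.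
    by rewrite inE; apply: le_lt_trans (tail 0%N) _; rewrite ltry.
  suff -> : x = fun i => x i - s 0%N i by [].
  by apply/funext => i; rewrite sE big_geq// subr0.
exists (Ell2 xP2) => m; apply: rnorm_ell2_le; first by rewrite mulr_ge0 ?exprn_ge0.
exact: tail.
Qed.

End geometric.

(** * Surjectivity from an approximate right inverse *)

Section neumann.
Variables (R : realType) (V : normedModType R[i]) (T : 'L(V)) (G : V -> V).
Variables (rho c : R).
Hypotheses (rho0 : 0 <= rho) (rho1 : rho < 1) (c0 : 0 <= c).
Hypothesis cvgV : forall (u : nat -> V) (C : R),
  (forall l, rnorm (u l) <= C * rho ^+ l) -> 0 <= C ->
  exists x, forall m, rnorm (x - \sum_(0 <= l < m) u l) <= C / (1 - rho) * rho ^+ m.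
Hypothesis Gc : forall y, rnorm (G y) <= c * rnorm y.
Hypothesis TG : forall y, rnorm (T (G y) - y) <= rho * rnorm y.

(** The residuals r_(m+1) = r_m - T (G r_m) decay geometrically, and [T] maps the partial sums of
    the G (r_l) to y - r_m. [G] is any map with these two bounds, linear or not; completeness enters
    through [cvgV]. *)
Lemma approx_right_inverse_surj y : exists x, T x = y.
Proof.
pose r (m : nat) := iter m (fun z => z - T (G z)) y.
have rE m : rnorm (r m) <= rnorm y * rho ^+ m.
  elim: m => [|m IH] /=; first by rewrite expr0 mulr1.
  rewrite rnorm_distC; apply: le_trans (TG _) _.
  by rewrite exprS mulrCA ler_wpM2l.
have uc l : rnorm (G (r l)) <= c * rnorm y * rho ^+ l.
  by rewrite -mulrA; apply: le_trans (Gc _) _; rewrite ler_wpM2l.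
have [|x hx] := cvgV uc; first by rewrite mulr_ge0 ?rnorm_ge0.
exists x; apply/eqP; rewrite -subr_eq0; apply/eqP/rnorm0_eq0/eqP.
rewrite eq_le rnorm_ge0 andbT; apply/ler_addgt0Pl => e e0; rewrite addr0.
have Ts m : T (\sum_(0 <= l < m) G (r l)) = y - r m.
  elim: m => [|m IH]; first by rewrite big_geq// linear0 subrr.
  by rewrite big_nat_recr//= linearD/= IH opprB addrAC addrA.
set K := c * rnorm y / (1 - rho) in hx.
have [M hM] := geometric_small rho0 rho1 (bop_norm T * K + rnorm y) e0.
apply: le_trans hM.
have -> : T x - y = T (x - \sum_(0 <= l < M) G (r l)) - r M.
  by rewrite linearB/= Ts opprB (addrC (r M)) addrA addrK.
apply: le_trans (rnormB _ _) _; rewrite mulrDl; apply: lerD => //.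
apply: le_trans (bop_norm_le _ _) _; rewrite -mulrA ler_wpM2l ?bop_norm_ge0//.
Qed.

End neumann.

(** * Periodized sections *)

Section corner_section.
Variables (R : realType) (X : normedModType R[i]) (n : nat).
Implicit Types (alpha beta gamma a c : int -> 'L(X)) (k : int) (j l : 'I_n).

Definition upper_op alpha a k j : 'L(X) :=
  if (j == 0%N :> nat) then a k else alpha (k + j%:Z).

Definition lower_op gamma c k j : 'L(X) :=
  if (j == n.-1 :> nat) then c k else gamma (k + j.+2%:Z).

Lemma val_ord_pred j : ord_pred j = (if j == 0%N :> nat then n.-1 else j.-1) :> nat.
Proof.
have jn := ltn_ord j; rewrite /=; case: eqP => [->|/eqP j0]; first by rewrite modn_small; lia.
by rewrite (_ : (j + n).-1 = (j.-1 + n)%N) ?modnDr ?modn_small; lia.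
Qed.

Lemma val_ordS j : ordS j = (if j == n.-1 :> nat then 0%N else j.+1) :> nat.
Proof.
have jn := ltn_ord j; rewrite /=; case: eqP => [->|/eqP j0].
  by rewrite prednK ?modnn//; lia.
by rewrite modn_small; lia.
Qed.

(** Row [j] couples [z j] to its cyclic neighbours. Comparing the coefficient of each [z l]
    separately covers n = 1 and n = 2 as well, where the neighbours coincide and the corners are
    added to other entries. *)
Lemma corner_sectionE alpha beta gamma a c k (z : ell2 'I_n X) j :
  corner_section alpha beta gamma a c n k z j =
  upper_op alpha a k j (z (ord_pred j)) + beta (k + j.+1%:Z) (z j)
  + lower_op gamma c k j (z (ordS j)).
Proof.
have pick p (F : 'I_n -> X) : \sum_l F l *+ (l == p) = F p.
  rewrite (bigD1 p)//= eqxx big1 ?addr0// => l /negbTE ->; exact: mulr0n.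
rewrite -(pick (ord_pred j) (fun l => upper_op alpha a k j (z l))).
rewrite -(pick j (fun l => beta (k + j.+1%:Z) (z l))).
rewrite -(pick (ordS j) (fun l => lower_op gamma c k j (z l))).
rewrite -!big_split /=; apply: eq_bigr => l _; rewrite !mxE.
have bD (f g : 'L(X)) v : (f + g) v = f v + g v by [].
have bM (f : 'L(X)) (b : bool) v : (f *+ b) v = f v *+ b by case: b.
have nE (p q : 'I_n) : (p == q) = (p == q :> nat) by [].
rewrite !bD !bM !nE val_ord_pred val_ordS /upper_op /lower_op /entry.
have jn := ltn_ord j; have ln := ltn_ord l.
have -> : (k + j.+1%:Z == k + l.+1%:Z + 1) = (j == l.+1 :> nat) by lia.
have -> : (k + j.+1%:Z == k + l.+1%:Z) = (j == l :> nat) by lia.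
have -> : (k + j.+1%:Z == k + l.+1%:Z - 1) = (j.+1 == l :> nat) by lia.
have z0 v : (0 : 'L(X)) v = 0 by [].
have -> : (if j == l.+1 :> nat then alpha (k + l.+1%:Z) else
    if j == l :> nat then beta (k + l.+1%:Z) else
    if j.+1 == l :> nat then gamma (k + l.+1%:Z) else 0) (z l) =
    alpha (k + l.+1%:Z) (z l) *+ (j == l.+1 :> nat) +
    beta (k + l.+1%:Z) (z l) *+ (l == j :> nat) +
    gamma (k + l.+1%:Z) (z l) *+ (j.+1 == l :> nat).
  have [jl|jl] := eqVneq (j : nat) l.+1.
    have [-> ->] : (l == j :> nat) = false /\ (j.+1 == l :> nat) = false by lia.
    by rewrite !mulr0n !addr0.
  have [jl'|jl'] := eqVneq (j : nat) l.
    have -> : (j.+1 == l :> nat) = false by lia.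
    by rewrite !mulr0n addr0 add0r.
  by rewrite !mulr0n !add0r; case: eqP; rewrite ?mulr0n.
have -> : (if j == 0%N :> nat then a k else alpha (k + j%:Z)) (z l) *+
    (l == (if j == 0%N :> nat then n.-1 else j.-1) :> nat) =
    alpha (k + l.+1%:Z) (z l) *+ (j == l.+1 :> nat) +
    a k (z l) *+ ((j.+1 == 1%N) && (l.+1 == n)).
  rewrite eqSS; have [j0|j0] := eqVneq (j : nat) 0%N.
    have -> : (j == l.+1 :> nat) = false by lia.
    by rewrite mulr0n add0r; congr (_ *+ nat_of_bool _); lia.
  rewrite mulr0n addr0; have [jl|jl] := eqVneq (j : nat) l.+1.
    by rewrite jl /=; congr (_ *+ _); lia.
  by have -> : (l == j.-1 :> nat) = false by lia.
have -> : (if j == n.-1 :> nat then c k else gamma (k + j.+2%:Z)) (z l) *+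
    (l == (if j == n.-1 :> nat then 0%N else j.+1) :> nat) =
    gamma (k + l.+1%:Z) (z l) *+ (j.+1 == l :> nat) +
    c k (z l) *+ ((j.+1 == n) && (l.+1 == 1%N)).
  rewrite eqSS; have [j0|j0] := eqVneq (j : nat) n.-1.
    have -> : (j.+1 == l :> nat) = false by lia.
    by rewrite mulr0n add0r; congr (_ *+ nat_of_bool _); lia.
  have -> : (j.+1 == n) = false by lia.
  rewrite mulr0n addr0.
  have [jl|jl] := eqVneq j.+1 (l : nat).
    by rewrite -jl; congr (_ *+ _); lia.
  by rewrite !mulr0n.
have -> : beta (k + j.+1%:Z) (z l) *+ (l == j :> nat) =
    beta (k + l.+1%:Z) (z l) *+ (l == j :> nat) by case: eqP => // ->.
rewrite -!addrA; congr (_ + _); rewrite [RHS]addrCA; congr (_ + _).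
exact: addrCA.
Qed.

End corner_section.

(** * Windowed vectors *)

Lemma bopZ (R : realType) (Y Z : normedModType R[i]) (f : bop Y Z) (l : R[i]) v :
  f (l *: v) = l *: f v.
Proof. exact: linearZ. Qed.

Section windows.
Variables (R : realType) (X : normedModType R[i]) (n : nat).
Hypothesis n0 : (0 < n)%N.
Variables (alpha beta gamma a c : int -> 'L(X)) (T : 'L(ell2 int X)).
Variables (al0 ga0 : R).
Hypotheses (al_ge0 : 0 <= al0) (ga_ge0 : 0 <= ga0).
Hypotheses (alphaM : op_bound al0 alpha) (aM : op_bound al0 a).
Hypotheses (gammaM : op_bound ga0 gamma) (cM : op_bound ga0 c).
Hypothesis triT : tridiagonal alpha beta gamma T.

Local Notation w := (sinw R n).
Local Notation s := (sin (angle R n)).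
Local Notation S := (\sum_(j < n) w j ^+ 2).
Local Notation B := (corner_section alpha beta gamma a c n).
Implicit Types (x y : ell2 int X) (k : int) (j : 'I_n).

(** The array of all windowed vectors, stored by position: [window x j] collects the entries in
    position [j] of all windows and is a multiple of a shift of [x], so its norm is immediate.
    [window_vec] reads the same array along one window. *)
Definition window x j : ell2 int X := (w j)%:C *: ell2_shift j.+1%:Z x.

Definition window_vec x k : ell2 'I_n X :=
  Ell2 (ell2_ord_finite (fun j => window x j k)).

Lemma w_ge0 j : 0 <= w j.
Proof. exact/ltW/sinw_gt0. Qed.

Lemma wn1_ge0 : 0 <= w n.-1.
Proof. by apply/ltW/sinw_gt0; rewrite ?ltn_predL. Qed.

Lemma w0_ge0 : 0 <= w 0.
Proof. exact/ltW/sinw_gt0. Qed.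

Lemma window_vecE x k j : window_vec x k j = (w j)%:C *: x (k + j.+1%:Z).
Proof. by rewrite -[LHS]/(window x j k) /window ell2Z ell2_shiftE. Qed.

Lemma sum_window x : \sum_j rnorm (window x j) ^+ 2 = S * rnorm x ^+ 2.
Proof.
rewrite mulr_suml; apply: eq_bigr => j _.
by rewrite /window rnormZr rnorm_ell2_shift exprMn real_normK ?num_real.
Qed.

(** The part of the commutator with the windows that is due to [alpha] and [a]. As a sequence in the
    window index it can be estimated at once in l^2(Z, X). For j = 0 the corner acts on the last
    entry of the window, in place of [alpha] on the entry preceding the window. *)
Definition upper_err x j : ell2 int X :=
  if j == 0%N :> nat then
    (w n.-1)%:C *: diag_op a (ell2_shift n%:Z x) - (w 0)%:C *: diag_op alpha x
  else (w j.-1 - w j)%:C *: ell2_shift j%:Z (diag_op alpha x).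

Definition lower_err x j : ell2 int X :=
  if j == n.-1 :> nat then
    (w 0)%:C *: diag_op c (ell2_shift 1 x) - (w n.-1)%:C *: ell2_shift n.+1%:Z (diag_op gamma x)
  else (w j.+1 - w j)%:C *: ell2_shift j.+2%:Z (diag_op gamma x).

Lemma upper_window x k j : upper_op alpha a k j (window_vec x k (ord_pred j)) =
  (w j)%:C *: alpha (k + j%:Z) (x (k + j%:Z)) + upper_err x j k.
Proof.
rewrite window_vecE val_ord_pred /upper_op /upper_err.
case: eqP => [->|/eqP j0].
  rewrite bopZ ell2B !ell2Z !(diag_opE _ _ al_ge0)// ell2_shiftE prednK// addr0.
  by rewrite [RHS]addrC subrK.
rewrite prednK ?lt0n// bopZ ell2Z ell2_shiftE (diag_opE _ _ al_ge0)//.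
by rewrite -scalerDl -rmorphD/= [_ + (_ - _)]addrC subrK.
Qed.

Lemma lower_window x k j : lower_op gamma c k j (window_vec x k (ordS j)) =
  (w j)%:C *: gamma (k + j.+2%:Z) (x (k + j.+2%:Z)) + lower_err x j k.
Proof.
rewrite window_vecE val_ordS /lower_op /lower_err.
case: eqP => [->|/eqP j0].
  rewrite bopZ ell2B !ell2Z ell2_shiftE !(diag_opE _ _ ga_ge0)// ell2_shiftE prednK//.
  by rewrite [RHS]addrC subrK.
rewrite bopZ ell2Z ell2_shiftE (diag_opE _ _ ga_ge0)//.
by rewrite -scalerDl -rmorphD/= [_ + (_ - _)]addrC subrK.
Qed.

Lemma section_window x k j : B k (window_vec x k) j =
  ((w j)%:C *: ell2_shift j.+1%:Z (T x) + upper_err x j + lower_err x j) k.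
Proof.
rewrite corner_sectionE upper_window lower_window !ell2D ell2Z ell2_shiftE triT.
have -> : k + j.+1%:Z - 1 = k + j%:Z by lia.
have -> : k + j.+1%:Z + 1 = k + j.+2%:Z by lia.
rewrite window_vecE bopZ !scalerDr -!addrA; congr (_ + _).
by rewrite addrCA; congr (_ + _); rewrite addrCA.
Qed.

Lemma rnorm_scale_le (p M : R) (u : ell2 int X) : 0 <= p -> rnorm u <= M ->
  rnorm (p%:C *: u) <= p * M.
Proof. by move=> p0 uM; rewrite rnormZr ger0_norm// ler_wpM2l. Qed.

Lemma upper_err_le x j : rnorm (upper_err x j) <= cosw R n j * (2 * s * al0 * rnorm x).
Proof.
have q0 := rnorm_ge0 x.
rewrite /upper_err; case: eqP => [->|/eqP j0].
  rewrite cosw0 mul1r -mulrA -sinw_wrap// mulrDl [leRHS]addrC.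
  apply: le_trans (rnormB _ _) _; apply: lerD.
    apply: rnorm_scale_le wn1_ge0 _; apply: le_trans (rnorm_diag_op _ al_ge0 aM) _.
    by rewrite rnorm_ell2_shift.
  by apply: rnorm_scale_le w0_ge0 _; apply: rnorm_diag_op.
rewrite rnormZr rnorm_ell2_shift distrC -{1}(prednK (_ : 0 < j)%N) ?lt0n// sinwS//.
rewrite prednK ?lt0n// (mulrC _ (cosw _ _ _)) -!mulrA ler_wpM2l ?normr_ge0// mulrA.
rewrite [leRHS]mulrA ler_wpM2l//; first by rewrite mulr_ge0// ltW// sin_angle_gt0.
exact: rnorm_diag_op.
Qed.

Lemma lower_err_le x j : rnorm (lower_err x j) <= cosw R n j.+1 * (2 * s * ga0 * rnorm x).
Proof.
have q0 := rnorm_ge0 x.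
rewrite /lower_err; case: eqP => [->|/eqP j0].
  rewrite prednK// coswn// mul1r -mulrA -sinw_wrap// mulrDl.
  apply: le_trans (rnormB _ _) _; apply: lerD.
    apply: rnorm_scale_le w0_ge0 _; apply: le_trans (rnorm_diag_op _ ga_ge0 cM) _.
    by rewrite rnorm_ell2_shift.
  by apply: rnorm_scale_le wn1_ge0 _; rewrite rnorm_ell2_shift; apply: rnorm_diag_op.
rewrite rnormZr rnorm_ell2_shift sinwS//.
rewrite (mulrC _ (cosw _ _ _)) -!mulrA ler_wpM2l ?normr_ge0// mulrA.
rewrite [leRHS]mulrA ler_wpM2l//; first by rewrite mulr_ge0// ltW// sin_angle_gt0.
exact: rnorm_diag_op.
Qed.

Lemma windows_lower_bound (eta : R) x : 0 <= eta ->
  (forall k z, eta * rnorm z <= rnorm (B k z)) ->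
  (eta - 2 * (al0 + ga0) * s) * rnorm x <= rnorm (T x).
Proof.
move=> eta0 hB.
have q0 := rnorm_ge0 x; have p0 := rnorm_ge0 (T x).
have s0 : 0 <= s by rewrite ltW// sin_angle_gt0.
pose Y j := (w j)%:C *: ell2_shift j.+1%:Z (T x) + upper_err x j + lower_err x j.
have h1 : eta ^+ 2 * \sum_j rnorm (window x j) ^+ 2 <= \sum_j rnorm (Y j) ^+ 2.
  apply: ell2_family_le (sqr_ge0 _) _ => k.
  have := hB k (window_vec x k).
  rewrite -ler_sqr ?nnegrE ?mulr_ge0 ?rnorm_ge0//.
  rewrite exprMn !ell2_ord_normE !sqr_sqrtr; do ?by rewrite sumr_ge0// => i _; exact: sqr_ge0.
  by under [X in _ <= X]eq_bigr do rewrite section_window.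
(* The weights w_j of the main term and the factors cosw j and cosw (j + 1) of the two errors all
   have the square sum [S], which then cancels against [sum_window]. *)
have h2 : \sum_j rnorm (Y j) ^+ 2 <=
    S * (rnorm (T x) + 2 * s * al0 * rnorm x + 2 * s * ga0 * rnorm x) ^+ 2.
  have := @sum_sqr3_le R n (fun j => w j) (fun j => cosw R n j) (fun j => cosw R n j.+1) S
    _ _ _ p0 _ _ erefl (sum_cosw_sinw _ n0) (sum_coswS_sinw _ n0).
  move=> /(_ (2 * s * al0 * rnorm x) (2 * s * ga0 * rnorm x)) h.
  apply: le_trans (h _ _); rewrite ?mulr_ge0//.
  apply: ler_sum => j _; rewrite ler_sqr ?nnegrE ?rnorm_ge0//; last first.
    by rewrite !addr_ge0 ?mulr_ge0 ?normr_ge0 ?w_ge0.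
  apply: le_trans (rnormD _ _) _; apply: lerD (lower_err_le _ _).
  apply: le_trans (rnormD _ _) _; apply: lerD (upper_err_le _ _).
  by apply: rnorm_scale_le (w_ge0 j) _; rewrite rnorm_ell2_shift.
have := le_trans h1 h2; rewrite sum_window mulrCA ler_pM2l; last exact: sum_sinw_gt0.
rewrite -exprMn ler_sqr ?nnegrE ?mulr_ge0//; last by rewrite !addr_ge0 ?mulr_ge0.
lra.
Qed.

End windows.

(** * Gluing local solutions *)

Section dual_windows.
Variables (R : realType) (X : normedModType R[i]) (n : nat).
Hypothesis n0 : (0 < n)%N.
Variables (alpha beta gamma a c : int -> 'L(X)) (T : 'L(ell2 int X)).
Variables (al0 ga0 : R).
Hypotheses (al_ge0 : 0 <= al0) (ga_ge0 : 0 <= ga0).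
Hypotheses (alphaM : op_bound al0 alpha) (aM : op_bound al0 a).
Hypotheses (gammaM : op_bound ga0 gamma) (cM : op_bound ga0 c).
Hypothesis triT : tridiagonal alpha beta gamma T.

Local Notation w := (sinw R n).
Local Notation s := (sin (angle R n)).
Local Notation S := (\sum_(j < n) w j ^+ 2).
Local Notation B := (corner_section alpha beta gamma a c n).

Variables (eta : R) (Rk : int -> 'L(ell2 'I_n X)).
Hypothesis eta0 : 0 < eta.
Hypothesis RkK : forall k z, B k (Rk k z) = z.
Hypothesis Bk : forall k z, eta * rnorm z <= rnorm (B k z).
Implicit Types (x y : ell2 int X) (k i : int) (j : 'I_n).

Definition local_sol y j : ell2 int X :=
  ell2_of (fun k => Rk k (window_vec n y k) j).

Lemma Rk_le k z : eta ^+ 2 * rnorm (Rk k z) ^+ 2 <= rnorm z ^+ 2.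
Proof.
rewrite -exprMn ler_sqr ?nnegrE ?rnorm_ge0//; last first.
  by rewrite mulr_ge0 ?rnorm_ge0// ltW.
by apply: le_trans (Bk k _) _; rewrite RkK.
Qed.

Lemma rnorm_ord_sqr (z : ell2 'I_n X) : rnorm z ^+ 2 = \sum_j rnorm (z j) ^+ 2.
Proof.
by rewrite ell2_ord_normE sqr_sqrtr// sumr_ge0// => i _; exact: sqr_ge0.
Qed.

Lemma local_solE y j k : local_sol y j k = Rk k (window_vec n y k) j.
Proof.
pose M := (eta ^+ 2)^-1; have e2 : 0 < eta ^+ 2 by rewrite exprn_gt0.
apply: (@ell2_ofE _ _ _ (fun k => Rk k (window_vec n y k) j) M n (@window _ _ n y)); first by rewrite invr_ge0 ltW.
move=> {}k; apply: (@le_trans _ _ (rnorm (Rk k (window_vec n y k)) ^+ 2)).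
  by rewrite ler_sqr ?nnegrE ?rnorm_ge0//; exact: ell2_norm_coord.
by rewrite mulrC ler_pdivlMr// mulrC; apply: le_trans (Rk_le _ _) _; rewrite rnorm_ord_sqr.
Qed.

Lemma sum_local_sol y : eta ^+ 2 * \sum_j rnorm (local_sol y j) ^+ 2 <= S * rnorm y ^+ 2.
Proof.
rewrite -(@sum_window _ _ n y); apply: ell2_family_le (sqr_ge0 _) _ => k.
have := Rk_le k (window_vec n y k); rewrite !rnorm_ord_sqr.
by under eq_bigr do rewrite -local_solE.
Qed.

(* Up to the factor S, an approximate solution of T x = y. *)
Definition glued_sum y : ell2 int X :=
  \sum_(j < n) (w j)%:C *: ell2_shift (- j.+1%:Z) (local_sol y j).

(** Here the shift by one falls on the position within a window: the term of [alpha] (i - 1) from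
    position [j] is matched with row [ordS j] of the window in which [i] has that position. At the
    wrap-around the two terms come from the different windows i - 1 - n and i - 1 and can only be
    estimated separately, which is harmless as shifts preserve the norm. *)
Definition upper_adj_err y j : ell2 int X :=
  if j == n.-1 :> nat then
    (w n.-1)%:C *: ell2_shift (-1) (diag_op alpha (ell2_shift (- n%:Z) (local_sol y j)))
    - (w 0)%:C *: ell2_shift (-1) (diag_op a (local_sol y j))
  else (w j - w j.+1)%:C *:
    ell2_shift (-1) (diag_op alpha (ell2_shift (- j.+1%:Z) (local_sol y j))).

Definition lower_adj_err y j : ell2 int X :=
  if j == 0%N :> nat then
    (w 0)%:C *: ell2_shift 1 (diag_op gamma (ell2_shift (-1) (local_sol y j)))
    - (w n.-1)%:C *: ell2_shift (- n%:Z) (diag_op c (local_sol y j))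
  else (w j - w j.-1)%:C *:
    ell2_shift 1 (diag_op gamma (ell2_shift (- j.+1%:Z) (local_sol y j))).

Lemma upper_glued y j i :
  (w j)%:C *: alpha (i - 1) (local_sol y j (i - 1 - j.+1%:Z)) =
  (w (ordS j))%:C *: upper_op alpha a (i - (ordS j).+1%:Z) (ordS j)
     (local_sol y j (i - (ordS j).+1%:Z)) + upper_adj_err y j i.
Proof.
rewrite /upper_adj_err /upper_op val_ordS; case: eqP => [->|/eqP jn].
  rewrite eqxx ell2B !ell2Z !ell2_shiftE !(diag_opE _ _ al_ge0)// ell2_shiftE prednK//.
  by rewrite [RHS]addrC subrK.
have -> : (j.+1 == 0%N) = false by [].
rewrite ell2Z ell2_shiftE (diag_opE _ _ al_ge0)// ell2_shiftE.
have -> : i - j.+2%:Z + j.+1%:Z = i - 1 by lia.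
have -> : i - j.+2%:Z = i - 1 - j.+1%:Z by lia.
by rewrite -scalerDl -rmorphD/= [_ + (_ - _)]addrC subrK.
Qed.

Lemma lower_glued y j i :
  (w j)%:C *: gamma (i + 1) (local_sol y j (i + 1 - j.+1%:Z)) =
  (w (ord_pred j))%:C *: lower_op gamma c (i - (ord_pred j).+1%:Z) (ord_pred j)
     (local_sol y j (i - (ord_pred j).+1%:Z)) + lower_adj_err y j i.
Proof.
have jn := ltn_ord j.
rewrite /lower_adj_err /lower_op val_ord_pred; case: eqP => [->|/eqP j0].
  rewrite eqxx ell2B !ell2Z !ell2_shiftE !(diag_opE _ _ ga_ge0)// ell2_shiftE prednK//.
  by rewrite [RHS]addrC subrK.
have -> : (j.-1 == n.-1) = false by lia.
rewrite ell2Z ell2_shiftE (diag_opE _ _ ga_ge0)// ell2_shiftE.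
have -> : i - j.-1.+1%:Z + j.-1.+2%:Z = i + 1 by lia.
have -> : i - j.-1.+1%:Z = i + 1 - j.+1%:Z by lia.
by rewrite -scalerDl -rmorphD/= [_ + (_ - _)]addrC subrK.
Qed.

Lemma glued_residual y :
  T (glued_sum y) = S%:C *: y + \sum_j (upper_adj_err y j + lower_adj_err y j).
Proof.
apply: ell2_eqP => i; rewrite triT ell2D ell2Z [in RHS]ell2_sumE_coord.
have gE m : glued_sum y m = \sum_(j < n) (w j)%:C *: local_sol y j (m - j.+1%:Z).
  by rewrite /glued_sum ell2_sumE_coord; apply: eq_bigr => j _; rewrite ell2Z ell2_shiftE.
have sumE (f : 'L(X)) (F : 'I_n -> X) : f (\sum_j F j) = \sum_j f (F j) by exact: raddf_sum.
rewrite !gE !sumE.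
under eq_bigr do rewrite bopZ upper_glued.
under [X in _ + X]eq_bigr do rewrite bopZ lower_glued.
rewrite !big_split /=.
rewrite rmorph_sum scaler_suml.
(* Each window containing [i] contributes w_j^2 y_i, as row [j] of B_k (R_k z) = z; together they
   give [S] times y_i. A cyclic reindexing then matches the neighbours with the two [glued]
   lemmas. *)
have -> : \sum_(j < n) (w j ^+ 2)%:C *: y i = \sum_(j < n) (w j)%:C *: (
    upper_op alpha a (i - j.+1%:Z) j (local_sol y (ord_pred j) (i - j.+1%:Z)) +
    beta i (local_sol y j (i - j.+1%:Z)) +
    lower_op gamma c (i - j.+1%:Z) j (local_sol y (ordS j) (i - j.+1%:Z))).
  apply: eq_bigr => j _; rewrite !local_solE.
  have -> : beta i = beta (i - j.+1%:Z + j.+1%:Z) by rewrite subrK.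
  rewrite -corner_sectionE.
  by rewrite RkK window_vecE subrK scalerA -rmorphM/= expr2.
under [X in _ = X + _]eq_bigr do rewrite !scalerDr.
rewrite !big_split /=.
pose U j := (w j)%:C *: upper_op alpha a (i - j.+1%:Z) j
  (local_sol y (ord_pred j) (i - j.+1%:Z)).
pose L j := (w j)%:C *: lower_op gamma c (i - j.+1%:Z) j
  (local_sol y (ordS j) (i - j.+1%:Z)).
have UE : \sum_j U j = \sum_(j < n) (w (ordS j))%:C *: upper_op alpha a
    (i - (ordS j).+1%:Z) (ordS j) (local_sol y j (i - (ordS j).+1%:Z)).
  rewrite (reindex_inj (can_inj (@ordSK n))); apply: eq_bigr => j _.
  by rewrite /U ordSK.
have LE : \sum_j L j = \sum_(j < n) (w (ord_pred j))%:C *: lower_op gamma c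
    (i - (ord_pred j).+1%:Z) (ord_pred j) (local_sol y j (i - (ord_pred j).+1%:Z)).
  rewrite (reindex_inj (can_inj (@ord_predK n))); apply: eq_bigr => j _.
  by rewrite /L ord_predK.
rewrite -UE -LE; under [X in _ + X + _ = _]eq_bigr do rewrite bopZ.
rewrite -/(U _) -/(L _).
rewrite -!addrA; congr (_ + _); rewrite addrCA; congr (_ + _).
exact: addrCA.
Qed.

Lemma upper_adj_err_le y j :
  rnorm (upper_adj_err y j) <= 2 * s * al0 * (cosw R n j.+1 * rnorm (local_sol y j)).
Proof.
have q0 := rnorm_ge0 (local_sol y j).
have dM (b : int -> 'L(X)) m : op_bound al0 b ->
    rnorm (diag_op b (ell2_shift m (local_sol y j))) <= al0 * rnorm (local_sol y j).
  by move=> bM; apply: le_trans (rnorm_diag_op _ al_ge0 bM) _; rewrite rnorm_ell2_shift.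
rewrite /upper_adj_err; case: eqP => [->|/eqP j0].
  rewrite prednK// coswn// mul1r -mulrA -sinw_wrap// mulrDl [leRHS]addrC.
  apply: le_trans (rnormB _ _) _; apply: lerD.
    by apply: rnorm_scale_le (wn1_ge0 _ n0) _; rewrite rnorm_ell2_shift dM.
  apply: rnorm_scale_le (w0_ge0 _ n0) _; rewrite rnorm_ell2_shift.
  exact: rnorm_diag_op.
rewrite rnormZr rnorm_ell2_shift distrC sinwS//.
rewrite [leRHS](_ : _ = 2 * s * cosw R n j.+1 * (al0 * rnorm (local_sol y j))); last by ring.
by rewrite ler_wpM2l ?dM// !mulr_ge0 ?normr_ge0// ltW// sin_angle_gt0.
Qed.

Lemma lower_adj_err_le y j :
  rnorm (lower_adj_err y j) <= 2 * s * ga0 * (cosw R n j * rnorm (local_sol y j)).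
Proof.
have q0 := rnorm_ge0 (local_sol y j).
have dM (b : int -> 'L(X)) m : op_bound ga0 b ->
    rnorm (diag_op b (ell2_shift m (local_sol y j))) <= ga0 * rnorm (local_sol y j).
  by move=> bM; apply: le_trans (rnorm_diag_op _ ga_ge0 bM) _; rewrite rnorm_ell2_shift.
rewrite /lower_adj_err; case: eqP => [->|/eqP j0].
  rewrite cosw0 mul1r -mulrA -sinw_wrap// mulrDl.
  apply: le_trans (rnormB _ _) _; apply: lerD.
    by apply: rnorm_scale_le (w0_ge0 _ n0) _; rewrite rnorm_ell2_shift dM.
  apply: rnorm_scale_le (wn1_ge0 _ n0) _; rewrite rnorm_ell2_shift.
  exact: rnorm_diag_op.
rewrite rnormZr rnorm_ell2_shift -{1}(prednK (_ : 0 < j)%N) ?lt0n// sinwS//.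
rewrite prednK ?lt0n//.
rewrite [leRHS](_ : _ = 2 * s * cosw R n j * (ga0 * rnorm (local_sol y j))); last by ring.
by rewrite ler_wpM2l ?dM// !mulr_ge0 ?normr_ge0// ltW// sin_angle_gt0.
Qed.

Lemma sum_cos_local_sol (C : 'I_n -> R) y : \sum_j C j ^+ 2 = S ->
  eta * \sum_j C j * rnorm (local_sol y j) <= S * rnorm y.
Proof.
move=> CS; rewrite mulr_sumr; under eq_bigr do rewrite mulrCA.
apply: sum_mul_le CS _; first exact: rnorm_ge0.
apply: le_trans (sum_local_sol y); rewrite mulr_sumr.
by under eq_bigr do rewrite exprMn.
Qed.

Lemma glued_residual_le y :
  eta * rnorm (\sum_j (upper_adj_err y j + lower_adj_err y j))
    <= 2 * (al0 + ga0) * s * (S * rnorm y).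
Proof.
have s0 : 0 <= s by rewrite ltW// sin_angle_gt0.
apply: (@le_trans _ _ (eta * (2 * s * al0 * \sum_(j < n) cosw R n j.+1 * rnorm (local_sol y j)
    + 2 * s * ga0 * \sum_(j < n) cosw R n j * rnorm (local_sol y j)))).
  rewrite ler_wpM2l ?(ltW eta0)//; apply: le_trans (rnorm_sum _ _ _) _.
  rewrite !mulr_sumr -big_split; apply: ler_sum => j _.
  by apply: le_trans (rnormD _ _) (lerD (upper_adj_err_le _ _) (lower_adj_err_le _ _)).
have h1 := sum_cos_local_sol y (sum_coswS_sinw R n0).
have h2 := sum_cos_local_sol y (sum_cosw_sinw R n0).
have a1 : 0 <= 2 * s * al0 by rewrite !mulr_ge0.
have a2 : 0 <= 2 * s * ga0 by rewrite !mulr_ge0.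
have := lerD (ler_wpM2l a1 h1) (ler_wpM2l a2 h2); lra.
Qed.

Lemma rnorm_glued_sum y : eta * rnorm (glued_sum y) <= S * rnorm y.
Proof.
apply: le_trans (sum_cos_local_sol y erefl).
rewrite ler_wpM2l ?(ltW eta0)//; apply: le_trans (rnorm_sum _ _ _) _.
apply: ler_sum => j _; apply: rnorm_scale_le (w_ge0 _ n0 j) _ => //.
by rewrite rnorm_ell2_shift.
Qed.

End dual_windows.

Lemma coercive_of_surj (R : realType) (V : normedModType R[i]) (T : 'L(V)) (d : R) :
  0 < d -> (forall x, d * rnorm x <= rnorm (T x)) -> (forall y, exists x, T x = y) ->
  coercive d T.
Proof.
move=> d0 Td Ts; split=> //; pose g y := sval (cid (Ts y)).
have Tg y : T (g y) = y by exact: svalP (cid (Ts y)).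
have Ti x x' : T x = T x' -> x = x'.
  move=> xx'; apply/eqP; rewrite -subr_eq0; apply/eqP/rnorm0_eq0/eqP.
  rewrite eq_le rnorm_ge0 andbT -(ler_pM2l d0) mulr0; apply: le_trans (Td _) _.
  by rewrite linearB/= xx' subrr rnorm0.
have gP : g \in @bop_pred R V V.
  apply/asboolP; split; first by move=> l u v; apply: Ti; rewrite linearP/= !Tg.
  exists d^-1 => y; rewrite mulrC ler_pdivlMr// mulrC.
  by apply: le_trans (Td _) _; rewrite Tg.
by exists (Bop gP); split=> [x|y] /=; [apply: Ti; rewrite Tg | exact: Tg].
Qed.

Lemma coercive_tridiagonal (R : realType) (X : completeNormedModType R[i]) (n : nat)
    (alpha beta gamma a c : int -> 'L(X)) (T : 'L(ell2 int X)) (al0 ga0 eta : R) :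
  (0 < n)%N -> 0 <= al0 -> 0 <= ga0 ->
  op_bound al0 alpha -> op_bound al0 a -> op_bound ga0 gamma -> op_bound ga0 c ->
  tridiagonal alpha beta gamma T ->
  2 * (al0 + ga0) * sin (angle R n) < eta ->
  (forall k, coercive eta (corner_section alpha beta gamma a c n k)) ->
  coercive (eta - 2 * (al0 + ga0) * sin (angle R n)) T.
Proof.
move=> n0 al_ge0 ga_ge0 alphaM aM gammaM cM triT e'eta hB.
set S := \sum_(j < n) sinw R n j ^+ 2.
have S0 : 0 < S by exact: sum_sinw_gt0.
set e' := _ * sin _ in e'eta *; have e'0 : 0 <= e'.
  by rewrite !mulr_ge0 ?addr_ge0// ltW// sin_angle_gt0.
have eta0 : 0 < eta by apply: le_lt_trans e'eta.
have Bk k z : eta * rnorm z <= rnorm (corner_section alpha beta gamma a c n k z).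
  by have [_] := hB k.
have inv k : invertible (corner_section alpha beta gamma a c n k) by have [] := hB k.
pose Rk k := sval (cid (inv k)).
have RkK k z : corner_section alpha beta gamma a c n k (Rk k z) = z.
  by have [_] := svalP (cid (inv k)); exact.
apply: coercive_of_surj; first by rewrite subr_gt0.
  by move=> x; exact: (windows_lower_bound n0 al_ge0 ga_ge0 alphaM aM gammaM cM triT x (ltW eta0) Bk).
pose G y := S^-1%:C *: glued_sum Rk y.
have rho1 : e' / eta < 1 by rewrite ltr_pdivrMr// mul1r.
have rho0 : 0 <= e' / eta by rewrite divr_ge0// ltW.
apply: (@approx_right_inverse_surj _ _ T G _ (eta^-1) rho0 rho1).
- by rewrite invr_ge0 ltW.
- by move=> u C; apply: ell2_series_cvg.
- move=> y; rewrite /G rnormZr ger0_norm ?invr_ge0 ?(ltW S0)//.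
  rewrite ler_pdivrMl// mulrCA ler_pdivlMl//.
  exact: (rnorm_glued_sum n0 eta0 RkK Bk).
- move=> y; rewrite /G bopZ.
  rewrite (glued_residual n0 al_ge0 ga_ge0 alphaM aM gammaM cM triT eta0 RkK Bk).
  rewrite scalerDr scalerA -rmorphM/= mulVf ?gt_eqF// scale1r addrAC subrr add0r.
  rewrite rnormZr ger0_norm ?invr_ge0 ?(ltW S0)// ler_pdivrMl//.
  rewrite [leRHS](_ : _ = eta^-1 * (e' * (S * rnorm y))); last by ring.
  rewrite ler_pdivlMl//.
  exact: (glued_residual_le n0 al_ge0 ga_ge0 alphaM aM gammaM cM eta0 RkK Bk).
Qed.

(** * Averages of the resolvent *)

Section roots_of_unity.
Variable C : numClosedFieldType.

Lemma exists_primitive_root (N : nat) : (0 < N)%N -> exists z : C, N.-primitive_root z.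
Proof.
pose p : {poly C} := 'X^N - 1; have [r Dp] := closed_field_poly_normal p.
move=> N0; rewrite (monicP _) ?monicXnsubC // scale1r in Dp.
have rn1 : all N.-unity_root r by apply/allP=> z; rewrite -root_prod_XsubC -Dp.
have sz_r : (N < (size r).+1)%N.
  by rewrite -(size_prod_XsubC r id) -Dp size_XnsubC.
have [|z] := hasP (cyclic.has_prim_root N0 rn1 _ sz_r); last by exists z.
by rewrite -separable.separable_prod_XsubC -Dp cyclotomic.separable_Xn_sub_1 // pnatr_eq0 -lt0n.
Qed.

Lemma sum_primitive_root (N : nat) (z : C) (l : nat) : N.-primitive_root z ->
  \sum_(j < N) z ^+ (j * l) = N%:R *+ (N %| l)%N.
Proof.
move=> pz; under eq_bigr do rewrite mulnC exprM.
case: (boolP (N %| l)%N) => [|Nl].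
  rewrite (prim_order_dvd pz) => /eqP ->.
  by under eq_bigr do rewrite expr1n; rewrite sumr_const card_ord mulr1n.
rewrite mulr0n.
have zl : z ^+ l - 1 != 0 by rewrite subr_eq0 -(prim_order_dvd pz).
apply: (mulfI zl); rewrite mulr0 -subrX1 -exprM mulnC exprM.
by rewrite (prim_expr_order pz) expr1n subrr.
Qed.

Lemma norm_prim_root (N : nat) (z : C) : N.-primitive_root z -> `|z| = 1.
Proof.
move=> pz; apply/eqP; rewrite -(pexpr_eq1 (prim_order_gt0 pz) (normr_ge0 z)).
by rewrite -normrX (prim_expr_order pz) normr1.
Qed.

End roots_of_unity.

(** * Kernel averages over a circle *)

Section resolvent_average.
Variables (R : realType) (Y : normedModType R[i]) (B Rb : 'L(Y)) (eta rho : R).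
Hypotheses (eta0 : 0 < eta) (rho0 : 0 < rho) (rho_eta : rho < eta).
Hypotheses (BK : cancel B Rb) (KB : cancel Rb B).
Hypothesis B_ge : forall y, eta * rnorm y <= rnorm (B y).
Hypothesis circle : forall z : R[i], `|z| = rho%:C -> coercive eta (B - z *: bop_id).
Implicit Types (y : Y) (z : R[i]).

Lemma iter_inv_le k y : eta ^+ k * rnorm (iter k Rb y) <= rnorm y.
Proof.
elim: k => [|k IH] /=; first by rewrite mul1r.
rewrite exprSr -mulrA; apply: le_trans IH.
by rewrite ler_wpM2l ?exprn_ge0 ?(ltW eta0)//; apply: le_trans (B_ge _) _; rewrite KB.
Qed.

Lemma iter_invD k y y' : iter k Rb (y + y') = iter k Rb y + iter k Rb y'.
Proof. by elim: k => //= k ->; rewrite linearD. Qed.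

Lemma iter_invZ k z y : iter k Rb (z *: y) = z *: iter k Rb y.
Proof. by elim: k => //= k ->; rewrite bopZ. Qed.

(** The finite Neumann expansion with its exact remainder, so that no convergence is involved. *)
Lemma resolvent_expansion z y f L : (B - z *: bop_id) f = y ->
  f = \sum_(l < L) z ^+ l *: iter l.+1 Rb y + z ^+ L *: iter L Rb f.
Proof.
rewrite -[(B - _) f]/(B f - z *: f) => fy.
have fE : f = Rb y + z *: Rb f by rewrite -bopZ -linearD/= -fy subrK BK.
elim: L => [|L IH]; first by rewrite big_ord0 add0r expr0 scale1r.
rewrite {1}IH big_ord_recr /= -addrA; congr (_ + _).
by rewrite {1}fE iter_invD iter_invZ scalerDr scalerA -exprSr -!iterSr.
Qed.

(* Averages the resolvent over the circle |z| = rho against the nonnegative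
   kernel 1 + Re(zeta * conj(z / rho)^m), discretized at the N-th roots of unity. *)
Lemma resolvent_average_approx (m d : nat) (zeta : R[i]) y :
  (0 < m)%N -> `|zeta| <= 1 ->
  eta * rnorm (Rb y + (zeta * (rho ^+ m / 2)%:C) *: iter m.+1 Rb y)
    <= (1 + (rho / eta) ^+ (m + d).+1) * rnorm y.
Proof.
(* With N = L + m, om^(j L) is the conjugate of om^(j m), and the discrete averages of z^l are exact
   for l < L: N divides l only for l = 0, L + l only for l = m, and m + l never. L > m makes the
   term l = m occur; the powers from L on form the remainder, subtracted in [W]. *)
move=> m0 zeta1; pose L := (m + d).+1; pose N := (L + m)%N.
have N0 : (0 < N)%N by [].
have [om pom] := exists_primitive_root R[i] N0.
pose z (j : nat) : R[i] := rho%:C * om ^+ j.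
have zn (j : 'I_N) : `|z j| = rho%:C.
  by rewrite normrM normrX (norm_prim_root pom) expr1n mulr1 ger0_norm ?ler0c ?ltW.
pose f (j : 'I_N) : Y := sval (cid (proj1 (circle (zn j)))) y.
have fy (j : 'I_N) : (B - z j *: bop_id) (f j) = y.
  by have [_] := svalP (cid (proj1 (circle (zn j)))); exact.
have fn (j : 'I_N) : eta * rnorm (f j) <= rnorm y.
  by have [_ /(_ (f j))] := circle (zn j); rewrite fy.
pose u (j : nat) : R[i] := zeta * om ^+ (j * L).
pose c (j : nat) : R[i] := 1 + 'Re (u j).
have omL (j : nat) : om ^+ (j * L) * om ^+ (j * m) = 1.
  by rewrite -exprD -mulnDr mulnC exprM (prim_expr_order pom) expr1n.
have cE (j : nat) : c j = 1 + (zeta * om ^+ (j * L) + zeta^*%R * om ^+ (j * m)) / 2.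
  rewrite /c ReE /u rmorphM/=; congr (1 + (_ + _ * _) / _).
  have n1 : `|om ^+ (j * L)| = 1 by rewrite normrX (norm_prim_root pom) expr1n.
  have := normCK (om ^+ (j * L)); rewrite n1 expr1n => h.
  by rewrite -[LHS]mulr1 -(omL j) mulrA (mulrC _^*%R) -h mul1r.
have c0 (j : nat) : 0 <= c j.
  rewrite /c -lerBlDl sub0r lerNl -raddfN /=.
  apply: le_trans (leif_Re_Creal _).1 _; rewrite normrN /u normrM normrX.
  by rewrite (norm_prim_root pom) expr1n mulr1.
have sum_c (l : nat) : (l < L)%N -> \sum_(j < N) c j * z j ^+ l =
    N%:R * ((l == 0%N)%:R + (zeta * (rho ^+ m / 2)%:C) *+ (l == m)).
  move=> lL; have -> : \sum_(j < N) c j * z j ^+ l = \sum_(j < N)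
      (rho%:C ^+ l * om ^+ (j * l) + rho%:C ^+ l * zeta / 2 * om ^+ (j * (L + l)) +
       rho%:C ^+ l * zeta^*%R / 2 * om ^+ (j * (m + l))).
    apply: eq_bigr => j _; rewrite cE /z exprMn -exprM !mulnDr !exprD.
    by field.
  rewrite !big_split /= -!mulr_sumr !(sum_primitive_root _ pom).
  have -> : (N %| m + l)%N = false by apply/negP => /dvdn_leq; lia.
  have -> : (N %| l)%N = (l == 0%N).
    by apply/idP/eqP => [|->]; [rewrite /dvdn modn_small; lia | rewrite dvdn0].
  have -> : (N %| L + l)%N = (l == m).
    apply/idP/eqP => [/dvdnP[q]|->]; last by rewrite dvdnn.
    by case: q => [|[|q]]; nia.
  rewrite rmorphM fmorphV rmorphXn rmorph_nat /=.
  case: eqP => [->|_]; case: eqP => [lm|_]; rewrite /= ?mulr1n ?mulr0n.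
  - by move: m0; rewrite -lm.
  - by field.
  - by rewrite lm; field.
  - by field.
have N1 : N%:R != 0 :> R[i] by rewrite pnatr_eq0.
pose W := N%:R^-1 *: \sum_(j < N) c j *: (f j - z j ^+ L *: iter L Rb (f j)).
have -> : Rb y + (zeta * (rho ^+ m / 2)%:C) *: iter m.+1 Rb y = W.
  have -> : W = \sum_(l < L) (N%:R^-1 * \sum_(j < N) c j * z j ^+ l) *: iter l.+1 Rb y.
    under [RHS]eq_bigr do rewrite -scalerA scaler_suml.
    rewrite -scaler_sumr exchange_big /=; congr (_ *: _); apply: eq_bigr => j _.
    rewrite {1}(resolvent_expansion L (fy j)) addrK scaler_sumr.
    by apply: eq_bigr => l _; rewrite scalerA.
  have -> : \sum_(l < L) (N%:R^-1 * \sum_(j < N) c j * z j ^+ l) *: iter l.+1 Rb y =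
     \sum_(l < L) ((l == 0%N :> nat)%:R *: iter l.+1 Rb y +
       ((zeta * (rho ^+ m / 2)%:C) *+ (l == m :> nat)) *: iter l.+1 Rb y).
    by apply: eq_bigr => l _; rewrite sum_c// mulKf// scalerDl.
  rewrite big_split /=; congr (_ + _).
    rewrite (bigD1 ord0)//= scale1r big1 ?addr0// => l l0.
    by rewrite (_ : (l == 0%N :> nat) = false) ?scale0r//; apply: negbTE.
  have mL : (m < L)%N by rewrite ltnS leq_addr.
  rewrite (bigD1 (Ordinal mL))//= eqxx mulr1n big1 ?addr0// => l lm.
  by rewrite (_ : (l == m :> nat) = false) ?mulr0n ?scale0r//; apply: negbTE.
(* The weights c_j are nonnegative and have mean 1 by the case l = 0, so [W] is a convex
   combination. *)
have sum_cn : \sum_(j < N) rnorm (c j : R[i]^o) = N%:R.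
  apply: (@complexI R); rewrite rmorph_sum rmorph_nat /=.
  under eq_bigr do rewrite -rnormE ger0_norm//.
  have := sum_c 0%N isT; rewrite eqxx (_ : (0%N == m) = false) ?mulr0n; last by lia.
  by rewrite addr0 mulr1 => <-; apply: eq_bigr => j _; rewrite expr0 mulr1.
set K := (1 + _) * _.
have termle (j : 'I_N) : eta * rnorm (f j - z j ^+ L *: iter L Rb (f j)) <= K.
  apply: (@le_trans _ _ (eta * (rnorm (f j) + rho ^+ L * rnorm (iter L Rb (f j))))).
    rewrite ler_wpM2l ?(ltW eta0)//; apply: le_trans (rnormB _ _) _.
    rewrite lerD2l rnormZ -lecR rmorphM/= -rnormE normrX zn -rmorphXn/= -rmorphM/=.
    by [].
  rewrite mulrDr /K mulrDl mul1r; apply: lerD; first exact: fn.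
  rewrite expr_div_n mulrAC ler_pdivlMr ?exprn_gt0//.
  apply: le_trans (_ : _ <= rho ^+ L * (eta * rnorm (f j))) _; last first.
    by rewrite ler_wpM2l ?exprn_ge0 ?(ltW rho0)// fn.
  have := iter_inv_le L (f j) => /(ler_wpM2l (mulr_ge0 (exprn_ge0 L (ltW rho0)) (ltW eta0))).
  by lra.
rewrite /W rnormZ mulrCA.
have -> : rnorm (N%:R^-1 : R[i]^o) = N%:R^-1.
  have -> : N%:R^-1 = (N%:R^-1 : R)%:C by rewrite fmorphV rmorph_nat.
  by rewrite rnorm_real ger0_norm ?invr_ge0.
rewrite ler_pdivrMl ?ltr0n//.
apply: (@le_trans _ _ (\sum_(j < N) rnorm (c j : R[i]^o) * K)).
  apply: (@le_trans _ _ (eta * \sum_(j < N) rnorm (c j *: (f j - z j ^+ L *: iter L Rb (f j))))).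
    by rewrite ler_wpM2l ?(ltW eta0)//; exact: rnorm_sum.
  rewrite mulr_sumr; apply: ler_sum => j _.
  by rewrite rnormZ mulrCA ler_wpM2l ?rnorm_ge0.
by rewrite -mulr_suml sum_cn.
Qed.

Lemma resolvent_average (m : nat) (zeta : R[i]) y : (0 < m)%N -> `|zeta| <= 1 ->
  eta * rnorm (Rb y + (zeta * (rho ^+ m / 2)%:C) *: iter m.+1 Rb y) <= rnorm y.
Proof.
move=> m0 zeta1; apply/ler_addgt0Pl => e e0.
have r0 : 0 <= rho / eta by rewrite divr_ge0 ?ltW.
have r1 : rho / eta < 1 by rewrite ltr_pdivrMr ?mul1r.
have [M hM] := geometric_small r0 r1 (rnorm y) e0.
apply: le_trans (resolvent_average_approx M y m0 zeta1) _.
rewrite mulrDl mul1r addrC lerD2r mulrC; apply: le_trans hM.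
rewrite ler_wpM2l ?rnorm_ge0// ler_wiXn2l ?(ltW r1)//; exact/leqW/leq_addl.
Qed.

End resolvent_average.

(** * Uniform improvement of resolvent bounds *)

Section composition.
Variables (R : realType) (W Y Z : normedModType R[i]) (f : bop Y Z) (g : bop W Y).

Lemma bop_comp_subproof : f \o g \in @bop_pred R W Z.
Proof.
apply/asboolP; split; first by move=> l u v /=; rewrite !linearP.
exists (bop_norm f * bop_norm g) => y /=; apply: le_trans (bop_norm_le _ _) _.
by rewrite -mulrA ler_wpM2l ?bop_norm_ge0 ?bop_norm_le.
Qed.

Definition bop_comp : bop W Z := Bop bop_comp_subproof.

End composition.

Lemma align_phase (R : realType) (u v : R[i]^o) : exists2 zeta : R[i], `|zeta| <= 1 &
  rnorm (u + zeta *: v) = rnorm u + rnorm v.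
Proof.
have [->|u0] := eqVneq u 0.
  by exists 1; rewrite ?normr1// scale1r add0r rnorm0 add0r.
have [->|v0] := eqVneq v 0.
  by exists 1; rewrite ?normr1// scaler0 addr0 rnorm0 addr0.
have nu : `|u| != 0 by rewrite normr_eq0.
have nv : `|v| != 0 by rewrite normr_eq0.
exists (u / `|u| * (`|v| / v)).
  by rewrite !normrM !normfV !normr_id mulfV// mul1r mulfV.
apply: (@complexI R); rewrite rmorphD/= -!rnormE.
have -> : u + (u / `|u| * (`|v| / v)) *: v = u * (1 + `|v| / `|u|).
  rewrite -[_ *: v]/(_ * v); field.
  by rewrite v0 nu.
rewrite normrM (@ger0_norm _ (1 + _)); last by rewrite addr_ge0// divr_ge0.
by rewrite mulrDr mulr1 mulrCA mulfV// mulr1.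
Qed.

Section uniform_disc.
Variables (R : realType) (Y : normedModType R[i]) (K : Type) (B : K -> 'L(Y)).
Variables (eta r rho Mb : R).
Hypotheses (eta0 : 0 < eta) (r0 : 0 < r) (Mb0 : 0 <= Mb).
Hypotheses (rho0 : 0 < rho) (rho_eta : rho < eta) (rho_r : rho < r).
Hypothesis BM : forall k y, rnorm (B k y) <= Mb * rnorm y.
Hypothesis disc : forall k (z : R[i]), `|z| < r%:C -> coercive eta (B k - z *: bop_id).

Lemma disc0 k : coercive eta (B k).
Proof.
have := disc k (_ : `|0| < _); rewrite normr0 ltcR => /(_ r0).
by rewrite scale0r subr0.
Qed.

Lemma disc_average k : exists2 Rk : 'L(Y), is_inverse (B k) Rk &
  forall (m : nat) (zeta : R[i]) y, (0 < m)%N -> `|zeta| <= 1 ->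
    eta * rnorm (Rk y + (zeta * (rho ^+ m / 2)%:C) *: iter m.+1 Rk y) <= rnorm y.
Proof.
have [[Rk [BK KB]] cB] := disc0 k; exists Rk => // m zeta y m0 zeta1.
apply: (resolvent_average eta0 rho0 rho_eta BK KB cB) => // z zr.
by apply: disc; rewrite zr ltcR.
Qed.

Lemma disc_improve (delta : R) : 0 < delta ->
  (forall k x, eta * rnorm x <= (1 - delta) * rnorm (B k x)) ->
  exists2 eta2, eta < eta2 & forall k, coercive eta2 (B k).
Proof.
move=> d0 h; pose d := Num.min delta (1 / 2).
have dp : 0 < d by rewrite lt_min d0; lra.
have d1 : d <= 1 / 2 by rewrite ge_min lexx orbT.
have dd : d <= delta by rewrite ge_min lexx.
exists (eta / (1 - d)); first by rewrite ltr_pdivlMr; [have := mulr_gt0 eta0 dp; lra|lra].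
move=> k; split=> [|x]; first by case: (disc0 k).
rewrite mulrAC ler_pdivrMr; last by lra.
by have := rnorm_ge0 (B k x); have := h k x; nra.
Qed.

(** Bounds from below the second vector to which complex convexity is applied; the summand 1 keeps
    the constant positive when Mb = 0. *)
Lemma inverse_sqr_ge k (Rk : 'L(Y)) y : is_inverse (B k) Rk ->
  rnorm y <= (Mb ^+ 2 + 1) * rnorm (Rk (Rk y)).
Proof.
move=> [BK KB]; rewrite -{1}(KB y) -{1}(KB (Rk y)).
have h1 := BM k (B k (Rk (Rk y))).
have h2 := ler_wpM2l Mb0 (BM k (Rk (Rk y))); have := rnorm_ge0 (Rk (Rk y)).
rewrite mulrA -expr2 in h2; have := le_trans h1 h2; lra.
Qed.

Lemma convex_disc_improve : complex_uniformly_convex Y ->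
  exists2 eta2, eta < eta2 & forall k, coercive eta2 (B k).
Proof.
move=> cY; have Mb1 : 0 < Mb ^+ 2 + 1 by rewrite ltr_wpDl ?sqr_ge0.
have [|delta d0 hd] := cY (eta * (rho / 2) / (Mb ^+ 2 + 1)).
  by rewrite divr_gt0// mulr_gt0// divr_gt0.
apply: (disc_improve d0) => k x; have [Rk RkP avg] := disc_average k.
have [x0|xn0] := eqVneq x 0; first by rewrite x0 linear0 !rnorm0 !mulr0.
set y := B k x; have Ry : Rk y = x := RkP.1 x.
have y0 : 0 < rnorm y.
  rewrite lt_neqAle rnorm_ge0 andbT eq_sym; apply: contra_neq xn0 => /rnorm0_eq0 y0.
  by rewrite -Ry y0 linear0.
pose t := (rnorm y)^-1; have t0 : 0 < t by rewrite invr_gt0.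
(* Convexity is applied to eta t R y and (eta rho / 2) t R^2 y; its condition over the unit disc is
   the average with m = 1. *)
have h : rnorm ((eta * t)%:C *: x) <= 1 - delta.
  apply: (hd _ ((eta * (rho / 2) * t)%:C *: Rk (Rk y))).
    have ap : 0 < eta * (rho / 2) by rewrite mulr_gt0// divr_gt0.
    rewrite rnormZr ger0_norm; last exact: ltW (mulr_gt0 ap t0).
    rewrite ler_pdivrMr//; have := inverse_sqr_ge y RkP.
    rewrite -(ler_pM2l t0) {1}/t mulVf ?gt_eqF// => h.
    by have := ler_wpM2l (ltW ap) h; lra.
  move=> zeta zeta1; have := avg 1%N zeta y isT zeta1; rewrite Ry /= Ry => h.
  rewrite (_ : _ + _ = (eta * t)%:C *: (x + (zeta * (rho ^+ 1 / 2)%:C) *: Rk x)).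
    rewrite rnormZr gtr0_norm ?mulr_gt0// mulrAC ler_pdivrMr ?mul1r//.
  by rewrite scalerDr !scalerA expr1 !rmorphM/=; congr (_ + _ *: _); ring.
move: h; rewrite rnormZr gtr0_norm ?mulr_gt0// mulrAC ler_pdivrMr//.
Qed.

(** With [phi] norming x = R (B x), the functionals phi o R and phi o R^2 stand in for the adjoint
    resolvent and its square at [phi]. The second is bounded below because it takes the value phi x
    at B^2 x. *)
Lemma dual_convex_disc_improve : complex_uniformly_convex (dual Y) ->
  exists2 eta2, eta < eta2 & forall k, coercive eta2 (B k).
Proof.
move=> cY; have Mb1 : 0 < Mb ^+ 2 + 1 by rewrite ltr_wpDl ?sqr_ge0.
have ap : 0 < eta * (rho / 2) by rewrite mulr_gt0// divr_gt0.
have [|delta d0 hd] := cY (eta * (rho / 2) / (Mb ^+ 2 + 1)); first by rewrite divr_gt0.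
apply: (disc_improve d0) => k x; have [Rk RkP avg] := disc_average k.
have [x0|xn0] := eqVneq x 0; first by rewrite x0 linear0 !rnorm0 !mulr0.
have x0 : 0 < rnorm x.
  by rewrite lt_neqAle rnorm_ge0 andbT eq_sym; apply: contra_neq xn0 => /rnorm0_eq0.
have [phi [phi1 phix]] := norming_functional x.
pose psi1 : dual Y := eta%:C *: bop_comp phi Rk.
pose psi2 : dual Y := (eta * (rho / 2))%:C *: bop_comp phi (bop_comp Rk Rk).
have h : rnorm psi1 <= 1 - delta.
  apply: (hd _ psi2).
    rewrite rnormZr gtr0_norm// ler_pM2l//.
    set chi := bop_comp _ _; have chi0 : 0 <= rnorm chi := rnorm_ge0 chi.
    have h1 : rnorm x <= rnorm chi * rnorm (B k (B k x)).
      rewrite -phix -[in leLHS](RkP.1 x) -[in leLHS](RkP.1 (B k x)).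
      exact: bop_norm_le chi _.
    have h2 := ler_wpM2l Mb0 (BM k x); have h3 := BM k (B k x).
    have h4 := ler_wpM2l chi0 (le_trans h3 h2).
    rewrite -[leLHS]mul1r ler_pdivrMr// -(ler_pM2r x0) mul1r.
    have := mulr_ge0 chi0 (ltW x0); have := le_trans h1 h4; lra.
  move=> zeta zeta1; apply: bop_norm_ub => y y1.
  rewrite -[X in rnorm X]/(eta%:C *: phi (Rk y) +
    zeta *: ((eta * (rho / 2))%:C *: phi (Rk (Rk y)))).
  rewrite scalerA -!(bopZ phi) -linearD/=; apply: le_trans (phi1 _) _.
  apply: le_trans y1; apply: le_trans (avg 1%N zeta y isT zeta1).
  rewrite -[in leRHS](ger0_norm (ltW eta0)) -rnormZr scalerDr scalerA expr1.
  by have -> : zeta * (eta * (rho / 2))%:C = eta%:C * (zeta * (rho / 2)%:C)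
    by rewrite rmorphM/= mulrCA.
have := bop_norm_le psi1 (B k x).
rewrite -[psi1 _]/(eta%:C *: phi (Rk (B k x))) RkP.1 rnormZr gtr0_norm// phix.
by move=> h2; exact: (le_trans h2 (ler_wpM2r (rnorm_ge0 _) h)).
Qed.

(* A bound by finitely many higher powers of the resolvent suffices: where the
   resolvent nearly attains its norm, the averages force these powers to be small. *)
Lemma finite_recursion_disc_improve (N : nat) (C : R) : 0 <= C ->
  (forall k Rk, is_inverse (B k) Rk -> forall y, exists2 c : 'I_N -> R[i],
     forall m, rnorm (c m : R[i]^o) <= C &
     Rk y = \sum_(m < N) c m *: iter m.+2 Rk y) ->
  exists2 eta2, eta < eta2 & forall k, coercive eta2 (B k).
Proof.
move=> C0 hrec; pose Q := \sum_(m < N) C * (2 / rho ^+ m.+1).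
have Q0 : 0 <= Q.
  by apply: sumr_ge0 => m _; rewrite mulr_ge0// divr_ge0// exprn_ge0// ltW.
have Q1 : 0 < 1 + Q by rewrite ltr_pwDl.
have d0 : 0 < (1 + Q)^-1 by rewrite invr_gt0.
apply: (disc_improve d0) => k x; have [Rk RkP avg] := disc_average k.
have [phi [phi1 phix]] := norming_functional x.
set y := B k x; have Ry : Rk y = x := RkP.1 x.
have [c cC cE] := hrec k Rk RkP y.
have term (m : 'I_N) : rnorm (phi (iter m.+2 Rk y)) <=
    2 / rho ^+ m.+1 * (rnorm y / eta - rnorm x).
  (* This phase makes the two terms of the average add up in modulus under [phi]. *)
  have [zeta zeta1 al] := align_phase (phi (Rk y))
    ((rho ^+ m.+1 / 2)%:C *: phi (iter m.+2 Rk y)).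
  have := avg m.+1 zeta y isT zeta1; rewrite mulrC -ler_pdivlMr// => h.
  have := le_trans (phi1 _) h; rewrite linearD/= bopZ -scalerA al.
  rewrite rnormZr ger0_norm ?divr_ge0 ?exprn_ge0 ?(ltW rho0)// Ry phix => h'.
  have rp : 0 < rho ^+ m.+1 by rewrite exprn_gt0.
  rewrite -ler_pdivrMl ?divr_gt0// invf_div; lra.
(* Solving for [rnorm x], which occurs on both sides, gives the factor Q / (1 + Q) < 1. *)
have : rnorm x <= Q * (rnorm y / eta - rnorm x).
  rewrite -[leLHS]phix -{1}Ry cE linear_sum/=; apply: le_trans (rnorm_sum _ _ _) _.
  rewrite /Q mulr_suml; apply: ler_sum => m _.
  rewrite linearZ/= rnormZ -mulrA; apply: ler_pM => //; do ?exact: rnorm_ge0.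
  exact: term.
move=> h; have h2 : rnorm x * (1 + Q) * eta <= Q * rnorm y.
  by rewrite -ler_pdivlMr//; lra.
have -> : 1 - (1 + Q)^-1 = Q / (1 + Q) by field; rewrite gt_eqF.
by rewrite mulrAC ler_pdivlMr//; lra.
Qed.

End uniform_disc.

(** * Finite-dimensional spaces *)

Section biorthogonal.
Variables (R : realType) (Y : normedModType R[i]).

Definition biorthogonal (N : nat) (e : 'I_N -> Y) (phi : 'I_N -> dual Y) :=
  forall i j, phi i (e j) = (i == j)%:R.

Definition expansion (N : nat) (e : 'I_N -> Y) (phi : 'I_N -> dual Y) (y : Y) : Y :=
  \sum_i phi i y *: e i.

Lemma biorthogonal_coord N (e : 'I_N -> Y) phi j y : biorthogonal e phi ->
  phi j (expansion e phi y) = phi j y.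
Proof.
move=> bi; rewrite linear_sum/= (bigD1 j)//= big1 ?addr0 => [|i ij]; rewrite bopZ bi.
  by rewrite eqxx [LHS]mulr1.
by rewrite eq_sym (negbTE ij) [LHS]mulr0.
Qed.

Lemma expansionP N (e : 'I_N -> Y) phi (l : R[i]) u v :
  expansion e phi (l *: u + v) = l *: expansion e phi u + expansion e phi v.
Proof.
rewrite /expansion scaler_sumr -big_split; apply: eq_bigr => i _ /=.
by rewrite linearP scalerDl scalerA.
Qed.

Lemma expansion_bounded N (e : 'I_N -> Y) phi :
  idfun \- expansion e phi \in @bop_pred R Y Y.
Proof.
apply/asboolP; split.
  move=> l u v /=; rewrite expansionP scalerBr opprD addrACA.
  by [].
exists (1 + \sum_i bop_norm (phi i) * rnorm (e i)) => y /=.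
apply: le_trans (rnormB _ _) _; rewrite mulrDl mul1r lerD2l.
apply: le_trans (rnorm_sum _ _ _) _; rewrite mulr_suml; apply: ler_sum => i _.
by rewrite rnormZ mulrAC ler_wpM2r ?rnorm_ge0// bop_norm_le.
Qed.

Lemma separating_functional (w : Y) : w != 0 -> exists psi : dual Y, psi w = 1.
Proof.
move=> w0; have [phi [_ phiw]] := norming_functional w.
have pw0 : phi w != 0.
  apply: contra_neq w0 => pw; apply/rnorm0_eq0; rewrite -phiw pw.
  exact: rnorm0.
exists ((phi w)^-1 *: phi); rewrite -[LHS]/((phi w)^-1 * phi w).
by rewrite mulVf.
Qed.

(** Induction on the family: the new vector is w = v - P v, and the new functional is one with value
    1 at w composed with id - P, which kills the old vectors. The coordinates are bounded
    functionals, so a bounded family of operators has uniformly bounded matrices. *)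
Lemma biorthogonal_span (s : seq Y) : exists N (e : 'I_N -> Y) (phi : 'I_N -> dual Y),
  biorthogonal e phi /\ {in s, forall v, expansion e phi v = v}.
Proof.
elim: s => [|v s [N [e [phi [bi sP]]]]].
  by exists 0%N, (fun=> 0), (fun=> 0); split=> // -[].
pose P := expansion e phi.
have Pe j : P (e j) = e j.
  rewrite /P /expansion (bigD1 j)//= bi eqxx scale1r big1 ?addr0// => i ij.
  by rewrite bi (negbTE ij) scale0r.
pose w := v - P v; have [w0|wn0] := eqVneq w 0.
  exists N, e, phi; split=> // u; rewrite inE => /predU1P[->|]; last exact: sP.
  by apply/eqP; rewrite eq_sym -subr_eq0 -/P -/w w0.
have [psi0 psi0w] := separating_functional wn0.
have [psi psiE] : exists psi : dual Y, forall y, psi y = psi0 (y - P y).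
  by exists (bop_comp psi0 (Bop (expansion_bounded e phi))).
have PB y z : P (y - z) = P y - P z.
  by rewrite -[in LHS]scaleN1r addrC /P expansionP scaleN1r addrC.
have PP y : P (P y) = P y by apply: eq_bigr => i _; rewrite biorthogonal_coord.
have phiw i : phi i w = 0 by rewrite linearB/= biorthogonal_coord// subrr.
have psie j : psi (e j) = 0 by rewrite psiE Pe subrr linear0.
have psiw : psi w = 1 by rewrite psiE {2}/w PB PP subrr subr0.
pose e' (i : 'I_N.+1) := oapp e w (unlift ord0 i).
pose phi' (i : 'I_N.+1) := oapp phi psi (unlift ord0 i).
have exE y : expansion e' phi' y = psi y *: w + P y.
  rewrite /expansion big_ord_recl /e' /phi' unlift_none /=; congr (_ + _).
  by apply: eq_bigr => i _; rewrite liftK.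
exists N.+1, e', phi'; split.
  move=> i j; rewrite /e' /phi'.
  case: unliftP => [i' ->|->]; case: unliftP => [j' ->|->] /=.
  - by rewrite bi (inj_eq lift_inj).
  - by rewrite phiw.
  - by rewrite psie.
  - by rewrite psiw.
move=> u; rewrite inE exE => /predU1P[->|us].
  have -> : psi v = 1 by rewrite psiE.
  by rewrite scale1r subrK.
by rewrite psiE /P sP// subrr linear0 scale0r add0r.
Qed.

Lemma finite_dimensional_biorthogonal : finite_dimensional Y ->
  exists N (e : 'I_N -> Y) (phi : 'I_N -> dual Y),
    biorthogonal e phi /\ forall y, expansion e phi y = y.
Proof.
move=> [m [f fP]]; have [N [e [phi [bi sP]]]] := biorthogonal_span [seq f i | i : 'I_m].
exists N, e, phi; split=> // y; have [c ->] := fP y.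
have h0 : expansion e phi 0 = 0.
  by rewrite /expansion big1// => i _; rewrite linear0 scale0r.
elim/big_rec : _ => // i z _ ih.
by rewrite expansionP ih sP//; apply/mapP; exists i => //; rewrite mem_enum.
Qed.

End biorthogonal.

(** * Polynomials with uniformly bounded coefficients *)

Section bounded_coefs.
Variables (R : realType) (K : Type).
Implicit Types p q : K -> {poly R[i]}.

Definition coef_bounded p :=
  forall i, exists C : R, forall k, rnorm ((p k)`_i : R[i]^o) <= C.

Lemma rnormM (x y : R[i]) : rnorm (x * y : R[i]^o) = rnorm (x : R[i]^o) * rnorm (y : R[i]^o).
Proof. exact: (@rnormZ R R[i]^o). Qed.

Lemma coef_bounded_cst (q : {poly R[i]}) : coef_bounded (fun=> q).
Proof. by move=> i; exists (rnorm (q`_i : R[i]^o)). Qed.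

Lemma coef_boundedD p q : coef_bounded p -> coef_bounded q ->
  coef_bounded (fun k => p k + q k).
Proof.
move=> bp bq i; have [C hC] := bp i; have [D hD] := bq i; exists (C + D) => k.
by rewrite coefD; apply: le_trans (rnormD _ _) (lerD (hC k) (hD k)).
Qed.

Lemma coef_boundedM p q : coef_bounded p -> coef_bounded q ->
  coef_bounded (fun k => p k * q k).
Proof.
move=> /choice[C hC] /choice[D hD] i; exists (\sum_(j < i.+1) C j * D (i - j)%N) => k.
rewrite coefM; apply: le_trans (@rnorm_sum _ R[i]^o _ _ _ _) _.
apply: ler_sum => j _; rewrite rnormM.
by apply: ler_pM; rewrite ?rnorm_ge0 ?hC ?hD.
Qed.

Lemma coef_bounded_sum (J : Type) (s : seq J) (P : pred J) (p : J -> K -> {poly R[i]}) :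
  (forall j, coef_bounded (p j)) -> coef_bounded (fun k => \sum_(j <- s | P j) p j k).
Proof.
move=> bp; elim: s => [|j s IH].
  by under eq_fun do rewrite big_nil; exact: coef_bounded_cst.
under eq_fun do rewrite big_cons; case: (P j) => //.
exact: coef_boundedD.
Qed.

Lemma coef_bounded_prod (J : Type) (s : seq J) (P : pred J) (p : J -> K -> {poly R[i]}) :
  (forall j, coef_bounded (p j)) -> coef_bounded (fun k => \prod_(j <- s | P j) p j k).
Proof.
move=> bp; elim: s => [|j s IH].
  by under eq_fun do rewrite big_nil; exact: coef_bounded_cst.
under eq_fun do rewrite big_cons; case: (P j) => //.
exact: coef_boundedM.
Qed.

Lemma char_poly_coef_bounded (N : nat) (M : K -> 'M[R[i]]_N) (C : R) :
  (forall k i j, rnorm (M k i j : R[i]^o) <= C) -> coef_bounded (fun k => char_poly (M k)).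
Proof.
move=> MC; apply: coef_bounded_sum => s; apply: coef_boundedM.
  exact: coef_bounded_cst.
apply: coef_bounded_prod => i l; exists (rnorm (('X *+ (i == s i) : {poly R[i]})`_l : R[i]^o) + (C + C)) => k.
rewrite !mxE coefB; apply: le_trans (@rnormB _ R[i]^o _ _) _.
have C0 : 0 <= C by apply: le_trans (MC k i i); exact: rnorm_ge0.
rewrite lerD2l coefC; case: eqP => _; last by rewrite rnorm0 addr_ge0.
by apply: le_trans (MC _ _ _) _; rewrite lerDl.
Qed.

End bounded_coefs.

Section annihilator.
Variables (R : realType) (Y : normedModType R[i]) (K : Type) (B : K -> 'L(Y)) (Mb : R).
Hypothesis BM : forall k y, rnorm (B k y) <= Mb * rnorm y.

(** The polynomials are characteristic polynomials of the matrices in a biorthogonal basis,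
    annihilating by Cayley-Hamilton. That [N] and [C] precede [k] is what makes the later estimates
    uniform. *)
Lemma finite_dimensional_annihilator : finite_dimensional Y ->
  exists (N : nat) (C : R), 0 <= C /\ forall k, exists p : {poly R[i]},
  [/\ p \is monic, size p = N.+1,
      forall i, rnorm (p`_i : R[i]^o) <= C,
      forall y, \sum_(i < N.+1) p`_i *: iter i (B k) y = 0
    & forall z, root p z -> exists2 y, y != 0 & B k y = z *: y].
Proof.
move=> /finite_dimensional_biorthogonal[N [e [phi [bi exP]]]].
(* The zero space is treated apart, as Cayley-Hamilton is applied to matrices of positive size. *)
case: N e phi bi exP => [|N] e phi bi exP.
  exists 0%N, 1; split=> // k; exists 1; split.
  - exact: monic1.
  - exact: size_poly1.
  - move=> i; rewrite coef1; case: (i == 0%N); last by rewrite rnorm0.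
    by rewrite -[X in rnorm X](rmorph1 (real_complex R)) rnorm_real normr1.
  - by move=> y; rewrite big_ord_recl big_ord0 addr0 /= -(exP y) /expansion big_ord0 scaler0.
  - by move=> z; rewrite (negbTE (root1 _)).
pose M k : 'M[R[i]]_N.+1 := \matrix_(i, j) phi j (B k (e i)).
pose toY (u : 'rV[R[i]]_N.+1) : Y := \sum_i u 0 i *: e i.
have toYB k u : B k (toY u) = toY (u *m M k).
  rewrite /toY linear_sum/=.
  have -> : \sum_i B k (u 0 i *: e i) = \sum_i \sum_j (u 0 i * M k i j) *: e j.
    apply: eq_bigr => i _; rewrite bopZ -{1}(exP (B k (e i))) scaler_sumr.
    by apply: eq_bigr => j _; rewrite scalerA mxE.
  rewrite exchange_big /=; apply: eq_bigr => j _.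
  by rewrite mxE scaler_suml.
have [C hC] : exists C : R, forall k i j, rnorm (M k i j : R[i]^o) <= C.
  exists (\sum_i \sum_j bop_norm (phi j) * (`|Mb| * rnorm (e i))) => k i j.
  rewrite mxE; apply: le_trans (bop_norm_le _ _) _.
  have h0 i' j' : 0 <= bop_norm (phi j') * (`|Mb| * rnorm (e i')).
    by rewrite !mulr_ge0 ?bop_norm_ge0 ?rnorm_ge0.
  rewrite (bigD1 i)//= (bigD1 j)//= -addrA; apply: ler_wpDr.
    by rewrite addr_ge0 ?sumr_ge0// => i' _; rewrite sumr_ge0.
  rewrite ler_wpM2l ?bop_norm_ge0//; apply: le_trans (BM _ _) _.
  by rewrite ler_wpM2r ?rnorm_ge0// ler_norm.
have /choice[D hD] := char_poly_coef_bounded hC.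
exists N.+1, (\sum_(i < N.+2) `|D i|); split; first by rewrite sumr_ge0.
move=> k; exists (char_poly (M k)); split.
- exact: char_poly_monic.
- exact: size_char_poly.
- move=> i; have [iN|Ni] := ltnP i N.+2; last first.
    by rewrite nth_default ?size_char_poly// rnorm0 sumr_ge0.
  apply: le_trans (hD i k) _; rewrite (bigD1 (Ordinal iN))//=.
  by apply: ler_wpDr; rewrite ?sumr_ge0// ler_norm.
- move=> y; rewrite -(exP y) (_ : expansion e phi y = toY (\row_i phi i y)); last first.
    by apply: eq_bigr => i _; rewrite mxE.
  move: (\row_i _) => u.
  have it i : iter i (B k) (toY u) = toY (u *m (M k) ^+ i).
    elim: i => [|i IH] /=; first by rewrite expr0 mulmx1.
    by rewrite IH toYB exprSr mulmxA.
  have CH := Cayley_Hamilton (M k).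
  have toYD u1 u2 : toY (u1 + u2) = toY u1 + toY u2.
    by rewrite /toY -big_split; apply: eq_bigr => j _; rewrite mxE scalerDl.
  have toYZ c u1 : toY (c *: u1) = c *: toY u1.
    by rewrite /toY scaler_sumr; apply: eq_bigr => j _; rewrite mxE scalerA.
  have toY0 : toY 0 = 0 by rewrite -(scale0r (0 : 'rV_N.+1)) toYZ scale0r.
  transitivity (toY (u *m horner_mx (M k) (char_poly (M k)))); last by rewrite CH mulmx0.
  rewrite -{2}(coefK (char_poly (M k))) poly_def size_char_poly rmorph_sum /=.
  rewrite mulmx_sumr (big_morph _ toYD toY0); apply: eq_bigr => i _.
  by rewrite it horner_mxZ rmorphXn /= horner_mx_X -scalemxAr toYZ.
- move=> z; rewrite -eigenvalue_root_char => /eigenvalueP[v vM v0].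
  exists (toY v); last first.
    by rewrite toYB vM /toY scaler_sumr; apply: eq_bigr => i _; rewrite mxE scalerA.
  apply: contra_neq v0 => tv; apply/rowP => j; rewrite mxE.
  have : phi j (toY v) = 0 by rewrite tv linear0.
  rewrite linear_sum/= (bigD1 j)//= big1 => [|i ij]; last first.
    by rewrite bopZ bi eq_sym (negbTE ij) [LHS]mulr0.
  by rewrite addr0 bopZ bi eqxx => <-; rewrite [RHS]mulr1.
Qed.

End annihilator.

Lemma iter_cancel (T : Type) (f g : T -> T) (i d : nat) (x : T) : cancel g f ->
  iter i f (iter (i + d) g x) = iter d g x.
Proof.
move=> gK; by elim: i => // i IH; rewrite iterSr addSn iterS gK.
Qed.

Lemma finite_dimensional_disc_improve (R : realType) (Y : normedModType R[i])
    (K : Type) (B : K -> 'L(Y)) (eta r rho Mb : R) :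
  0 < eta -> 0 < r -> 0 < rho -> rho < eta -> rho < r ->
  (forall k y, rnorm (B k y) <= Mb * rnorm y) ->
  (forall k (z : R[i]), `|z| < r%:C -> coercive eta (B k - z *: bop_id)) ->
  finite_dimensional Y -> exists2 eta2, eta < eta2 & forall k, coercive eta2 (B k).
Proof.
move=> eta0 r0 rho0 rho_eta rho_r BM disc fdY.
have [N [C [C0 hp]]] := finite_dimensional_annihilator BM fdY.
apply: (finite_recursion_disc_improve eta0 r0 rho0 rho_eta rho_r disc C0 (N := N)).
move=> k Rk [BK KB] y; have [p [pm sp pC pB _]] := hp k.
exists (fun m => - p`_(rev_ord m)); first by move=> m; rewrite (@rnormN _ R[i]^o).
have itE i : (i <= N.+1)%N -> iter i (B k) (iter N.+1 Rk y) = iter (N.+1 - i) Rk y.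
  by move=> iN; rewrite -{1}(subnKC iN) iter_cancel.
(* At R^(N+1) y the relation p(B) = 0 reads: the sum of the p_i R^(N+1-i) y vanishes. The top term
   is R y because [p] is monic; the others are the powers R^2, ..., R^(N+1). *)
have := pB (iter N.+1 Rk y).
rewrite (eq_bigr (fun i : 'I_N.+1 => p`_i *: iter (N.+1 - i) Rk y)); last first.
  by move=> i _; rewrite itE// ltnW.
rewrite big_ord_recr /=; have -> : p`_N = 1 by have := monicP pm; rewrite lead_coefE sp.
rewrite scale1r subSnn addrC => /eqP; rewrite addr_eq0 => /eqP /= ->.
rewrite (reindex_inj rev_ord_inj) -sumrN /=; apply: eq_bigr => m _.
by rewrite scaleNr (_ : (N.+1 - (N - m.+1))%N = m.+2)//; have := ltn_ord m; lia.
Qed.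

(** Invertibility on the disc excludes eigenvalues of modulus below r, so |p(0)| >= r^N as the
    product of the moduli of the roots, and p(B) x = 0 expresses p(0) x through B x with bounded
    coefficients. *)
Lemma finite_dimensional_uniform_inverse (R : realType) (Y : normedModType R[i])
    (K : Type) (B : K -> 'L(Y)) (r Mb : R) : 0 < r -> 0 <= Mb ->
  (forall k y, rnorm (B k y) <= Mb * rnorm y) ->
  (forall k (z : R[i]), `|z| < r%:C -> invertible (B k - z *: bop_id)) ->
  finite_dimensional Y -> exists2 eta, 0 < eta & forall k, coercive eta (B k).
Proof.
move=> r0 Mb0 BM disc fdY.
have [N [C [C0 hp]]] := finite_dimensional_annihilator BM fdY.
pose Q := \sum_(i < N) C * Mb ^+ i.
have Q0 : 0 <= Q by rewrite sumr_ge0// => i _; rewrite mulr_ge0 ?exprn_ge0.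
have Q1 : 0 < Q + 1 by rewrite ltr_wpDl.
exists (r ^+ N / (Q + 1)); first by rewrite divr_gt0// exprn_gt0.
move=> k; split=> [|x].
  have := disc k 0; rewrite scale0r subr0; apply.
  by rewrite normr0 ltcR.
have [p [pm sp pC pB pz]] := hp k.
have p0 : r ^+ N <= rnorm (p`_0 : R[i]^o).
  have [s ps] := closed_field_poly_normal p.
  rewrite (monicP pm) scale1r in ps.
  have sN : size s = N by move: sp; rewrite ps size_prod_XsubC => -[].
  rewrite -horner_coef0 {1}ps horner_prod -lecR -rnormE normr_prod -sN rmorphXn/=.
  have sr : {in s, forall z, r%:C <= `|z|}.
    move=> z zs; rewrite (@rnormE _ R[i]^o) lecR leNgt; apply/negP => zr.
    have [|y yn0 By] := pz z; first by rewrite ps root_prod_XsubC.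
    have [|D [DK _]] := disc k z; first by rewrite (@rnormE _ R[i]^o) ltcR.
    move: yn0; rewrite -[y]DK -[(B k - _) y]/(B k y - z *: y) By subrr linear0.
    by rewrite eqxx.
  elim: s {ps sN} sr => [|z s IH] sr; first by rewrite big_nil expr0.
  rewrite big_cons /= exprS; apply: ler_pM; rewrite ?exprn_ge0 ?ler0c ?(ltW r0)//.
    by rewrite hornerXsubC sub0r normrN sr// mem_head.
  by apply: IH => u us; apply: sr; rewrite inE us orbT.
have iterM i y : rnorm (iter i (B k) y) <= Mb ^+ i * rnorm y.
  elim: i => [|i IH]; first by rewrite expr0 mul1r.
  by rewrite iterS exprS -mulrA; apply: le_trans (BM _ _) _; rewrite ler_wpM2l.
have h : r ^+ N * rnorm x <= Q * rnorm (B k x).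
  apply: (@le_trans _ _ (rnorm (p`_0 *: x))); first by rewrite rnormZ ler_wpM2r ?rnorm_ge0.
  have := pB x; rewrite big_ord_recl /= => /eqP; rewrite addr_eq0 => /eqP ->.
  rewrite rnormN /Q mulr_suml; apply: le_trans (rnorm_sum _ _ _) _.
  apply: ler_sum => i _; rewrite -mulrA rnormZ -iterS iterSr.
  by apply: ler_pM (pC _) (iterM _ _); exact: rnorm_ge0.
rewrite mulrAC ler_pdivrMr// mulrDr mulr1 mulrC.
by have := rnorm_ge0 (B k x); lra.
Qed.

(** * Uniform convexity of finite l2-sums *)

Section four_point_mean.
Variables (R : realType) (X : normedModType R[i]).
Implicit Types x y : X.

(** The mean of ||x + zeta y||^2 over the fourth roots of unity zeta. Squared norms add up over
    l^2-sums, so convexity in this form passes from the coordinates to X^n; the form with all norms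
    on the disc at most 1 does not do so directly. *)
Definition mean4 x y : R := (rnorm (x + y) ^+ 2 + rnorm (x - y) ^+ 2 +
  rnorm (x + 'i%C *: y) ^+ 2 + rnorm (x - 'i%C *: y) ^+ 2) / 4.

Lemma midpoint_le x y : 2 * rnorm x <= rnorm (x + y) + rnorm (x - y).
Proof.
have -> : 2 * rnorm x = rnorm ((x + y) + (x - y)).
  have -> : (x + y) + (x - y) = (2 : R)%:C *: x.
    by rewrite addrACA subrr addr0 rmorph_nat scaler_nat mulr2n.
  by rewrite rnormZr ger0_norm.
exact: rnormD.
Qed.

Lemma half_diff_le x y : 2 * rnorm y <= rnorm (x + y) + rnorm (x - y).
Proof.
have := midpoint_le y x; rewrite (addrC y) (rnorm_distC y); exact.
Qed.

Lemma mean4_ge x y : rnorm x ^+ 2 <= mean4 x y.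
Proof.
rewrite /mean4; have := midpoint_le x y; have := midpoint_le x ('i%C *: y).
have sqr_le (a p q : R) : 0 <= a -> 2 * a <= p + q -> 4 * a ^+ 2 <= 2 * (p ^+ 2 + q ^+ 2).
  move=> a0 h; have := sqr_ge0 (p - q).
  have : (2 * a) ^+ 2 <= (p + q) ^+ 2 by rewrite ler_sqr ?nnegrE; lra.
  lra.
by move=> /(sqr_le _ _ _ (rnorm_ge0 x)) h1 /(sqr_le _ _ _ (rnorm_ge0 x)) h2; lra.
Qed.

(** Each pair of opposite points contributes at least its share by the midpoint inequality, so a
    mean close to [rnorm x ^+ 2] leaves no room for a large norm at any of the four points. *)
Lemma mean4_points x y (sigma : R) : 0 <= sigma ->
  mean4 x y <= rnorm x ^+ 2 + sigma ^+ 2 / 2 ->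
  [/\ rnorm (x + y) <= rnorm x + 2 * sigma, rnorm (x - y) <= rnorm x + 2 * sigma,
      rnorm (x + 'i%C *: y) <= rnorm x + 2 * sigma
    & rnorm (x - 'i%C *: y) <= rnorm x + 2 * sigma].
Proof.
rewrite /mean4 => s0 h; have a0 := rnorm_ge0 x.
have half (p q u v : R) : 2 * rnorm x <= p + q -> 2 * rnorm x <= u + v ->
    p ^+ 2 + q ^+ 2 + u ^+ 2 + v ^+ 2 <= 4 * (rnorm x ^+ 2 + sigma ^+ 2 / 2) ->
    p <= rnorm x + 2 * sigma /\ q <= rnorm x + 2 * sigma.
  move=> h1 h2 h3.
  have k1 : (2 * rnorm x) ^+ 2 <= (p + q) ^+ 2 by rewrite ler_sqr ?nnegrE; lra.
  have k2 : (2 * rnorm x) ^+ 2 <= (u + v) ^+ 2 by rewrite ler_sqr ?nnegrE; lra.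
  have d1 : `|p - q| <= 2 * sigma.
    rewrite -ler_sqr ?nnegrE ?normr_ge0 ?mulr_ge0// real_normK ?num_real//.
    by have := sqr_ge0 (u - v); lra.
  have d2 : p + q <= 2 * (rnorm x + sigma).
    rewrite -ler_sqr ?nnegrE; [|lra|lra].
    have := sqr_ge0 (u - v); have := sqr_ge0 (p - q).
    have := mulr_ge0 a0 s0; lra.
  by move: d1; rewrite ler_norml => /andP[e1 e2]; split; lra.
have m1 := midpoint_le x y; have m2 := midpoint_le x ('i%C *: y).
have [] := half _ _ _ _ m1 m2 _; first by lra.
have [] := half _ _ _ _ m2 m1 _; first by lra.
by [].
Qed.

(** The disc of radius 1/2 lies in the convex hull of 1, -1, i and -i. *)
Lemma mean4_disc x y (M : R) (zeta : R[i]) : rnorm x <= M ->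
  rnorm (x + y) <= M -> rnorm (x - y) <= M ->
  rnorm (x + 'i%C *: y) <= M -> rnorm (x - 'i%C *: y) <= M ->
  `|zeta| <= 1 -> rnorm (x + zeta *: ((1 / 2 : R)%:C *: y)) <= M.
Proof.
move=> xM h1 h2 h3 h4 z1; pose s := complex.Re zeta / 2; pose t := complex.Im zeta / 2.
have half (c : R) : `|c|%:C <= `|zeta| -> `|c / 2| <= 1 / 2.
  move=> /le_trans/(_ z1); rewrite -(rmorph1 (real_complex R)) lecR => c1.
  by rewrite normrM (ger0_norm (x := 2^-1)) ?invr_ge0//; lra.
have hs : `|s| <= 1 / 2 by apply: half; exact: normc_ge_Re.
have ht : `|t| <= 1 / 2.
  apply: half; rewrite {1}normc_def lecR -sqrtr_sqr.
  by rewrite ler_wsqrtr// lerDr sqr_ge0.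
have seg (u v : X) (c : R) : rnorm (u + v) <= M -> rnorm (u - v) <= M ->
    rnorm (`|c|%:C *: u + c%:C *: v) <= `|c| * M.
  move=> uv1 uv2; have [c0|c0] := leP 0 c.
    rewrite (ger0_norm c0).
    have -> : c%:C *: u + c%:C *: v = c%:C *: (u + v) by rewrite scalerDr.
    by rewrite rnormZr ger0_norm// ler_wpM2l.
  rewrite (ltr0_norm c0); have -> : (- c)%:C *: u + c%:C *: v = (- c)%:C *: (u - v).
    by rewrite scalerBr rmorphN !scaleNr opprK.
  have nc : 0 <= - c by rewrite oppr_ge0 ltW.
  by rewrite rnormZr ger0_norm// ler_wpM2l.
have -> : x + zeta *: ((1 / 2 : R)%:C *: y) = (1 - `|s| - `|t|)%:C *: x +
    ((`|s|%:C *: x + s%:C *: y) + (`|t|%:C *: x + t%:C *: ('i%C *: y))).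
  have e1 : (1 - `|s| - `|t|)%:C *: x + (`|s|%:C *: x + `|t|%:C *: x) = x.
    rewrite -!scalerDl -!rmorphD/= -[RHS]scale1r -(rmorph1 (real_complex R)).
    by congr (_%:C *: _); lra.
  rewrite [X in _ = _ + X]addrACA [RHS]addrA e1 !scalerA -scalerDl.
  congr (_ + _ *: _); rewrite {1}[zeta]complexE /s /t mul1r !rmorphM/= mulrDl.
  by congr (_ + _); rewrite -mulrA mulrC.
have c0 : 0 <= 1 - `|s| - `|t| by lra.
apply: le_trans (rnormD _ _) _; rewrite rnormZr ger0_norm//.
apply: (@le_trans _ _ ((1 - `|s| - `|t|) * M + (`|s| * M + `|t| * M))); last by lra.
apply: lerD; first by rewrite ler_wpM2l.
by apply: le_trans (rnormD _ _) _; apply: lerD; apply: seg.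
Qed.

Lemma mean4_convex (eps : R) : complex_uniformly_convex X -> 0 < eps ->
  exists2 kappa, 0 < kappa & forall x y, rnorm x <= 1 -> eps <= rnorm y ->
    rnorm x ^+ 2 + kappa <= mean4 x y.
Proof.
(* Convexity will be applied to x / m and y / (2 m) with m <= 2, whence eps / 4. The choice of
   [sigma] makes the excess 2 sigma smaller than delta * rnorm x, where rnorm x >= eps / 2. *)
move=> cX e0; have [|delta0 d0 hd] := cX (eps / 4); first by rewrite divr_gt0.
pose delta := Num.min 1 delta0.
have dp : 0 < delta by rewrite lt_min ltr01.
have d1 : delta <= 1 by rewrite ge_min lexx.
have dd : delta <= delta0 by rewrite ge_min lexx orbT.
pose sigma := Num.min (1 / 2) (delta * eps / 8).
have de : 0 < delta * eps by rewrite mulr_gt0.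
have sp : 0 < sigma by rewrite lt_min; apply/andP; split; lra.
have s1 : sigma <= 1 / 2 by rewrite ge_min lexx.
have s2 : sigma <= delta * eps / 8 by rewrite ge_min lexx orbT.
have de1 : delta * eps <= eps by rewrite ler_piMl// ltW.
exists (sigma ^+ 2 / 2); first by rewrite divr_gt0// exprn_gt0.
move=> x y x1 ey; rewrite leNgt; apply/negP => /ltW h.
have [p1 p2 p3 p4] := mean4_points (ltW sp) h.
have a0 := rnorm_ge0 x; set m := rnorm x + 2 * sigma in p1 p2 p3 p4.
have m0 : 0 < m by rewrite /m; lra.
have m2 : m <= 2 by rewrite /m; lra.
have ae : eps / 2 <= rnorm x.
  have := half_diff_le x y; rewrite /m in p1 p2; lra.
have : rnorm (m^-1%:C *: x) <= 1 - delta0.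
  apply: (hd _ (m^-1%:C *: ((1 / 2 : R)%:C *: y))).
    rewrite !rnormZr ger0_norm ?invr_ge0 ?(ltW m0)// ger0_norm; last by lra.
    by rewrite ler_pdivlMl//; have := ler_wpM2r (ltW e0) m2; lra.
  move=> zeta z1; rewrite scalerA (mulrC zeta) -scalerA -scalerDr rnormZr.
  rewrite ger0_norm ?invr_ge0 ?(ltW m0)// ler_pdivrMl// mulr1.
  by apply: mean4_disc => //; rewrite /m; lra.
rewrite rnormZr ger0_norm ?invr_ge0 ?(ltW m0)// ler_pdivrMl// => k.
have k2 : rnorm x <= m * (1 - delta) by apply: le_trans k _; rewrite ler_pM2l//; lra.
have k3 : delta * (eps / 2) <= delta * rnorm x by rewrite ler_pM2l.
rewrite /m in k2; have := mulr_gt0 dp sp; lra.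
Qed.

End four_point_mean.

Section l2_sums.
Variables (R : realType) (X V : normedModType R[i]) (n : nat) (c : 'I_n -> V -> X).
Hypothesis n0 : (0 < n)%N.
Hypothesis cP : forall j (l : R[i]) u v, c j (l *: u + v) = l *: c j u + c j v.
Hypothesis cN : forall v, rnorm v ^+ 2 = \sum_j rnorm (c j v) ^+ 2.

Lemma l2_coord_le j v : rnorm (c j v) <= rnorm v.
Proof.
rewrite -ler_sqr ?nnegrE ?rnorm_ge0// cN (bigD1 j)//= lerDl.
by rewrite sumr_ge0// => i _; exact: sqr_ge0.
Qed.

Lemma l2_mean4 u v : mean4 u v = \sum_j mean4 (c j u) (c j v).
Proof.
have cD j x y : c j (x + y) = c j x + c j y by rewrite -[x in LHS]scale1r cP scale1r.
have cB j x y : c j (x - y) = c j x - c j y.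
  by rewrite addrC -scaleN1r cP scaleN1r addrC.
have c0 j : c j 0 = 0 by rewrite -(subrr 0) cB subrr.
have cZ j l x : c j (l *: x) = l *: c j x by rewrite -[_ *: x]addr0 cP c0 addr0.
rewrite /mean4 !cN -!big_split /= mulr_suml; apply: eq_bigr => j _.
have cNg x : c j (- x) = - c j x by rewrite -scaleN1r cZ scaleN1r.
by rewrite !cD !cNg !cZ.
Qed.

(** The coordinates [c] are abstract, so that one argument serves both X^n and its dual. *)
Lemma l2_uniformly_convex : complex_uniformly_convex X -> complex_uniformly_convex V.
Proof.
move=> cX eps e0; have np : 0 < n%:R :> R by rewrite ltr0n.
have [|kappa k0 hk] := mean4_convex cX (_ : 0 < eps / (2 * n%:R)).
  by rewrite divr_gt0// mulr_gt0.
exists (kappa / 2); first by rewrite divr_gt0.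
move=> x y ey h; have i1 : `|'i%C : R[i]| = 1.
  by rewrite normc_def /= expr0n expr1n /= add0r sqrtr1.
have sq (a : R) : 0 <= a -> a <= 1 -> a ^+ 2 <= 1 by move=> *; rewrite expr_le1.
have m1 : mean4 x y <= 1.
  have := h 1; have := h (-1); have := h 'i%C; have := h (- 'i%C).
  rewrite !scaleNr scale1r !normrN i1 normr1 lexx.
  do 4 (move=> /(_ isT)/(sq _ (rnorm_ge0 _)) ?); rewrite /mean4; lra.
have x1 : rnorm x <= 1 by have := h 0; rewrite scale0r addr0 normr0 ler01; exact.
(* By pigeonhole one coordinate of [y] is not small. It gains [kappa], and the others lose nothing
   by [mean4_ge]. *)
have [j ej] : exists j, eps / (2 * n%:R) <= rnorm (c j y).
  apply/existsP; apply: contraT; rewrite negb_exists => /forallP hj.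
  set q := eps / (2 * n%:R) in hj; have q0 : 0 < q by rewrite divr_gt0// mulr_gt0.
  have : eps ^+ 2 <= \sum_(j < n) q ^+ 2.
    apply: (@le_trans _ _ (rnorm y ^+ 2)); first by rewrite ler_sqr ?nnegrE ?rnorm_ge0// ltW.
    rewrite cN; apply: ler_sum => j _; have := hj j; rewrite -ltNge => /ltW hh.
    by rewrite ler_sqr ?nnegrE ?rnorm_ge0// ltW.
  rewrite sumr_const card_ord -mulr_natl.
  have -> : eps = 2 * n%:R * q by rewrite /q; field; rewrite gt_eqF.
  have n1 : 1 <= n%:R :> R by rewrite ler1n.
  have q2 : 0 < q ^+ 2 by rewrite exprn_gt0.
  rewrite leNgt (_ : (_ * q) ^+ 2 = n%:R * q ^+ 2 * (4 * n%:R)); last by ring.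
  have p0 : 0 < n%:R * q ^+ 2 by exact: mulr_gt0.
  have : 1 < 4 * n%:R :> R by lra.
  by rewrite -(ltr_pM2l p0) mulr1 => ->.
have : rnorm x ^+ 2 + kappa <= 1.
  apply: le_trans m1; rewrite l2_mean4 cN (bigD1 j)//= [leRHS](bigD1 j)//= addrAC.
  apply: lerD; last by apply: ler_sum => i _; exact: mean4_ge.
  by apply: hk => //; apply: le_trans x1; exact: l2_coord_le.
have := rnorm_ge0 x; move=> a0 hx.
rewrite -ler_sqr ?nnegrE//; have := sqr_ge0 (rnorm x); have := sqr_ge0 kappa; lra.
Qed.

End l2_sums.

(** * The space X^n and its dual *)

Section finite_l2.
Variables (R : realType) (X : normedModType R[i]) (n : nat).
Hypothesis n0 : (0 < n)%N.

Lemma ell2_ord_uniformly_convex :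
  complex_uniformly_convex X -> complex_uniformly_convex (ell2 'I_n X).
Proof.
apply: (l2_uniformly_convex (c := fun j (v : ell2 'I_n X) => v j)) => //.
exact: rnorm_ord_sqr.
Qed.

Definition coord_inj_fun (j : 'I_n) (v : X) : ell2 'I_n X :=
  Ell2 (ell2_ord_finite (fun i => if i == j then v else 0)).

Lemma rnorm_coord_inj j v : rnorm (coord_inj_fun j v) = rnorm v.
Proof.
apply/eqP; rewrite -(@eqrXn2 _ 2) ?rnorm_ge0// rnorm_ord_sqr (bigD1 j)//= eqxx.
by rewrite big1 ?addr0// => i /negbTE ->; rewrite rnorm0 expr0n.
Qed.

Lemma coord_inj_subproof j : coord_inj_fun j \in @bop_pred R X (ell2 'I_n X).
Proof.
apply/asboolP; split; last by exists 1 => v; rewrite mul1r rnorm_coord_inj.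
move=> l u v; apply: ell2_eqP => i; rewrite ell2D ell2Z /=.
by case: (i == j); rewrite ?scaler0 ?addr0.
Qed.

Definition coord_inj j : bop X (ell2 'I_n X) := Bop (coord_inj_subproof j).

Lemma coord_inj_sum (x : ell2 'I_n X) : x = \sum_j coord_inj j (x j).
Proof.
apply: ell2_eqP => i; rewrite ell2_sumE_coord (bigD1 i)//= eqxx big1 ?addr0// => j ji.
by rewrite eq_sym (negbTE ji).
Qed.

Lemma ell2_ord_finite_dimensional :
  finite_dimensional X -> finite_dimensional (ell2 'I_n X).
Proof.
move=> [m [f fP]]; pose J := ('I_n * 'I_m)%type.
exists #|{: J}|, (fun p => coord_inj (enum_val p).1 (f (enum_val p).2)) => x.
have /choice[d dP] := fun i => fP (x i).
exists (fun p => d (enum_val p).1 (enum_val p).2).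
pose G (q : J) := d q.1 q.2 *: coord_inj q.1 (f q.2).
rewrite -[RHS]/(\sum_p G (enum_val p)) -(big_enum_val G).
rewrite {1}(coord_inj_sum x).
rewrite -(pair_big predT predT (fun i l => d i l *: coord_inj i (f l))) /=.
apply: eq_bigr => i _; rewrite -[LHS]/(coord_inj i (x i)) {1}dP linear_sum.
by apply: eq_bigr => l _; exact: (bopZ (coord_inj i)).
Qed.

Lemma near_maximizer (psi : dual X) (e : R) : 0 < e ->
  exists (v : X) (t : R), [/\ rnorm v <= 1, psi v = t%:C & rnorm psi - e <= t].
Proof.
move=> e0; have [_ [v /= v1 <-] hv] := sup_adherent e0 (bop_has_sup psi).
have [w0|w0] := eqVneq (psi v) 0.
  by exists v, 0; split=> //; move: hv; rewrite w0 rnorm0 => /ltW.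
have nw : `|psi v| != 0 by rewrite normr_eq0.
exists ((`|psi v| / psi v) *: v), (rnorm (psi v)); split; last exact: ltW.
- rewrite rnormZ (_ : rnorm _ = 1) ?mul1r//; apply: (@complexI R).
  by rewrite -rnormE normrM normfV normr_id mulfV.
- by rewrite bopZ -rnormE; apply: divfK.
Qed.

(** The dual of an l^2-sum is the l^2-sum of the duals. For the lower bound [phi] is tested on the
    vector of the N_j v_j, with v_j only a near maximizer since the norm of a functional need not be
    attained. *)
Lemma dual_coord_norm (phi : dual (ell2 'I_n X)) :
  rnorm phi ^+ 2 = \sum_j rnorm (bop_comp phi (coord_inj j) : dual X) ^+ 2.
Proof.
set S := \sum_j _; pose N j : R := rnorm (bop_comp phi (coord_inj j) : dual X).
have S0 : 0 <= S by rewrite sumr_ge0// => j _; exact: sqr_ge0.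
have phiE x : phi x = \sum_j bop_comp phi (coord_inj j) (x j).
  by rewrite {1}(coord_inj_sum x) linear_sum.
pose s := Num.sqrt S; have ss : s ^+ 2 = S by rewrite sqr_sqrtr.
have s0 : 0 <= s by exact: sqrtr_ge0.
suff -> : rnorm phi = s by [].
apply/eqP; rewrite eq_le; apply/andP; split.
  apply: bop_norm_ub => x x1; rewrite phiE.
  apply: le_trans (@rnorm_sum _ R[i]^o _ _ _ _) _.
  apply: (@le_trans _ _ (\sum_j N j * rnorm (x j))).
    by apply: ler_sum => j _; exact: bop_norm_le.
  move: s0; rewrite le_eqVlt => /predU1P[s0|s0].
    rewrite -s0 big1// => j _; suff -> : N j = 0 by rewrite mul0r.
    apply/eqP; rewrite -sqrf_eq0 eq_le sqr_ge0 andbT -[leRHS](expr0n _ 2) s0 ss.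
    by rewrite /S (bigD1 j)//= lerDl sumr_ge0// => i _; exact: sqr_ge0.
  have : \sum_j N j * rnorm (x j) <= S * s^-1.
    apply: sum_mul_le => //; first by rewrite invr_ge0 ltW.
    rewrite -ss -exprMn mulfV ?gt_eqF// expr1n -rnorm_ord_sqr.
    by rewrite expr_le1 ?rnorm_ge0.
  by rewrite -ss expr2 mulfK ?gt_eqF.
move: s0; rewrite (le_eqVlt 0) => /predU1P[sz|s0].
  by rewrite -sz; exact: rnorm_ge0.
rewrite -(ler_pM2r s0) -expr2 ss; apply/ler_addgt0Pl => e e0.
pose e1 := e / (1 + \sum_j N j).
have N0 j : 0 <= N j by exact: rnorm_ge0.
have D0 : 0 < 1 + \sum_j N j by rewrite ltr_pwDl// sumr_ge0.
have e10 : 0 < e1 by rewrite divr_gt0.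
have /choice[v /choice[t vt]] := fun j => near_maximizer (bop_comp phi (coord_inj j)) e10.
pose x : ell2 'I_n X := Ell2 (ell2_ord_finite (fun j => (N j)%:C *: v j)).
have xs : rnorm x <= s.
  rewrite -ler_sqr ?nnegrE ?rnorm_ge0 ?(ltW s0)// ss rnorm_ord_sqr.
  apply: ler_sum => j _; rewrite ler_sqr ?nnegrE ?rnorm_ge0//= rnormZr ger0_norm//.
  by have [v1 _ _] := vt j; rewrite ler_piMr.
have phx : rnorm (phi x) = `|\sum_j N j * t j|.
  rewrite -rnorm_real rmorph_sum phiE; congr rnorm; apply: eq_bigr => j _.
  have [_ vtj _] := vt j; rewrite [x j]/= bopZ vtj rmorphM.
  by [].
have h1 : \sum_j N j * t j <= rnorm phi * s.
  apply: le_trans (ler_norm _) _; rewrite -phx; apply: le_trans (bop_norm_le _ _) _.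
  by rewrite ler_wpM2l// bop_norm_ge0.
have h2 : S <= \sum_j N j * t j + e1 * \sum_j N j.
  rewrite mulr_sumr -big_split; apply: ler_sum => j _ /=.
  by have [_ _ tj] := vt j; rewrite -/(N j) expr2 (mulrC e1) -mulrDr ler_wpM2l// -lerBlDr.
have h3 : e1 * \sum_j N j <= e.
  rewrite /e1 mulrAC ler_pdivrMr// mulrDr mulr1; lra.
lra.
Qed.

Lemma dual_ell2_ord_uniformly_convex :
  complex_uniformly_convex (dual X) -> complex_uniformly_convex (dual (ell2 'I_n X)).
Proof.
apply: (l2_uniformly_convex (c := fun j phi => bop_comp phi (coord_inj j) : dual X)) => //.
  by move=> j l u v; apply/val_inj/funext.
exact: dual_coord_norm.
Qed.

Lemma ell2_ord_globevnik : globevnik X -> globevnik (ell2 'I_n X).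
Proof.
by case=> h; [apply: Or31; exact: ell2_ord_finite_dimensional
  |apply: Or32; exact: ell2_ord_uniformly_convex
  |apply: Or33; exact: dual_ell2_ord_uniformly_convex].
Qed.

End finite_l2.

(** * The inclusions *)

Section inclusion.
Variables (R : realType) (X : completeNormedModType R[i]) (n : nat).
Variables (alpha beta gamma a c : int -> 'L(X)) (A : 'L(ell2 int X)).
Hypothesis n0 : (0 < n)%N.
Hypothesis triA : tridiagonal alpha beta gamma A.

Lemma sup_norm_ub (b : int -> 'L(X)) k : bounded_seq b -> rnorm (b k) <= sup_norm b.
Proof. by move=> bb; apply: ub_le_sup => //; exists k. Qed.

Lemma sup_norm_ge0 (b : int -> 'L(X)) : bounded_seq b -> 0 <= sup_norm b.
Proof. by move=> bb; apply: le_trans (sup_norm_ub 0 bb); exact: rnorm_ge0. Qed.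

Lemma op_bound_sup_norm (b : int -> 'L(X)) (M : R) : bounded_seq b -> sup_norm b <= M ->
  op_bound M b.
Proof.
move=> bb bM k v; apply: le_trans (bop_norm_le _ _) _; rewrite ler_wpM2r ?rnorm_ge0//.
by apply: le_trans bM; exact: sup_norm_ub.
Qed.

Lemma tridiagonal_sub (l : R[i]) :
  tridiagonal alpha (fun k => beta k - l *: bop_id) gamma (A - l *: bop_id).
Proof.
move=> x i; rewrite -[LHS]/(A x i - l *: x i) triA.
rewrite -[X in _ = _ + X + _]/(beta i (x i) - l *: x i).
by rewrite [X in _ = X + _]addrA [LHS]addrAC.
Qed.

Lemma corner_section_sub (l : R[i]) k :
  corner_section alpha beta gamma a c n k - l *: bop_id =
  corner_section alpha (fun i => beta i - l *: bop_id) gamma a c n k.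
Proof.
apply/val_inj/funext => z; apply: ell2_eqP => j.
rewrite -[LHS]/(corner_section alpha beta gamma a c n k z j - l *: z j).
rewrite -[RHS]/(corner_section alpha (fun i => beta i - l *: bop_id) gamma a c n k z j).
rewrite !corner_sectionE.
rewrite -[X in _ = _ + X + _]/(beta (k + j.+1%:Z) (z j) - l *: z j).
by rewrite [X in _ = X + _]addrA [LHS]addrAC.
Qed.

Hypotheses (ba : bounded_seq alpha) (bb : bounded_seq beta) (bg : bounded_seq gamma).
Hypotheses (ba' : bounded_seq a) (bc : bounded_seq c).
Hypotheses (aa : sup_norm a <= sup_norm alpha) (cc : sup_norm c <= sup_norm gamma).

Lemma coercive_inclusion (l : R[i]) (eta : R) : eps' alpha gamma n < eta ->
  (forall k, coercive eta (corner_section alpha beta gamma a c n k - l *: bop_id)) ->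
  coercive (eta - eps' alpha gamma n) (A - l *: bop_id).
Proof.
move=> e'eta hB.
apply: (coercive_tridiagonal n0 (sup_norm_ge0 ba) (sup_norm_ge0 bg)
  (op_bound_sup_norm ba (lexx _)) (op_bound_sup_norm ba' aa)
  (op_bound_sup_norm bg (lexx _)) (op_bound_sup_norm bc cc) (tridiagonal_sub l)) => // k.
by rewrite -corner_section_sub.
Qed.

Lemma spec_inclusion (eps : R) : 0 < eps ->
  spec eps A `<=` pi_ac alpha beta gamma a c n (eps + eps' alpha gamma n).
Proof.
move=> e0 l lA; apply: contrapT => lpi.
have s0 : 0 <= sin (pi / (2 * n%:R)) :> R by exact/ltW/sin_angle_gt0.
have e'0 : 0 <= eps' alpha gamma n.
  by rewrite !mulr_ge0// addr_ge0// sup_norm_ge0.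
have ee : 0 < eps + eps' alpha gamma n by rewrite ltr_pwDl.
apply: (specNE A l e0).2 lA; rewrite -(addrK (eps' alpha gamma n) eps).
apply: coercive_inclusion => [|k]; first by rewrite ltrDr.
by apply/specNE => // lk; apply: lpi; exists k.
Qed.

Lemma corner_section_bounded : exists2 M : R, 0 <= M & forall k z,
  rnorm (corner_section alpha beta gamma a c n k z) <= M * rnorm z.
Proof.
have [al0 be0 ga0] := And3 (sup_norm_ge0 ba) (sup_norm_ge0 bb) (sup_norm_ge0 bg).
exists (\sum_(j < n) (sup_norm alpha + sup_norm beta + sup_norm gamma)).
  by rewrite sumr_ge0// => j _; rewrite !addr_ge0.
move=> k z; apply: le_trans (ell2_ord_norm_le _) _; rewrite mulr_suml.
apply: ler_sum => j _; rewrite corner_sectionE !mulrDl.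
have zM (b : 'L(X)) (M : R) i : 0 <= M -> (forall v, rnorm (b v) <= M * rnorm v) ->
    rnorm (b (z i)) <= M * rnorm z.
  by move=> M0 bM; apply: le_trans (bM _) _; rewrite ler_wpM2l//; exact: ell2_norm_coord.
apply: le_trans (rnormD _ _) _; apply: lerD.
  apply: le_trans (rnormD _ _) _; apply: lerD; apply: zM => // v.
    rewrite /upper_op; case: ifP => _.
      exact: op_bound_sup_norm ba' aa _ _.
    exact: op_bound_sup_norm ba (lexx _) _ _.
  exact: op_bound_sup_norm bb (lexx _) _ _.
apply: zM => // v; rewrite /lower_op; case: ifP => _.
  exact: op_bound_sup_norm bc cc _ _.
exact: op_bound_sup_norm bg (lexx _) _ _.
Qed.

Lemma closureN_disc (S : set R[i]^o) (l : R[i]^o) : ~ closure S l ->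
  exists2 r : R, 0 < r & forall m : R[i]^o, `|m - l| < r%:C -> ~ S m.
Proof.
move=> /existsNP[U /not_implyP[/nbhs_ballP[e /= e0 eU] SU]].
have eR : e = (complex.Re e)%:C by move: e0; case: (e) => x y; rewrite ltcE/= => /andP[/eqP->].
exists (complex.Re e); first by rewrite eR ltcR in e0.
move=> m; rewrite -eR => ml Sm; apply: SU; exists m; split=> //.
by apply: eU; rewrite -ball_normE /= distrC.
Qed.

End inclusion.

Lemma globevnik_disc_improve (R : realType) (Y : normedModType R[i])
    (K : Type) (B : K -> 'L(Y)) (eta r Mb : R) :
  0 < eta -> 0 < r -> 0 <= Mb ->
  (forall k y, rnorm (B k y) <= Mb * rnorm y) ->
  (forall k (z : R[i]), `|z| < r%:C -> coercive eta (B k - z *: bop_id)) ->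
  globevnik Y -> exists2 eta2, eta < eta2 & forall k, coercive eta2 (B k).
Proof.
move=> eta0 r0 Mb0 BM disc; have m0 : 0 < Num.min r eta by rewrite lt_min r0.
have re : Num.min r eta <= eta by rewrite ge_min lexx orbT.
have rr : Num.min r eta <= r by rewrite ge_min lexx.
have h1 : 0 < Num.min r eta / 2 by rewrite divr_gt0.
have h2 : Num.min r eta / 2 < eta by lra.
have h3 : Num.min r eta / 2 < r by lra.
case=> hY.
- exact: finite_dimensional_disc_improve h1 h2 h3 BM disc hY.
- exact: convex_disc_improve h1 h2 h3 BM disc hY.
- exact: dual_convex_disc_improve h1 h2 h3 BM disc hY.
Qed.

(** If eps + eps' = 0, then alpha = gamma = 0 and [Spec] is the spectrum, which yields no bound on
    the inverses to be improved. On an infinite-dimensional X the inclusion can then fail: if the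
    beta_k are Jordan blocks of growing size, extended by 0, all sections have spectrum {0} while
    Spec A contains the unit disc. In finite dimension the eigenvalues supply the uniform bound;
    hence the disjunction. *)
Lemma Spec_inclusion (R : realType) (X : completeNormedModType R[i]) (n : nat)
    (alpha beta gamma a c : int -> 'L(X)) (A : 'L(ell2 int X)) (eps : R) :
  (0 < n)%N -> tridiagonal alpha beta gamma A ->
  bounded_seq alpha -> bounded_seq beta -> bounded_seq gamma ->
  bounded_seq a -> bounded_seq c ->
  sup_norm a <= sup_norm alpha -> sup_norm c <= sup_norm gamma ->
  globevnik X -> 0 <= eps ->
  0 < eps + eps' alpha gamma n \/ finite_dimensional X ->
  Spec eps A `<=` Pi_ac alpha beta gamma a c n (eps + eps' alpha gamma n).
Proof.
move=> n0 triA ba bb bg ba' bc aa cc gX e0 hfd l lA; apply: contrapT => lPi.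
have s0 : 0 <= sin (pi / (2 * n%:R)) :> R by exact/ltW/sin_angle_gt0.
have e'0 : 0 <= eps' alpha gamma n.
  by rewrite !mulr_ge0// addr_ge0// sup_norm_ge0.
set eta := eps + _ in hfd lPi; have eta_ge0 : 0 <= eta by rewrite addr_ge0.
have [r r0 hr] := closureN_disc lPi.
pose B k : 'L(ell2 'I_n X) := corner_section alpha beta gamma a c n k - l *: bop_id.
have SpecB k (z : R[i]) : `|z| < r%:C ->
    ~ Spec eta (corner_section alpha beta gamma a c n k) (l + z).
  by move=> zr kz; apply: (hr (l + z)); [rewrite addrC addKr | exists k].
have Bz k (z : R[i]) : B k - z *: bop_id =
    corner_section alpha beta gamma a c n k - (l + z) *: bop_id.
  by rewrite scalerDl opprD addrA.
have [M0 M00 hM0] := corner_section_bounded n ba bb bg ba' bc aa cc.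
pose M := M0 + rnorm (l : R[i]^o); have Mp : 0 <= M by rewrite addr_ge0// rnorm_ge0.
have BM k y : rnorm (B k y) <= M * rnorm y.
  rewrite -[B k y]/(corner_section alpha beta gamma a c n k y - l *: y).
  by apply: le_trans (rnormB _ _) _; rewrite mulrDl rnormZ lerD2r.
have [eta2 e2 hB] : exists2 eta2, eta < eta2 & forall k, coercive eta2 (B k).
  have [eta0|eta_le0] := ltP 0 eta.
    apply: (globevnik_disc_improve eta0 r0 Mp BM) (ell2_ord_globevnik n0 gX) => k z zr.
    by rewrite Bz; apply: SpecN_coercive eta0 _; exact: SpecB.
  have etaE : eta = 0 by apply/eqP; rewrite eq_le eta_le0.
  have fdX : finite_dimensional X by case: hfd => //; rewrite etaE ltxx.
  rewrite etaE; apply: (finite_dimensional_uniform_inverse r0 Mp BM) => [k z zr|].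
    rewrite Bz; apply: contrapT => ninv; apply: (SpecB k z zr).
    by rewrite /Spec etaE eqxx.
  exact: ell2_ord_finite_dimensional.
have e'2 : eps' alpha gamma n < eta2 by apply: le_lt_trans e2; rewrite lerDr.
apply: coercive_SpecN e0 _ (coercive_inclusion n0 triA ba bg ba' bc aa cc e'2 hB) lA.
by rewrite ltrBrDr.
Qed.

(** * Periodic corners *)

Section periodic.
Variables (R : realType) (X : normedModType R[i]) (t : R[i]).
Hypothesis t1 : `|t| = 1.

Lemma per_aE (alpha : int -> 'L(X)) k : rnorm (per_a alpha t k) = rnorm (alpha k).
Proof.
rewrite rnormZ (_ : rnorm _ = 1) ?mul1r//; apply: (@complexI R).
by rewrite -(@rnormE _ R[i]^o) t1.
Qed.

Lemma per_cE (gamma : int -> 'L(X)) (n : nat) k :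
  rnorm (per_c gamma n t k) = rnorm (gamma (k + n%:Z + 1)).
Proof.
rewrite rnormZ (_ : rnorm _ = 1) ?mul1r//; apply: (@complexI R).
by rewrite -(@rnormE _ R[i]^o) norm_conjC t1.
Qed.

Lemma per_a_sup (alpha : int -> 'L(X)) : bounded_seq alpha ->
  bounded_seq (per_a alpha t) /\ sup_norm (per_a alpha t) <= sup_norm alpha.
Proof.
rewrite /bounded_seq /sup_norm (_ : (fun j => _) = (fun j => rnorm (alpha j))) => [ba|].
  by split.
by apply/funext => k; rewrite per_aE.
Qed.

Lemma per_c_sup (gamma : int -> 'L(X)) (n : nat) : bounded_seq gamma ->
  bounded_seq (per_c gamma n t) /\ sup_norm (per_c gamma n t) <= sup_norm gamma.
Proof.
move=> bg; have ub k : rnorm (per_c gamma n t k) <= sup_norm gamma.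
  by rewrite per_cE; apply: ub_le_sup => //; exists (k + n%:Z + 1).
split; first by exists (sup_norm gamma) => _ [k _ <-].
apply: ge_sup; first by exists (rnorm (per_c gamma n t 0)), 0.
by move=> _ [k _ <-].
Qed.

End periodic.

Theorem corollary4p5 (R : realType) (X : completeNormedModType R[i]) (n : nat)
    (alpha beta gamma : int -> 'L(X)) (A : 'L(ell2 int X)) :
  (0 < n)%N ->
  bounded_seq alpha -> bounded_seq beta -> bounded_seq gamma ->
  tridiagonal alpha beta gamma A ->
  (forall a c : int -> 'L(X),
    bounded_seq a -> bounded_seq c ->
    sup_norm a <= sup_norm alpha -> sup_norm c <= sup_norm gamma ->
    (forall eps : R, 0 < eps ->
      spec eps A `<=` pi_ac alpha beta gamma a c n (eps + eps' alpha gamma n)) /\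
    (globevnik X -> forall eps : R, 0 <= eps ->
      0 < eps + eps' alpha gamma n \/ finite_dimensional X ->
      Spec eps A `<=` Pi_ac alpha beta gamma a c n (eps + eps' alpha gamma n))) /\
  (forall t : R[i], `|t| = 1 ->
    (forall eps : R, 0 < eps ->
      spec eps A `<=` pi_per alpha beta gamma t n (eps + eps' alpha gamma n)) /\
    (globevnik X -> forall eps : R, 0 <= eps ->
      0 < eps + eps' alpha gamma n \/ finite_dimensional X ->
      Spec eps A `<=` Pi_per alpha beta gamma t n (eps + eps' alpha gamma n))).
Proof.
move=> n0 ba bb bg triA.
have main a c : bounded_seq a -> bounded_seq c ->
    sup_norm a <= sup_norm alpha -> sup_norm c <= sup_norm gamma ->
    (forall eps : R, 0 < eps ->
      spec eps A `<=` pi_ac alpha beta gamma a c n (eps + eps' alpha gamma n)) /\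
    (globevnik X -> forall eps : R, 0 <= eps ->
      0 < eps + eps' alpha gamma n \/ finite_dimensional X ->
      Spec eps A `<=` Pi_ac alpha beta gamma a c n (eps + eps' alpha gamma n)).
  move=> ba' bc aa cc; split=> [eps e0|gX eps e0 hfd].
    exact: spec_inclusion.
  exact: Spec_inclusion.
split=> // t t1.
have [ba' aa] := per_a_sup t1 ba; have [bc cc] := per_c_sup t1 n bg.
exact: main ba' bc aa cc.
Qed.
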